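(* Let $0\le\lambda\le\rho<\frac\pi2$ with $\rho>0$ and $\lambda\le\frac\pi2-\rho$. Then $$\gamma^s_\lambda(\rho)\ge\begin{cases}R_1^s(y^s_{min}(\lambda)), & \text{if }\lambda\le\rho\le x_1^s(y^s_{min}(\lambda)),\\ R_1^s\big(x_1^s|_{S_1}^{-1}(\rho)\big), & \text{if }x_1^s(y^s_{min}(\lambda))<\rho\le\min\{y_s^s(\lambda),\frac\pi4\},\\ R^s_{reg}(\rho), & \text{if } y_s^s(\lambda)<\rho\le y_b^s(\lambda),\\ R_2^s(\rho), & \text{if }\rho>\frac\pi4,\text{ and }\big(\rho<y_s^s(\lambda)\text{ or }\rho>y_b^s(\lambda)\big),\end{cases}$$ where each case is asserted whenever the triangle appearing in it is defined (and if $\lambda>\arcsin\frac35$, the condition of the second case reads $x_1^s(y^s_{min}(\lambda))<\rho\le\frac\pi4$, the third case is void, and the condition of the fourth case reads $\rho>\frac\pi4$). Furthermore, in the first, second, third and fourth case of this bound on $\gamma^s_\lambda(\rho)$ we have equality if and only if there is a $\lambda$-separable packing $\mathcal F$ of spherical caps of radius $\rho$ whose Delaunay triangles tile $\mathbb{S}^2$ and are congruent to $T_1^s(y^s_{min}(\lambda))$, $T_1^s(x_1^s|_{S_1}^{-1}(\rho))$, $T^s_{reg}(\rho)$, or $T_2^s(\rho)$, respectively.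
   Context: $\mathbb{S}^2$ is the unit sphere (curvature $1$) with geodesic distance; lines are great circles; a spherical cap is a closed geodesic disk. A packing of caps is a family of caps with pairwise disjoint interiors. For $0\le\lambda\le\rho$, a packing $\mathcal P$ of caps of radius $\rho$ is $\lambda$-separable if the family $\mathcal P'$ of caps of radius $\lambda$ concentric to the caps of $\mathcal P$ is totally separable, i.e. any two caps of $\mathcal P'$ can be separated by a line which is disjoint from the interior of every cap of $\mathcal P'$ (separated: lying in different closed hemispheres bounded by it). $\gamma^s_\lambda(\rho)$ is the smallest $r>0$ such that there is a $\lambda$-separable packing $\mathcal P$ of caps of radius $\rho$ in $\mathbb{S}^2$ for which the caps of radius $r$ concentric to the caps of $\mathcal P$ cover $\mathbb{S}^2$. For $0<\lambda<\frac\pi4$ and $\arcsin\tan\lambda\le y\le\frac\pi2$ put $$x_1^s(y)=\tfrac12\arcsin\frac{\cos\lambda\,\sin^2y}{\sqrt{\sin^2y-\sin^2\lambda}},\qquad x_2^s(y)=\tfrac\pi2-x_1^s(y).$$ The function $x_1^s$ is strictly decreasing on $S_1=[\arcsin\tan\lambda,\arcsin(\sqrt2\sin\lambda)]$, from $\frac\pi4$ to $\lambda$; $x_1^s|_{S_1}^{-1}$ is the inverse of its restriction to $S_1$. For $i=1,2$ and $y<\frac\pi2$, $T_i^s(y)$ is the spherical isosceles triangle of edge lengths $2y,2x_i^s(y),2x_i^s(y)$, and $R_i^s(y)$ is its circumradius (defined only for $0<\lambda<\frac\pi4$, $\arcsin\tan\lambda\le y<\frac\pi2$). $T^s_{reg}(\rho)$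 is the regular spherical triangle of edge length $2\rho$ and $R^s_{reg}(\rho)$ its circumradius. For $0\le\lambda\le\arcsin\frac35$ put $$y_s^s(\lambda)=\arcsin\sqrt{\tfrac{3+5\sin^2\lambda-\sqrt{9-34\sin^2\lambda+25\sin^4\lambda}}{8}},\qquad y_b^s(\lambda)=\arcsin\sqrt{\tfrac{3+5\sin^2\lambda+\sqrt{9-34\sin^2\lambda+25\sin^4\lambda}}{8}}$$ (so $y_s^s(0)=0$, $y_b^s(0)=\frac\pi3$). For $0<\lambda<\frac\pi2$ put, with $L=\sin\lambda$ and $A=100L^6-36L^4+12\sqrt{-375L^{12}+750L^{10}-471L^8+96L^6}$, $$y^s_{min}(\lambda)=\arcsin\left(\frac16\sqrt{6A^{1/3}-\frac{216\left(-\frac{10}{9}L^4+\frac23L^2\right)}{A^{1/3}}+60L^2}\right).$$ For $\lambda=0$ the first two cases are void. The Delaunay triangles of a packing are the triangular cells of the Delaunay decomposition defined by the set $X$ of centers: the edge-to-edge tiling of $\operatorname{conv}(X)$ by convex spherical polygons with vertices in $X$ such that the circumdisk of each tile contains no point of $X$ in its interior and only the vertices of the tile on its boundary. *)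

(* Defs.v *)
From HB Require Import structures.
From mathcomp Require Import all_boot all_order all_algebra.
From mathcomp Require Import all_classical all_reals all_analysis.

Set Implicit Arguments.
Unset Strict Implicit.
Unset Printing Implicit Defensive.

Import Order.TTheory GRing.Theory Num.Theory.

Local Open Scope classical_set_scope.
Local Open Scope ring_scope.

(** * The unit sphere, with its geodesic distance *)

Definition dot (R : realType) (u v : 'rV[R]_3) : R := \sum_i u 0 i * v 0 i.

Definition S2 (R : realType) : set 'rV[R]_3 := [set p | dot p p = 1].
Arguments S2 {R}.

Definition sdist (R : realType) (p q : 'rV[R]_3) : R := acos (dot p q).

Definition cap (R : realType) (c : 'rV[R]_3) (r : R) : set 'rV[R]_3 :=
  [set p | S2 p /\ sdist c p <= r].

(** The interior relative to the sphere. *)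
Definition sinterior (R : realType) (A : set 'rV[R]_3) : set 'rV[R]_3 :=
  [set p | S2 p /\
    exists2 e : R, 0 < e & [set q | S2 q /\ sdist p q < e] `<=` A].

(** A line and its two closed hemispheres are given by a unit normal [n]; the
    second hemisphere is [hemisphere (- n)]. *)
Definition line (R : realType) (n : 'rV[R]_3) : set 'rV[R]_3 :=
  [set p | S2 p /\ dot n p = 0].

Definition hemisphere (R : realType) (n : 'rV[R]_3) : set 'rV[R]_3 :=
  [set p | S2 p /\ 0 <= dot n p].

(** * Packings *)

(** A packing of caps of radius [rho] is represented by its set of centers: as
    [rho > 0] in all uses, disjointness of the interiors makes the caps of the
    family pairwise different. *)
Definition packing (R : realType) (rho : R) (X : set 'rV[R]_3) : Prop :=
  X `<=` S2 /\ trivIset X (fun x => sinterior (cap x rho)).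

Definition totally_separable (R : realType) (lambda : R)
    (X : set 'rV[R]_3) : Prop :=
  forall x y, X x -> X y -> x <> y ->
    exists n, [/\ S2 n,
      cap x lambda `<=` hemisphere n,
      cap y lambda `<=` hemisphere (- n) &
      forall z, X z -> line n `&` sinterior (cap z lambda) = set0].

Definition separable_packing (R : realType) (lambda rho : R)
    (X : set 'rV[R]_3) : Prop :=
  packing rho X /\ totally_separable lambda X.

Definition covering_radii (R : realType) (lambda rho : R) : set R :=
  [set r | 0 < r /\ exists2 X : set 'rV[R]_3,
    separable_packing lambda rho X & S2 `<=` \bigcup_(x in X) cap x r].

(** The smallest element itself, not the infimum; the default value [0] is
    taken only if there is no smallest element. *)
Definition gamma (R : realType) (lambda rho : R) : R :=
  xget 0 [set r | covering_radii lambda rho r /\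
                  lbound (covering_radii lambda rho) r].

(** * Spherical polygons, given by their vertex sets *)

(** Spherical convex hull: the part of the sphere in the convex cone spanned
    by [V]. *)
Definition sconv (R : realType) (V : set 'rV[R]_3) : set 'rV[R]_3 :=
  [set p | S2 p /\ exists n (v : 'I_n -> 'rV[R]_3) (a : 'I_n -> R),
    (forall i, V (v i) /\ 0 <= a i) /\ p = \sum_i a i *: v i].

(** [V] is the vertex set of a nondegenerate convex spherical polygon, the
    polygon itself being [sconv V]. *)
Definition convex_polygon (R : realType) (V : set 'rV[R]_3) : Prop :=
  [/\ finite_set V, V `<=` S2,
    exists2 n, S2 n & forall v, V v -> 0 < dot n v,
    ~ (exists2 n, S2 n & V `<=` line n) &
    forall v, V v -> ~ sconv (V `\ v) v].

Definition polygon_edge (R : realType) (V : set 'rV[R]_3)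
    (a b : 'rV[R]_3) : Prop :=
  [/\ V a, V b, a <> b &
    exists n, [/\ S2 n, dot n a = 0, dot n b = 0 &
      forall v, V v -> v <> a -> v <> b -> 0 < dot n v]].

(** Of the two complementary disks bounded by the circle through [V], this is
    the one containing the polygon. *)
Definition circumdisk (R : realType) (V : set 'rV[R]_3)
    (c : 'rV[R]_3) (r : R) : Prop :=
  [/\ S2 c, 0 <= r <= pi, forall v, V v -> sdist c v = r &
      sconv V `<=` cap c r].

Definition congruent (R : realType) (A B : set 'rV[R]_3) : Prop :=
  exists2 Q : 'M[R]_3, Q *m Q^T = 1%:M & (fun p => p *m Q) @` A = B.

(** * Delaunay decomposition *)

(** A family of tiles is a set [D] of vertex sets. *)
Definition tiling (R : realType) (D : set (set 'rV[R]_3))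
    (A : set 'rV[R]_3) : Prop :=
  \bigcup_(V in D) sconv V = A /\ trivIset D (fun V => sinterior (sconv V)).

Definition edge_to_edge (R : realType) (D : set (set 'rV[R]_3)) : Prop :=
  forall V W, D V -> D W -> V <> W ->
    [\/ sconv V `&` sconv W = set0,
        exists2 a, V a /\ W a & sconv V `&` sconv W = [set a] |
        exists a b, [/\ polygon_edge V a b, polygon_edge W a b &
                        sconv V `&` sconv W = sconv [set a; b]]].

Definition delaunay (R : realType) (X : set 'rV[R]_3)
    (D : set (set 'rV[R]_3)) : Prop :=
  [/\ forall V, D V -> convex_polygon V /\ V `<=` X,
      tiling D (sconv X), edge_to_edge D &
      forall V, D V -> exists c r, [/\ circumdisk V c r,
        X `&` sinterior (cap c r) = set0 &
        forall x, X x -> sdist c x = r -> V x]].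

(** Vertices of a nondegenerate polygon are not collinear, so [u], [v] and [w]
    are then distinct. *)
Definition triangular (R : realType) (V : set 'rV[R]_3) : Prop :=
  exists u v w, V = [set u; v; w].

(** * Triangles with given edge lengths *)

(** All (mutually congruent) triangles of edge lengths [a], [b], [c]. *)
Definition triangles (R : realType) (a b c : R) : set (set 'rV[R]_3) :=
  [set V | convex_polygon V /\ exists u v w, [/\ V = [set u; v; w],
    sdist u v = a, sdist v w = b & sdist w u = c]].

(** The common circumradius of the members of a congruence class. *)
Definition circumradius (R : realType) (T : set (set 'rV[R]_3)) : R :=
  xget 0 [set r | exists V c, T V /\ circumdisk V c r].

Definition Delaunay_tiles_congruent_to (R : realType)
    (T : set (set 'rV[R]_3)) (X : set 'rV[R]_3) : Prop :=
  exists2 D, delaunay X D &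
    tiling (D `&` @triangular R) S2 /\
    forall V, D V -> triangular V ->
      exists2 W, T W & congruent (sconv V) (sconv W).

Definition x1s (R : realType) (lambda y : R) : R :=
  2^-1 * asin (cos lambda * sin y ^+ 2 /
               Num.sqrt (sin y ^+ 2 - sin lambda ^+ 2)).

Definition x2s (R : realType) (lambda y : R) : R := pi / 2 - x1s lambda y.

Definition S1 (R : realType) (lambda : R) : set R :=
  [set y | asin (tan lambda) <= y <= asin (Num.sqrt 2 * sin lambda)].

Definition x1s_inv (R : realType) (lambda : R) : R -> R :=
  'pinv_(fun=> 0) (S1 lambda) (x1s lambda).

(** [T1s], [T2s] and [Tregs] are the congruence classes of the triangles of the
    same name; the class is empty exactly when the triangle is not defined. *)
Definition Ts_domain (R : realType) (lambda y : R) : Prop :=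
  0 < lambda < pi / 4 /\ asin (tan lambda) <= y < pi / 2.

Definition T1s (R : realType) (lambda y : R) : set (set 'rV[R]_3) :=
  [set V | Ts_domain lambda y /\
    triangles (2 * y) (2 * x1s lambda y) (2 * x1s lambda y) V].

Definition T2s (R : realType) (lambda y : R) : set (set 'rV[R]_3) :=
  [set V | Ts_domain lambda y /\
    triangles (2 * y) (2 * x2s lambda y) (2 * x2s lambda y) V].

Definition Tregs (R : realType) (rho : R) : set (set 'rV[R]_3) :=
  triangles (2 * rho) (2 * rho) (2 * rho).

Definition yss (R : realType) (lambda : R) : R :=
  let L := sin lambda in
  asin (Num.sqrt ((3 + 5 * L ^+ 2
    - Num.sqrt (9 - 34 * L ^+ 2 + 25 * L ^+ 4)) / 8)).

Definition ybs (R : realType) (lambda : R) : R :=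
  let L := sin lambda in
  asin (Num.sqrt ((3 + 5 * L ^+ 2
    + Num.sqrt (9 - 34 * L ^+ 2 + 25 * L ^+ 4)) / 8)).

(** [A > 0] for [0 < lambda < pi / 2], so that [powR] is the real cube root. *)
Definition ymins (R : realType) (lambda : R) : R :=
  let L := sin lambda in
  let A := 100 * L ^+ 6 - 36 * L ^+ 4
    + 12 * Num.sqrt (- 375 * L ^+ 12 + 750 * L ^+ 10 - 471 * L ^+ 8
                     + 96 * L ^+ 6) in
  let A3 := A `^ 3^-1 in
  asin (6^-1 * Num.sqrt (6 * A3
    - 216 * (- (10 / 9) * L ^+ 4 + 2 / 3 * L ^+ 2) / A3 + 60 * L ^+ 2)).

Definition sharp_bound (R : realType) (lambda rho : R)
    (T : set (set 'rV[R]_3)) : Prop :=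
  circumradius T <= gamma lambda rho /\
  (gamma lambda rho = circumradius T <->
   exists2 F, separable_packing lambda rho F &
              Delaunay_tiles_congruent_to T F).

(* Main.v *)
(** Let [X] be the centers of a separable packing whose caps of radius [r < pi / 2] cover
    the sphere. The circumdisk of a Delaunay triangle of [X] contains no center in its
    interior, so its radius is at most [r]; conversely the caps centered at the vertices
    of a triangle whose radius is its circumradius cover it. Hence everything reduces to
    finding the smallest circumradius of a single triangle with edges at least [2 rho] in
    which each two vertices are separated by a line. Such a line cuts off one vertex, so at
    least two vertices are cut off from the opposite edge, and this is an inequality between
    the two incident edges and the circumradius. Shrinking the longer of the two free edges
    leaves isosceles triangles, for which the inequality becomes the sign of a cubic
    polynomial with at most two roots in the relevant range.

    In the last case the legs of [T2s] are shorter than [2 rho], so its circumradius is below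
    that of the regular triangle of edge [2 rho] and equality never occurs. A Delaunay cell
    with four vertices would contain a triangle with a non-acute angle, which the optimal
    triangles do not have. The minimum defining [gamma] exists by passing to limits of
    packings along an ultrafilter. *)

(* Half-edges and radii enter through their squared sines, which makes circumradius and separation
   polynomial. The obstacle is that the circumradius grows with leg and base while separation trades
   one against the other, so monotonicity settles only part of the feasible isosceles triangles. For
   the rest, leg and base are replaced by the circumradius and the squared cosine [z] of the base
   angle of the chord triangle; the cubic is in [z], at fixed circumradius. A tight triangle is
   optimal either as a double root of the cubic (first case) or because its legs attain the lower
   bound [2 * rho] (second case).

   Delaunay cells are the facets of the hull of [X], seen through its polar body: a cell is given by
   [h] with [dot h x <= 1] on [X] and equality at its vertices, and [1 / dot h h] is the squared
   cosine of its circumradius. *)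
Require Import Defs.
From mathcomp Require Import all_boot all_order all_algebra.
From mathcomp Require Import all_classical all_reals all_analysis.
From mathcomp Require Import ring lra.
Import Order.TTheory GRing.Theory Num.Theory.
Import numFieldNormedType.Exports.
Local Open Scope classical_set_scope.
Local Open Scope ring_scope.
Set Implicit Arguments.
Unset Strict Implicit.
Unset Printing Implicit Defensive.

(** * Planar optimization *)

(* Squared area of the triangle with squared sides [4 a], [4 b], [4 c]. Here and below
   [a], [b], [c] are the [sin^2] of the half-edges of a spherical triangle; then
   [K = sin^2] of its circumradius is given by [K * heron a b c = 4 * a * b * c], the
   formula for the circumradius of the triangle of chords. *)
Definition heron (R : pzRingType) (a b c : R) : R :=
  2 * (a * b) + 2 * (b * c) + 2 * (c * a) - a ^+ 2 - b ^+ 2 - c ^+ 2.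

Lemma heronC (R : comPzRingType) (a b c : R) : heron b a c = heron a b c.
Proof. by rewrite /heron; ring. Qed.

Lemma heron_rot (R : comPzRingType) (a b c : R) : heron b c a = heron a b c.
Proof. by rewrite /heron; ring. Qed.

(** If [a] is the least of the three, then [heron a b c <= 3 * (b * c)], whence [K >= 4 / 3 * a].
    Equality makes the nonnegative sum in [E0] vanish, so [b] and [c] equal [a]. *)
Lemma regular_circumradius_le (R : realFieldType) (a b c p K : R) :
  0 < p -> p <= a -> p <= b -> p <= c -> 0 < heron a b c ->
  K * heron a b c = 4 * a * b * c ->
  4 / 3 * p <= K /\ (K = 4 / 3 * p -> [/\ a = p, b = p & c = p]).
Proof.
move=> p0 pa pb pc S0 KS.
wlog [ab ac] : a b c pa pb pc S0 KS / a <= b /\ a <= c.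
  move=> W.
  have [H|[H|H]] : (a <= b /\ a <= c) \/ (b <= a /\ b <= c) \/ (c <= a /\ c <= b) by lra.
  - exact: W.
  - have [||h1 h2] := W b a c pb pa pc _ _ H; [by rewrite heronC|by rewrite heronC KS; ring|].
    by split=> // /h2[].
  - have [||h1 h2] := W c a b pc pa pb _ _ H;
      [by rewrite -heron_rot|by rewrite -heron_rot KS; ring|].
    by split=> // /h2[].
have a0 : 0 < a by lra.
have E : 3 * (b * c) - heron a b c =
  a * ((b - a) + (c - a)) + (b - a) ^+ 2 + (c - a) ^+ 2 + (b - a) * (c - a).
  by rewrite /heron; ring.
have E0 : 0 <= a * ((b - a) + (c - a)) + (b - a) ^+ 2 + (c - a) ^+ 2 + (b - a) * (c - a).
  by rewrite !addr_ge0 ?mulr_ge0 ?exprn_ge0 //; lra.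
have aK : 4 * a * heron a b c <= 3 * K * heron a b c.
  have -> : 3 * K * heron a b c = 4 * a * (3 * (b * c)) by rewrite -mulrA KS; ring.
  by rewrite ler_pM2l; lra.
rewrite ler_pM2r // in aK.
split; first by lra.
move=> KE; have ap : a = p by lra.
have : a * (3 * (b * c) - heron a b c) = 0.
  have -> : a * (3 * (b * c) - heron a b c) = 3 / 4 * (4 * a * b * c) - a * heron a b c by field.
  by rewrite -KS KE ap; field.
move/eqP; rewrite mulf_eq0 gt_eqF //= E => /eqP E1.
have h : a * ((b - a) + (c - a)) <= 0.
  have : 0 <= (b - a) ^+ 2 + (c - a) ^+ 2 + (b - a) * (c - a).
    by rewrite !addr_ge0 ?mulr_ge0 ?exprn_ge0 //; lra.
  by lra.
rewrite pmulr_rle0 // in h.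
by split; lra.
Qed.

(* For the isosceles triangle of circumradius [K] (as [sin^2]) whose chord triangle has
   base angles of squared cosine [z], this is nonnegative iff its base vertices can be
   separated. It is cubic in [z] for fixed [K]; see [slack_isosceles]. *)
Definition slack (R : pzRingType) (l K z : R) : R :=
  4 * z * (1 - z) ^+ 2 * K * (1 - K) - l * (1 - K * (1 - z) * (1 + 4 * z ^+ 2)).

(** Divided difference of [slack l K] at [z0] and [z], quadratic in [z]; for [z = z0] it is the
    derivative of the cubic. *)
Definition slack_quot (R : pzRingType) (l K z0 z : R) : R :=
  4 * K * (1 - K - l) * (z ^+ 2 + z * z0 + z0 ^+ 2)
  + 4 * K * (l - 2 * (1 - K)) * (z + z0) + K * (4 * (1 - K) - l).

Lemma slack_quotE (R : realFieldType) (l K z0 z : R) :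
  slack l K z0 = 0 -> slack l K z = (z - z0) * slack_quot l K z0 z.
Proof. by move=> H; rewrite -[LHS]subr0 -H /slack /slack_quot; ring. Qed.

(** The cubic equals [- l * (1 - K)] at [0] and [(1 - K) * (K / 2 - l)] at [1/2]; both are negative
    because [K < 2 * l]. *)
Lemma slack_quot_bounds (R : realFieldType) (l K z0 : R) :
  0 < l < 2^-1 -> 0 < K < 1 -> K < 2 * l -> 0 < z0 < 2^-1 ->
  slack l K z0 = 0 ->
  0 < slack_quot l K z0 0 /\ slack_quot l K z0 2^-1 < 0.
Proof.
move=> hl hK Kl hz Hz.
have E0 := slack_quotE 0 Hz; have E1 := slack_quotE 2^-1 Hz.
split.
- have h : 0 < z0 * slack_quot l K z0 0.
    have -> : z0 * slack_quot l K z0 0 = l * (1 - K).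
      by transitivity (- slack l K 0); [rewrite E0; ring | rewrite /slack; ring].
    by rewrite mulr_gt0; lra.
  by rewrite pmulr_rgt0 in h; lra.
- have h : (2^-1 - z0) * slack_quot l K z0 2^-1 < 0.
    rewrite -E1; have -> : slack l K 2^-1 = (1 - K) * (K / 2 - l) by rewrite /slack; field.
    by rewrite pmulr_rlt0; lra.
  by rewrite pmulr_rlt0 in h; lra.
Qed.

(* Two sign changes on [[0, 1/2]] already account for the quadratic [slack_quot]. *)
Lemma slack_lt0_left (R : realFieldType) (l K z0 z : R) :
  0 < l < 2^-1 -> 0 < K < 1 -> K < 2 * l -> 0 < z0 < 2^-1 ->
  slack l K z0 = 0 -> 0 <= slack_quot l K z0 z0 ->
  0 < z < z0 -> slack l K z < 0.
Proof.
move=> hl hK Kl hz Hz G1 hzz.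
have [G0 G2] := slack_quot_bounds hl hK Kl hz Hz.
rewrite (slack_quotE _ Hz).
suff G : 0 < slack_quot l K z0 z by rewrite nmulr_rlt0 //; lra.
rewrite ltNge; apply/negP => Gz.
set h3 := 4 * K * (1 - K - l).
have [h|h] := lerP h3 0.
- have : z0 * slack_quot l K z0 z = (z0 - z) * slack_quot l K z0 0
     + z * slack_quot l K z0 z0 - h3 * (z * (z0 - z) * z0).
    by rewrite /slack_quot /h3; ring.
  have : 0 < (z0 - z) * slack_quot l K z0 0 by rewrite mulr_gt0; lra.
  have : 0 <= z * slack_quot l K z0 z0 by rewrite mulr_ge0; lra.
  have : h3 * (z * (z0 - z) * z0) <= 0 by rewrite mulr_le0_ge0 // !mulr_ge0; lra.
  have : z0 * slack_quot l K z0 z <= 0 by rewrite mulr_ge0_le0; lra.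
  by lra.
- have : (2^-1 - z) * slack_quot l K z0 z0 = (2^-1 - z0) * slack_quot l K z0 z
     + (z0 - z) * slack_quot l K z0 2^-1 - h3 * ((z0 - z) * (2^-1 - z0) * (2^-1 - z)).
    by rewrite /slack_quot /h3; field.
  have : 0 <= (2^-1 - z) * slack_quot l K z0 z0 by rewrite mulr_ge0; lra.
  have : (2^-1 - z0) * slack_quot l K z0 z <= 0 by rewrite mulr_ge0_le0; lra.
  have : (z0 - z) * slack_quot l K z0 2^-1 < 0 by rewrite pmulr_rlt0; lra.
  have : 0 <= h3 * ((z0 - z) * (2^-1 - z0) * (2^-1 - z)).
    by apply: mulr_ge0; [exact: ltW h|rewrite !mulr_ge0; lra].
  by lra.
Qed.

(** Here [z0] is a double root, so the quotient is [z - z0] times a linear [L], which is negative at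
    [0] and at [1/2], hence between them. *)
Lemma slack_lt0_right (R : realFieldType) (l K z0 z : R) :
  0 < l < 2^-1 -> 0 < K < 1 -> K < 2 * l -> 0 < z0 < 2^-1 ->
  slack l K z0 = 0 -> slack_quot l K z0 z0 = 0 ->
  z0 < z <= 2^-1 -> slack l K z < 0.
Proof.
move=> hl hK Kl hz Hz G1 hzz.
have [G0 G2] := slack_quot_bounds hl hK Kl hz Hz.
rewrite (slack_quotE _ Hz) pmulr_rlt0; last by lra.
pose L x : R := 4 * K * (1 - K - l) * (x + 2 * z0) + 4 * K * (l - 2 * (1 - K)).
have GE x : slack_quot l K z0 x = (x - z0) * L x.
  by rewrite -[LHS]subr0 -G1 /slack_quot /L; ring.
rewrite !GE in G0 G2 *.
rewrite pmulr_rlt0 in G2; last by lra.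
rewrite nmulr_rgt0 in G0; last by lra.
rewrite pmulr_rlt0; last by lra.
have : 2^-1 * L z = (2^-1 - z) * L 0 + z * L 2^-1 by rewrite /L; field.
have : z * L 2^-1 < 0 by rewrite pmulr_rlt0; lra.
have : (2^-1 - z) * L 0 <= 0 by rewrite mulr_ge0_le0; lra.
by lra.
Qed.

(* For fixed [z], [- slack] is a convex quadratic in [K] with constant term [l]; the
   product of its roots rules out that [K] and [K0] are separated by the larger root. *)
Lemma slack_root_le (R : realFieldType) (l K K0 z : R) :
  0 < l -> 0 < K -> 0 < K0 < 2 * l -> 0 <= z <= 1 -> K * (1 - z) <= 2^-1 ->
  0 <= slack l K z -> slack l K0 z <= 0 -> K0 <= K.
Proof.
move=> l0 K0' hK0 hz KX HK HK0; rewrite leNgt; apply/negP => KK.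
set N := 4 * z * (1 - z) ^+ 2.
have E : K0 * slack l K z - K * slack l K0 z = (K0 - K) * (N * K * K0 - l).
  by rewrite /slack /N; ring.
have NK : N * K <= 2^-1.
  have -> : N * K = (4 * z * (1 - z)) * (K * (1 - z)) by rewrite /N; ring.
  have h1 : 4 * z * (1 - z) <= 1.
    by have := sqr_ge0 (2 * z - 1); rewrite (_ : _ ^+ 2 = 1 - 4 * z * (1 - z)); [lra|ring].
  apply: le_trans KX; rewrite ler_piMl // mulr_ge0; lra.
have : 0 <= K0 * slack l K z - K * slack l K0 z.
  by rewrite addr_ge0 ?mulr_ge0 // ?oppr_ge0 ?mulr_ge0_le0 //; lra.
rewrite E pmulr_rge0; last by lra.
have : N * K * K0 <= 2^-1 * K0 by rewrite ler_wpM2r; lra.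
by lra.
Qed.

(** The hypothesis on [K] is the circumradius formula for legs [X] and base [Y], with [Y] cancelled.
    The pair [(K, z)] thus replaces [(X, Y)], and the defect of [feasible] becomes [slack]. *)
Lemma slack_isosceles (R : realFieldType) (l X Y K : R) : 0 < X -> 0 < Y < 4 * X ->
  K * (4 * X - Y) = 4 * X ^+ 2 ->
  let z := Y / (4 * X) in
  X = K * (1 - z) /\
  slack l K z * (4 * X) = 4 * X * (1 - X) * (Y - l) - (1 - l) * Y ^+ 2.
Proof.
move=> X0 hY HK z.
have HKE : K = 4 * X ^+ 2 / (4 * X - Y) by rewrite -HK mulfK //; lra.
have e1 : 4 * X - Y != 0 by lra.
have e2 : X != 0 by lra.
split; first by rewrite HKE /z; field; rewrite ?e2 ?e1.
rewrite HKE /z /slack; field.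
by rewrite ?e2 ?e1.
Qed.

(** [4 * X ^+ 2 / (4 * X - Y)] grows with [Y], and with [X] as long as [Y <= 2 * X], i.e. while the
    apex angle of the chord triangle is not obtuse. *)
Lemma isosceles_incr (R : realFieldType) (X Y K X' Y' K' : R) :
  0 < X -> 0 < Y -> Y <= 2 * X -> X <= X' -> Y <= Y' -> Y' < 4 * X' ->
  K * (4 * X - Y) = 4 * X ^+ 2 -> K' * (4 * X' - Y') = 4 * X' ^+ 2 ->
  K <= K' /\ (K = K' -> X = X' /\ Y = Y').
Proof.
move=> X0 Y0 YX XX YY Y4 HK HK'.
have d12 : 0 < (4 * X' - Y') * (4 * X - Y) by rewrite mulr_gt0; lra.
have E : (K' - K) * ((4 * X' - Y') * (4 * X - Y)) =
  4 * ((X' - X) * ((2 * X - Y) * (X + X') + 2 * X * (X' - X)) + X ^+ 2 * (Y' - Y)).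
  transitivity (K' * (4 * X' - Y') * (4 * X - Y) - K * (4 * X - Y) * (4 * X' - Y')); first by ring.
  by rewrite HK HK'; ring.
have e1 : 0 <= (2 * X - Y) * (X + X') by rewrite mulr_ge0; lra.
have e2 : 0 <= 2 * X * (X' - X) by rewrite mulr_ge0; lra.
have e3 : 0 <= (X' - X) * ((2 * X - Y) * (X + X') + 2 * X * (X' - X)) by rewrite mulr_ge0; lra.
have e4 : 0 <= X ^+ 2 * (Y' - Y) by rewrite mulr_ge0 ?exprn_ge0; lra.
split.
  have : 0 <= (K' - K) * ((4 * X' - Y') * (4 * X - Y)) by rewrite E; lra.
  by rewrite pmulr_lge0 //; lra.
move=> KK; rewrite KK subrr mul0r in E.
have /eqP : X ^+ 2 * (Y' - Y) = 0 by lra.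
rewrite mulf_eq0 expf_eq0 gt_eqF //= => /eqP h1.
have /eqP : (X' - X) * ((2 * X - Y) * (X + X') + 2 * X * (X' - X)) = 0 by lra.
rewrite mulf_eq0 => /orP[/eqP h2|/eqP h2]; first by split; lra.
have /eqP : 2 * X * (X' - X) = 0 by lra.
by rewrite mulf_eq0 gt_eqF /=; [move=> /eqP h3; split; lra|lra].
Qed.

Lemma isosceles_circumradius_le (R : realFieldType) (a b c K K' : R) :
  0 < a -> a <= b -> 0 < c <= 2 * a -> 0 < heron a b c ->
  K * heron a b c = 4 * a * b * c -> K' * (4 * a - c) = 4 * a ^+ 2 ->
  K' <= K /\ (K' = K -> a = b).
Proof.
move=> a0 ab hc S0 KS KK.
have d0 : 0 < 4 * a - c by lra.
have E : (K - K') * (heron a b c * (4 * a - c)) =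
    4 * a * ((b - a) * (c * (2 * a - c) + a * (b - a))).
  transitivity (K * heron a b c * (4 * a - c) - K' * (4 * a - c) * heron a b c); first by ring.
  by rewrite KS KK /heron; ring.
have e1 : 0 <= c * (2 * a - c) by rewrite mulr_ge0; lra.
have e2 : 0 <= a * (b - a) by rewrite mulr_ge0; lra.
split.
  have : 0 <= (K - K') * (heron a b c * (4 * a - c)).
    by rewrite E mulr_ge0 ?mulr_ge0; lra.
  by rewrite pmulr_lge0 ?mulr_gt0 //; lra.
move=> KE; rewrite KE subrr mul0r in E.
move: E => /esym/eqP; rewrite !mulf_eq0 !pnatr_eq0 /= gt_eqF //=.
move=> /orP[/eqP h|/eqP h]; first by lra.
have /eqP : a * (b - a) = 0 by lra.
by rewrite mulf_eq0 gt_eqF //= => /eqP; lra.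
Qed.

Lemma edge_le_circumradius (R : realFieldType) (a b c K : R) :
  0 < a -> 0 < b -> 0 < c -> 0 < heron a b c -> K * heron a b c = 4 * a * b * c -> c <= K.
Proof.
move=> a0 b0 c0 S0 KS; rewrite -(ler_pM2r S0) KS.
rewrite -subr_ge0; have -> : 4 * a * b * c - c * heron a b c = c * (a + b - c) ^+ 2.
  by rewrite /heron; ring.
by rewrite mulr_ge0 ?sqr_ge0 // ltW.
Qed.

(* [tan^2 lambda * cot^2 x * cot^2 y <= cot^2 R] without denominators, where [l], [K] are
   the [sin^2] of [lambda], [R], and [sin^2] of [x], [y] are the last two arguments: some
   line separates a vertex with incident half-edges [x], [y] from the opposite edge. *)
Definition separated (R : realFieldType) (l K x y : R) : Prop :=
  l * (K * (1 - x - y) + x * y) <= (1 - K) * (x * y).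

(* [separated] at a base vertex of the isosceles triangle of leg [X] and base [Y] *)
Definition feasible (R : realFieldType) (l X Y : R) : Prop :=
  (1 - l) * Y ^+ 2 <= 4 * X * (1 - X) * (Y - l).

Lemma separated_feasible (R : realFieldType) (l X Y K : R) : 0 < X -> 0 < Y < 4 * X ->
  K * (4 * X - Y) = 4 * X ^+ 2 -> separated l K X Y -> feasible l X Y.
Proof.
move=> X0 hY HK; rewrite /separated /feasible -subr_ge0 => h.
rewrite -subr_ge0.
have h2 : 0 <= ((1 - K) * (X * Y) - l * (K * (1 - X - Y) + X * Y)) * (4 * X - Y).
  by rewrite mulr_ge0 //; lra.
have : ((1 - K) * (X * Y) - l * (K * (1 - X - Y) + X * Y)) * (4 * X - Y) =
   X * (4 * X * (1 - X) * (Y - l) - (1 - l) * Y ^+ 2).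
  transitivity (X * Y * (1 - l) * (4 * X - Y) - K * (4 * X - Y) * (X * Y + l * (1 - X - Y))).
    by ring.
  by rewrite HK; ring.
by move=> E; rewrite E pmulr_rge0 in h2.
Qed.

(** Divided by [K], the inequality bounds [(1 - l) * X * Y / K] from below by a quantity free of
    [K]. *)
Lemma separated_le (R : realFieldType) (l X Y K K' : R) : 0 < l < 1 ->
  0 < X < 1 -> 0 < Y < 1 -> 0 < K' -> K' <= K -> separated l K X Y -> separated l K' X Y.
Proof.
move=> hl hX hY K0 KK; rewrite /separated => h.
have E : K' * ((1 - K) * (X * Y) - l * (K * (1 - X - Y) + X * Y)) +
  (1 - l) * (X * Y) * (K - K') =
  K * ((1 - K') * (X * Y) - l * (K' * (1 - X - Y) + X * Y)) by ring.
rewrite -subr_ge0 -(@pmulr_rge0 _ K); last by lra.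
by rewrite -E addr_ge0 ?mulr_ge0; lra.
Qed.

(* A tight isosceles triangle at which [slack] is nondecreasing in [z]: the circumradius
   then cannot be lowered by decreasing [z]. *)
Record optimal (R : realFieldType) (l X0 Y0 K0 : R) : Prop := Optimal {
  opt_l : 0 < l < 2^-1;
  opt_X : 0 < X0 <= 2^-1;
  opt_Y : 0 < Y0 < 2 * X0;
  opt_K : K0 * (4 * X0 - Y0) = 4 * X0 ^+ 2;
  opt_K1 : K0 < 1;
  opt_K2 : K0 < 2 * l;
  opt_tight : (1 - l) * Y0 ^+ 2 = 4 * X0 * (1 - X0) * (Y0 - l);
  opt_slope : 0 <= slack_quot l K0 (Y0 / (4 * X0)) (Y0 / (4 * X0)) }.

(** A triangle dominating [(X0, Y0)] in leg and base is settled by monotonicity. Otherwise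
    [slack l K0] is negative at every [z] other than [z0] that can occur, whereas
    [slack l K z >= 0], and [slack_root_le] yields [K0 <= K]. The alternative in the second
    hypothesis concerns [z > z0]: a double root makes the cubic negative there, and [X0 <= X] with
    [Y < Y0] forces [z <= z0]. *)
Lemma optimal_isosceles (R : realFieldType) (l X0 Y0 K0 X Y K : R) :
  optimal l X0 Y0 K0 ->
  slack_quot l K0 (Y0 / (4 * X0)) (Y0 / (4 * X0)) = 0 \/ X0 <= X ->
  0 < X <= 2^-1 -> 0 < Y <= 2 * X -> feasible l X Y ->
  K * (4 * X - Y) = 4 * X ^+ 2 -> K <= K0 ->
  [/\ K = K0, X = X0 & Y = Y0].
Proof.
move=> [hl hX0 hY0 HK0 K01 K02 tight slope] hc hX hY F HK KK.
have [/andP[X0X Y0Y]|far] := boolP ((X0 <= X) && (Y0 <= Y)).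
  have [K0K e] : K0 <= K /\ (K0 = K -> X0 = X /\ Y0 = Y).
    by apply: isosceles_incr => //; clear -hX0 hY0 hX hY; lra.
  have KE : K0 = K by apply/eqP; rewrite eq_le K0K.
  by have [<- <-] := e KE.
set z0 := Y0 / (4 * X0) in hc slope; set z := Y / (4 * X).
have [Xp X2] := andP hX; have [X0p X02] := andP hX0.
have [Yp Y0p] : 0 < Y /\ 0 < Y0 by case/andP: hY; case/andP: hY0.
have [Y4 Y04] : Y < 4 * X /\ Y0 < 4 * X0 by split; clear -hX hY hX0 hY0; lra.
have X4 : 0 < 4 * X by rewrite mulr_gt0.
have X04 : 0 < 4 * X0 by rewrite mulr_gt0.
have [|||XE slE] := @slack_isosceles R l X Y K; rewrite ?Yp //.
have [|||X0E sl0E] := @slack_isosceles R l X0 Y0 K0; rewrite ?Y0p //.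
rewrite -/z in XE slE; rewrite -/z0 in X0E sl0E.
have sl0 : slack l K0 z0 = 0.
  by apply: (mulIf (lt0r_neq0 X04)); rewrite sl0E tight subrr mul0r.
have sl : 0 <= slack l K z by rewrite -(pmulr_lge0 _ X4) slE subr_ge0.
have hz0 : 0 < z0 < 2^-1.
  by rewrite /z0 divr_gt0 //= ltr_pdivrMr //; clear -hY0; lra.
have hz : 0 < z <= 2^-1.
  by rewrite /z divr_gt0 //= ler_pdivrMr //; clear -hY; lra.
have hz1 : 0 <= z <= 1 by clear -hz; lra.
have K0p : 0 < K0 < 1.
  by rewrite K01 andbT -(@pmulr_lgt0 _ (4 * X0 - Y0)) ?HK0 ?subr_gt0 // mulr_gt0 ?exprn_gt0.
have Kp : 0 < K.
  by rewrite -(@pmulr_lgt0 _ (4 * X - Y)) ?HK ?subr_gt0 // mulr_gt0 ?exprn_gt0.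
have K02' : 0 < K0 < 2 * l by rewrite K02 andbT; case/andP: K0p.
have lp : 0 < l by case/andP: hl.
have KX : K * (1 - z) <= 2^-1 by rewrite -XE.
have neg : z <> z0 -> slack l K0 z < 0.
  case/andP: (hz) => z_gt0 z_le; move/eqP; rewrite neq_lt => /orP[zz|zz].
    by apply: (slack_lt0_left hl K0p K02 hz0 sl0 slope); rewrite z_gt0.
  apply: (slack_lt0_right hl K0p K02 hz0 sl0); rewrite ?zz //.
  case: hc => // XX.
  have YY0 : Y < Y0 by rewrite ltNge; apply/negP => YY; move: far; rewrite XX YY.
  have : z <= z0.
    rewrite /z /z0 ler_pdivrMr // mulrAC ler_pdivlMr //.
    by apply: ler_pM; [exact: ltW|exact: ltW|exact: ltW|rewrite ler_pM2l].
  by rewrite leNgt zz.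
have root := slack_root_le lp Kp K02' hz1 KX sl.
have [zz|zz] := eqVneq z z0; last first.
  have neg' := neg (elimN eqP zz).
  have KE : K = K0 by apply/eqP; rewrite eq_le KK root // ltW.
  by rewrite -KE ltNge sl in neg'.
have KE : K = K0 by apply/eqP; rewrite eq_le KK root // zz sl0.
have XX : X = X0 by rewrite XE X0E KE zz.
split=> //; rewrite -(divfK (lt0r_neq0 X04) Y0).
by rewrite -/z0 -zz /z XX divfK // gt_eqF.
Qed.

Lemma sep_isosceles_circumradius (R : realFieldType) (l X0 Y0 K0 a b c K : R) :
  optimal l X0 Y0 K0 ->
  slack_quot l K0 (Y0 / (4 * X0)) (Y0 / (4 * X0)) = 0 \/ X0 <= a ->
  l <= a -> a <= b -> b < 1 -> 0 < c < 1 -> 0 < heron a b c ->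
  K * heron a b c = 4 * a * b * c -> separated l K a c -> K <= K0 ->
  [/\ K = K0, a = X0, b = X0 & c = Y0].
Proof.
move=> opt hc la ab b1 hcc S0 KS sep KK0.
have [hl hX0 _ _ _ K02 _ _] := opt.
have lp : 0 < l < 1 by clear -hl; lra.
have a0 : 0 < a by apply: lt_le_trans la; case/andP: lp.
have [c0 c1] := andP hcc.
have cK : c <= K := edge_le_circumradius a0 (lt_le_trans a0 ab) c0 S0 KS.
have c2a : 0 < c <= 2 * a by clear -c0 cK KK0 K02 la; lra.
have d0 : 0 < 4 * a - c by clear -c2a a0; lra.
have ha1 : 0 < a < 1 by rewrite a0 (le_lt_trans ab).
pose K' := 4 * a ^+ 2 / (4 * a - c).
have HK' : K' * (4 * a - c) = 4 * a ^+ 2 by rewrite /K' divfK // gt_eqF.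
have [K'K eqab] : K' <= K /\ (K' = K -> a = b).
  exact: (isosceles_circumradius_le a0 ab c2a S0 KS HK').
have K'0 : 0 < K' by rewrite divr_gt0 // mulr_gt0 ?exprn_gt0.
have K'K0 : K' <= K0 := le_trans K'K KK0.
have sep' : separated l K' a c := separated_le lp ha1 hcc K'0 K'K sep.
have c4a : 0 < c < 4 * a by rewrite c0 -subr_gt0.
have F : feasible l a c := separated_feasible a0 c4a HK' sep'.
have [a2|a2] := lerP a 2^-1.
  have [KE aE cE] : [/\ K' = K0, a = X0 & c = Y0].
    by apply: (optimal_isosceles opt hc) => //; rewrite a0.
  have KK' : K' = K by apply/eqP; rewrite eq_le K'K KE.
  by split; rewrite // -?KK' // -(eqab KK').
(* Legs beyond [1/2] are cut down to [1/2], where [4 * a * (1 - a)] is largest: this preserves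
   [feasible] and strictly lowers the circumradius, here to [K''], against the minimality of
   [K0]. *)
pose K'' : R := 1 / (2 - c).
have HK'' : K'' * (4 * 2^-1 - c) = 4 * 2^-1 ^+ 2 by rewrite /K''; field; clear -c1; lra.
have [K''K' e] : K'' <= K' /\ (K'' = K' -> 2^-1 = a /\ c = c).
  by apply: isosceles_incr => //; clear -c0 c1 a2 a0; lra.
exfalso.
have F2 : feasible l 2^-1 c.
  have l1 : 0 <= (1 - l) * c ^+ 2 by apply: mulr_ge0 (sqr_ge0 c); clear -lp; lra.
  clear -F l1 a2 ha1; rewrite /feasible in F *.
  have : 4 * a * (1 - a) * (c - l) <= c - l.
    rewrite ler_piMl //; last first.
      by rewrite -subr_ge0 (_ : _ - _ = (2 * a - 1) ^+ 2) ?sqr_ge0 //; ring.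
    have h : 0 <= 4 * a * (1 - a) * (c - l) by apply: le_trans F.
    by rewrite pmulr_rge0 ?mulr_gt0 // in h; lra.
  by rewrite (_ : 4 * 2^-1 * (1 - 2^-1) * (c - l) = c - l); [lra|field].
have [KE _ _] : [/\ K'' = K0, 2^-1 = X0 & c = Y0].
  apply: (optimal_isosceles opt) => //; last exact: le_trans K'K0.
  - by case: hc => [->|_]; [left|right; case/andP: hX0].
  - by rewrite lexx invr_gt0 ltr0n.
  - by rewrite c0 /=; clear -c1; lra.
have KK' : K'' = K' by apply/eqP; rewrite eq_le K''K' KE.
by case: (e KK') => a2'; rewrite a2' ltxx in a2.
Qed.

(** The vertex cut off is opposite to [a]. The guards make the coefficients of the certificate in
    [vertex_separatedP] nonnegative. The bound on [a] reflects that both endpoints of that edge lie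
    at distance at least [lambda] beyond the line. *)
Definition vertex_separated (R : realFieldType) (l K a b c : R) : Prop :=
  a <= 1 - l /\ (c <= a + b -> b <= a + c -> a + b + c <= 2 -> separated l K b c).

Lemma sep_circumradius (R : realFieldType) (l X0 Y0 K0 p a b c K : R) :
  optimal l X0 Y0 K0 ->
  slack_quot l K0 (Y0 / (4 * X0)) (Y0 / (4 * X0)) = 0 \/ X0 <= p ->
  l <= p -> p <= a -> p <= b -> p <= c -> 0 < heron a b c ->
  K * heron a b c = 4 * a * b * c ->
  vertex_separated l K a b c -> vertex_separated l K b a c -> K <= K0 ->
  [/\ K = K0, a = X0, b = X0 & c = Y0].
Proof.
move=> opt hc lp pa pb pc S0 KS [a1 Ga] [b1 Gb] KK.
have [hl hX0 _ _ K01 K02 _ _] := opt.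
have p0 : 0 < p by apply: lt_le_trans lp; case/andP: hl.
have [a0 [b0 c0]] : 0 < a /\ 0 < b /\ 0 < c by rewrite !(lt_le_trans p0).
have cK : c <= K := edge_le_circumradius a0 b0 c0 S0 KS.
have bK : b <= K.
  apply: (edge_le_circumradius c0 a0 b0); first by rewrite -heron_rot.
  by rewrite -heron_rot KS; ring.
have aK : a <= K.
  apply: (edge_le_circumradius b0 c0 a0); first by rewrite heron_rot.
  by rewrite heron_rot KS; ring.
have hca : slack_quot l K0 (Y0 / (4 * X0)) (Y0 / (4 * X0)) = 0 \/ X0 <= a.
  by case: hc; [left|right; apply: le_trans (_ : p <= _)].
have hcb : slack_quot l K0 (Y0 / (4 * X0)) (Y0 / (4 * X0)) = 0 \/ X0 <= b.
  by case: hc; [left|right; apply: le_trans (_ : p <= _)].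
(* Each of [a], [b], [c] is at least [l] and at most [K < 2 * l], so none exceeds the sum of the
   other two; [a, b <= 1 - l] and [c < 2 * l] bound the total by [2]. *)
have sbc : separated l K b c by apply: Ga; clear -lp pa pb pc aK bK cK KK K02 a1 b1; lra.
have sac : separated l K a c by apply: Gb; clear -lp pa pb pc aK bK cK KK K02 a1 b1; lra.
have [la lb] : l <= a /\ l <= b by rewrite !(le_trans lp).
have K1 : K < 1 := le_lt_trans KK K01.
have [b2 a2] : b < 1 /\ a < 1 by rewrite !(le_lt_trans _ K1).
have c2 : 0 < c < 1 by rewrite c0 (le_lt_trans cK).
have [ab|/ltW ba] := lerP a b.
  exact: (sep_isosceles_circumradius opt hca la ab b2 c2 S0 KS sac KK).
have S0' : 0 < heron b a c by rewrite heronC.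
have KS' : K * heron b a c = 4 * b * a * c by rewrite heronC KS; ring.
by have [] := sep_isosceles_circumradius opt hcb lb ba a2 c2 S0' KS' sbc KK.
Qed.

(** * The tight isosceles triangle and its cubic equation *)

Lemma optimal_factor_gt0 (R : realFieldType) (l z : R) :
  0 < l < 2^-1 -> l <= 2 * (1 - l) * z -> (3 * l <= 1 -> 4^-1 < z) -> z < 2^-1 ->
  0 < (12 * l - 4) * z ^+ 2 + (6 - 14 * l) * z - (1 - 2 * l).
Proof.
move=> /andP[l0 l2] lz hz z2.
(* The leading coefficient changes sign at [l = 1/3]. Up to there the quadratic is concave or linear
   in [z], nonnegative at [1/4] and positive at [1/2]; beyond, it has nonnegative coefficients in
   the variable [t]. *)
have [l3|l3] := lerP (3 * l) 1.
  have z4 := hz l3; clear hz lz.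
  have -> : (12 * l - 4) * z ^+ 2 + (6 - 14 * l) * z - (1 - 2 * l) =
    (1 - 3 * l) * (4 * ((z - 4^-1) * (2^-1 - z)) + (2^-1 - z)) + (1 - 2 * l) * (4 * (z - 4^-1)).
    by field.
  have e1 : 0 < 2^-1 - z by lra.
  have e2 : 0 < z - 4^-1 by lra.
  have e3 : 0 <= 1 - 3 * l by lra.
  have e4 : 0 < 1 - 2 * l by lra.
  by rewrite ltr_wpDl ?mulr_gt0 // mulr_ge0 // addr_ge0 ?mulr_ge0 // ltW // mulr_gt0.
pose t := 2 * (1 - l) * z - l.
have t0 : 0 <= t by rewrite /t; lra.
have e : 0 < 4 * (1 - l) ^+ 2 by rewrite mulr_gt0 ?exprn_gt0; lra.
rewrite -(pmulr_rgt0 _ e).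
have -> : 4 * (1 - l) ^+ 2 * ((12 * l - 4) * z ^+ 2 + (6 - 14 * l) * z - (1 - 2 * l)) =
  (12 * l - 4) * t ^+ 2 + 4 * (13 * (l - 6 / 13) ^+ 2 + 3 / 13) * t
    + 4 * (1 - 2 * l) ^+ 2 * (3 * l - 1).
  by rewrite /t; field.
have e1 : 0 < 3 * l - 1 by lra.
have e2 : 0 < 1 - 2 * l by lra.
have e3 : 0 <= 13 * (l - 6 / 13) ^+ 2 + 3 / 13.
  by have := sqr_ge0 (l - 6 / 13); lra.
have e4 : 0 <= 12 * l - 4 by lra.
rewrite ltr_wpDl ?mulr_gt0 ?exprn_gt0 // addr_ge0 //; first by rewrite mulr_ge0 ?sqr_ge0.
by rewrite !mulr_ge0.
Qed.

(* The hypotheses on [Y] bound [z] away from the root of the quadratic factor. *)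
Lemma optimal_lt (R : realFieldType) (l X Y K : R) :
  0 < l < 2^-1 -> 0 < X <= 2^-1 -> 0 < Y < 2 * X ->
  K * (4 * X - Y) = 4 * X ^+ 2 ->
  (1 - l) * Y ^+ 2 = 4 * X * (1 - X) * (Y - l) ->
  l <= (1 - l) * Y -> (3 * l <= 1 -> X < Y) -> K < 2 * l.
Proof.
move=> hl hX hY HK tight lY XY.
have [X0 X2] := andP hX; have [Y0 Y2] := andP hY.
have Y4 : 0 < Y < 4 * X by clear -hX hY; lra.
have [|||XE slE] := @slack_isosceles R l X Y K; rewrite ?Y4 //.
set z := Y / (4 * X) in XE slE.
have X4 : 0 < 4 * X by rewrite mulr_gt0.
have sl0 : slack l K z = 0.
  apply/eqP; rewrite tight subrr in slE; move: slE => /eqP; rewrite mulf_eq0.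
  by rewrite (gt_eqF X4) orbF.
have z0 : 0 < z by rewrite divr_gt0.
have z2 : z < 2^-1 by rewrite ltr_pdivrMr //; clear -Y2; lra.
have K0 : 0 < K.
  have d0 : 0 < 4 * X - Y by rewrite subr_gt0; case/andP: Y4.
  by rewrite -(pmulr_lgt0 _ d0) HK mulr_gt0 ?exprn_gt0.
rewrite ltNge; apply/negP => KK.
have HE : slack l (2 * l) z =
    l * (1 - 2 * z) * ((12 * l - 4) * z ^+ 2 + (6 - 14 * l) * z - (1 - 2 * l)).
  by rewrite /slack; ring.
have B0 : 0 < slack l (2 * l) z.
  have [l0 l2] := andP hl; have e1 : 0 < 1 - 2 * z by clear -z2; lra.
  rewrite HE mulr_gt0 ?mulr_gt0 ?optimal_factor_gt0 //.
    rewrite /z mulrA ler_pdivlMr //.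
    apply: le_trans (_ : 2 * l <= _); last by clear -lY; lra.
    rewrite (_ : l * (4 * X) = 2 * l * (2 * X)); last by ring.
    by rewrite ler_piMr; clear -l0 X2; lra.
  by move=> l3; rewrite /z ltr_pdivlMr //; have := XY l3; lra.
have KX : K * (1 - z) <= 2^-1 by rewrite -XE.
(* [2 * l < K] is excluded by the product of the roots, [2 * l = K] by strictness. *)
have N0 : 4 * z * (1 - z) ^+ 2 * K <= 2^-1.
  rewrite (_ : _ * K = (4 * z * (1 - z)) * (K * (1 - z))); last by ring.
  apply: le_trans KX; rewrite ler_piMl //.
    by rewrite mulr_ge0 ?(ltW K0) //; clear -z2; lra.
  by rewrite -subr_ge0 (_ : _ - _ = (2 * z - 1) ^+ 2) ?sqr_ge0 //; ring.
have E : K * slack l (2 * l) z = (K - 2 * l) * ((4 * z * (1 - z) ^+ 2 * K) * (2 * l) - l).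
  transitivity (K * slack l (2 * l) z - 2 * l * slack l K z); first by rewrite sl0 mulr0 subr0.
  by rewrite /slack; ring.
have : 0 < K * slack l (2 * l) z by rewrite mulr_gt0.
have h : (4 * z * (1 - z) ^+ 2 * K) * (2 * l) - l <= 0.
  have : (4 * z * (1 - z) ^+ 2 * K) * (2 * l) <= 2^-1 * (2 * l).
    by rewrite ler_wpM2r //; clear -hl; lra.
  by clear; lra.
by rewrite E ltNge mulr_ge0_le0 // subr_ge0.
Qed.

(* Its root is the [sin^2 y] minimizing the circumradius of the triangles [T1s]. *)
Definition ycubic (R : pzRingType) (l Y : R) : R :=
  Y ^+ 3 - 5 * l * Y ^+ 2 + (5 * l ^+ 2 + 2 * l) * Y - 3 * l ^+ 2.

(** Around the inflection point [5 / 3 * l] the divided difference is a sum of squares plus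
    [10 / 3 * (l * (3 / 5 - l))]. *)
Lemma ycubic_lt (R : realFieldType) (l Y Y' : R) : 0 < l < 2^-1 ->
  (ycubic l Y < ycubic l Y') = (Y < Y').
Proof.
move=> hl.
have mono : {homo ycubic l : x y / x < y}.
  move=> x y xy; rewrite -subr_gt0.
  have -> : ycubic l y - ycubic l x = (y - x) *
    (((x - 5 / 3 * l) + (y - 5 / 3 * l) / 2) ^+ 2 + 3 / 4 * (y - 5 / 3 * l) ^+ 2
      + 10 / 3 * (l * (3 / 5 - l))) by rewrite /ycubic; field.
  rewrite mulr_gt0 ?subr_gt0 // ltr_wpDl //.
    by rewrite addr_ge0 ?sqr_ge0 // mulr_ge0 ?sqr_ge0 //; lra.
  by rewrite !mulr_gt0; lra.
apply/idP/idP => [|/mono//].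
by apply: contraTT; rewrite -!leNgt le_eqVlt => /orP[/eqP->//|/mono/ltW].
Qed.

Lemma ycubic_bounds (R : realFieldType) (l Y : R) : 0 < l < 2^-1 ->
  (ycubic l Y <= 0 -> Y < 2 * l) /\ (ycubic l Y = 0 -> 3 / 2 * l < Y).
Proof.
move=> hl; split=> h; rewrite -(ycubic_lt _ _ hl).
  apply: le_lt_trans h _; rewrite (_ : ycubic _ _ = l ^+ 2 * (1 - 2 * l)).
    by rewrite mulr_gt0 ?exprn_gt0; lra.
  by rewrite /ycubic; ring.
rewrite h (_ : ycubic _ _ = - (3 / 8 * l ^+ 3)); last by rewrite /ycubic; field.
by rewrite oppr_lt0 mulr_gt0 ?exprn_gt0; lra.
Qed.

(** Tightness is linear in [l]; solving it for [l] leaves a rational identity in [X] and [Y]. It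
    reduces the sign of the slope of [slack] at a tight triangle to comparing two products. *)
Lemma slack_quot_diag (R : realFieldType) (l X Y K : R) : 0 < l < 1 ->
  0 < X -> 0 < Y < 4 * X -> Y < 1 ->
  K * (4 * X - Y) = 4 * X ^+ 2 ->
  (1 - l) * Y ^+ 2 = 4 * X * (1 - X) * (Y - l) ->
  slack_quot l K (Y / (4 * X)) (Y / (4 * X)) * ((Y - l) * X) =
  K * l * ((2 * l - Y) * (1 - Y) - (Y - l) * (1 - 2 * X)).
Proof.
move=> hl X0 hY Y1 HK tight.
have X1 : X != 0 by lra.
have d1 : 4 * X - Y != 0 by lra.
have d2 : 4 * X * (1 - X) - Y ^+ 2 != 0.
  apply/eqP => h; have /eqP : Y ^+ 2 * (1 - Y) = 0.
    transitivity ((1 - l) * Y ^+ 2 - Y ^+ 2 * (Y - l)); first by ring.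
    by rewrite tight (_ : Y ^+ 2 = 4 * X * (1 - X)); [ring|lra].
  by rewrite mulf_eq0 expf_eq0 /= => /orP[] /eqP; lra.
have lE : l = Y * (4 * X * (1 - X) - Y) / (4 * X * (1 - X) - Y ^+ 2).
  by rewrite -[LHS](mulfK d2); congr (_ / _); lra.
have KE : K = 4 * X ^+ 2 / (4 * X - Y) by rewrite -HK mulfK.
rewrite KE lE /slack_quot; field.
by rewrite X1 d1 d2.
Qed.

Lemma optimal_intro (R : realFieldType) (l X Y : R) :
  0 < l < 2^-1 -> 0 < X <= 2^-1 -> l <= (1 - l) * Y ->
  (1 - l) * Y ^+ 2 = 4 * X * (1 - X) * (Y - l) ->
  ycubic l Y <= 0 -> (3 * l <= 1 -> X < Y) ->
  let K := 4 * X ^+ 2 / (4 * X - Y) in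
  optimal l X Y K /\
  (ycubic l Y = 0 -> slack_quot l K (Y / (4 * X)) (Y / (4 * X)) = 0).
Proof.
move=> hl hX lY tight CY XY K.
have Y2 : Y < 2 * l by case: (ycubic_bounds Y hl) => + _; apply.
have Y1 : Y < 1 by lra.
have YpL : l < Y.
  have Y0 : 0 < Y by rewrite -(@pmulr_rgt0 _ (1 - l)); lra.
  have : l * Y > 0 by rewrite mulr_gt0; lra.
  by move: lY; lra.
(* By tightness [(X - l) * (1 - X - l)] is a nonnegative multiple of [(Y - 2 * l) ^+ 2]; the leg
   would be exactly [lambda] at [Y = 2 * l]. *)
have lX : l <= X.
  have h : 0 <= (X - l) * (1 - X - l).
    rewrite -(@pmulr_lge0 _ (4 * (Y - l))); last by lra.
    have -> : (X - l) * (1 - X - l) * (4 * (Y - l)) = (1 - l) * (Y - 2 * l) ^+ 2.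
      transitivity (4 * X * (1 - X) * (Y - l) - 4 * l * (1 - l) * (Y - l)); first by ring.
      by rewrite -tight; ring.
    by rewrite mulr_ge0 ?sqr_ge0 //; lra.
  by rewrite pmulr_lge0 in h; lra.
have d1 : 4 * X - Y != 0 by lra.
have HK : K * (4 * X - Y) = 4 * X ^+ 2 by rewrite /K divfK.
have hY : 0 < Y < 2 * X by lra.
have K2 : K < 2 * l by apply: (@optimal_lt _ l X Y).
have K0 : 0 < K by rewrite divr_gt0 ?mulr_gt0 ?exprn_gt0; lra.
have DX : 0 < (Y - l) * X by rewrite mulr_gt0; lra.
have [l0 l1] : 0 < l /\ 0 < l < 1 by lra.
have X0 : 0 < X by lra.
have hY4 : 0 < Y < 4 * X by lra.
have := slack_quot_diag l1 X0 hY4 Y1 HK tight.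
(* The origin of [ycubic]: squaring both sides of the slope inequality allows tightness to eliminate
   [X]. *)
have E : ((2 * l - Y) * (1 - Y)) ^+ 2 - ((Y - l) * (1 - 2 * X)) ^+ 2 = - ((1 - Y) * ycubic l Y).
  transitivity (((2 * l - Y) * (1 - Y)) ^+ 2 - (Y - l) ^+ 2
    + (Y - l) * (4 * X * (1 - X) * (Y - l))).
    by ring.
  by rewrite -tight /ycubic; ring.
have e1 : 0 <= (2 * l - Y) * (1 - Y) by rewrite mulr_ge0; lra.
have e2 : 0 <= (Y - l) * (1 - 2 * X) by rewrite mulr_ge0; lra.
move=> SE; split.
  split=> //; [lra|].
  rewrite -(pmulr_lge0 _ DX) SE mulr_ge0 //; first by rewrite mulr_ge0 // ltW.
  rewrite subr_ge0 -(@ler_pXn2r _ 2) // -subr_ge0 E oppr_ge0 mulr_ge0_le0 //.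
  by lra.
move=> C0; rewrite C0 mulr0 oppr0 in E.
have /eqP : slack_quot l K (Y / (4 * X)) (Y / (4 * X)) * ((Y - l) * X) = 0.
  rewrite SE (_ : (2 * l - Y) * (1 - Y) = (Y - l) * (1 - 2 * X)) ?subrr ?mulr0 //.
  by apply/eqP; rewrite -(@eqrXn2 _ 2) //; apply/eqP; lra.
by rewrite mulf_eq0 (gt_eqF DX) orbF => /eqP.
Qed.

(** If [Y <= X], then [X * (1 - X) >= Y * (1 - Y)] and tightness gives
    [4 * (1 - Y) * (Y - l) <= (1 - l) * Y]. For [3 * l <= 1] this fails on the whole interval
    [3 / 2 * l < Y < 2 * l], which contains the root. *)
Lemma ycubic_root_leg_lt (R : realFieldType) (l X Y : R) :
  0 < l < 2^-1 -> X <= 2^-1 -> l <= (1 - l) * Y ->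
  (1 - l) * Y ^+ 2 = 4 * X * (1 - X) * (Y - l) ->
  ycubic l Y = 0 -> 3 * l <= 1 -> X < Y.
Proof.
move=> hl hX lY tight CY l3.
have Y2 : Y < 2 * l by case: (ycubic_bounds Y hl) => + _; apply; rewrite CY.
have Y1 : 3 / 2 * l < Y by case: (ycubic_bounds Y hl) => _; apply.
rewrite ltNge; apply/negP => YX.
have h1 : 0 < (Y - 3 / 2 * l) * (2 * l - Y) by rewrite mulr_gt0; lra.
have h2 : 0 <= (1 - 3 * l) * (3 * Y - 4 * l) by rewrite mulr_ge0; lra.
have h3 : 0 < 4 * (1 - Y) * (Y - l) - (1 - l) * Y.
  rewrite (_ : 4 * _ * _ - _ =
    4 * ((Y - 3 / 2 * l) * (2 * l - Y)) + (1 - 3 * l) * (3 * Y - 4 * l)); last by field.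
  by lra.
have h4 : 0 < Y * (4 * (1 - Y) * (Y - l) - (1 - l) * Y) by rewrite mulr_gt0; lra.
have E : Y * (4 * (1 - Y) * (Y - l) - (1 - l) * Y) = - (4 * (Y - l) * ((X - Y) * (1 - X - Y))).
  transitivity (4 * Y * (1 - Y) * (Y - l) - (1 - l) * Y ^+ 2); first by ring.
  by rewrite tight; ring.
have : 0 <= 4 * (Y - l) * ((X - Y) * (1 - X - Y)).
  rewrite mulr_ge0 //; first by lra.
  by rewrite mulr_ge0; lra.
by move: h4; rewrite E; lra.
Qed.

(* Cardano's formula, with [w = a + q / a]. *)
Lemma ycubic_cardano (R : realFieldType) (l a : R) :
  a != 0 ->
  (a ^+ 3) ^+ 2 - (200 * l ^+ 3 - 72 * l ^+ 2) * a ^+ 3 + (40 * l ^+ 2 - 24 * l) ^+ 3 = 0 ->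
  ycubic l ((a + (40 * l ^+ 2 - 24 * l) / a + 10 * l) / 6) = 0.
Proof.
move=> a0 h; apply: (mulIf (_ : 216 * a ^+ 3 != 0)).
  by rewrite mulf_neq0 ?expf_neq0 // pnatr_eq0.
rewrite mul0r -[RHS]h /ycubic; field.
by rewrite a0.
Qed.

(** * Vectors and spherical triangles *)

Section Vectors.
Context {R : realType}.
Implicit Types (u v w h n d : 'rV[R]_3) (k : R).

Lemma dotE u v : dot u v = u 0 0 * v 0 0 + u 0 1 * v 0 1 + u 0 2 * v 0 2.
Proof.
rewrite /dot !big_ord_recl big_ord0 addr0 addrA.
by congr (_ + _ * _ + _ * _); congr (_ _ _); apply/val_inj.
Qed.

Lemma dotC u v : dot u v = dot v u.
Proof. by rewrite !dotE; ring. Qed.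

Lemma dotDl u v w : dot (u + v) w = dot u w + dot v w.
Proof. by rewrite !dotE !mxE; ring. Qed.

Lemma dotZl k u v : dot (k *: u) v = k * dot u v.
Proof. by rewrite !dotE !mxE; ring. Qed.

Lemma dotNl u v : dot (- u) v = - dot u v.
Proof. by rewrite !dotE !mxE; ring. Qed.

Lemma dotBl u v w : dot (u - v) w = dot u w - dot v w.
Proof. by rewrite dotDl dotNl. Qed.

Lemma dotDr u v w : dot w (u + v) = dot w u + dot w v.
Proof. by rewrite dotC dotDl !(dotC w). Qed.

Lemma dotZr k u v : dot u (k *: v) = k * dot u v.
Proof. by rewrite dotC dotZl dotC. Qed.

Lemma dotNr u v : dot u (- v) = - dot u v.
Proof. by rewrite dotC dotNl dotC. Qed.

Lemma dotBr u v w : dot w (u - v) = dot w u - dot w v.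
Proof. by rewrite dotDr dotNr. Qed.

Lemma dot0l u : dot 0 u = 0.
Proof. by rewrite dotE !mxE; ring. Qed.

Lemma dot0r u : dot u 0 = 0.
Proof. by rewrite dotC dot0l. Qed.

Lemma dot_ge0 u : 0 <= dot u u.
Proof. by rewrite dotE !addr_ge0 // -expr2 sqr_ge0. Qed.

Lemma row3P u v : u 0 0 = v 0 0 -> u 0 1 = v 0 1 -> u 0 2 = v 0 2 -> u = v.
Proof.
move=> h0 h1 h2; apply/rowP => -[[|[|[|//]]] j].
- by have -> : Ordinal j = 0 :> 'I_3 by exact/val_inj.
- by have -> : Ordinal j = 1 :> 'I_3 by exact/val_inj.
- by have -> : Ordinal j = 2 :> 'I_3 by exact/val_inj.
Qed.

Lemma dot_eq0 u : dot u u = 0 -> u = 0.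
Proof.
rewrite dotE => /eqP; rewrite !paddr_eq0 ?addr_ge0 -?expr2 ?sqr_ge0 // !sqrf_eq0.
move=> /andP[/andP[/eqP h0 /eqP h1] /eqP h2].
by apply: row3P; rewrite mxE.
Qed.

Lemma dot_gt0 u : u <> 0 -> 0 < dot u u.
Proof.
by move=> u0; rewrite lt_neqAle dot_ge0 andbT eq_sym; apply/eqP => /dot_eq0.
Qed.

Definition cross u v : 'rV[R]_3 := \row_j nth 0
  [:: u 0 1 * v 0 2 - u 0 2 * v 0 1; u 0 2 * v 0 0 - u 0 0 * v 0 2;
      u 0 0 * v 0 1 - u 0 1 * v 0 0] j.

Definition det3 u v w : R := dot (cross u v) w.

Lemma dot_cross_self u v :
  dot (cross u v) (cross u v) = dot u u * dot v v - dot u v ^+ 2.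
Proof. by rewrite !dotE !mxE /=; ring. Qed.

Lemma dot_sqr_le u v : dot u v ^+ 2 <= dot u u * dot v v.
Proof. by rewrite -subr_ge0 -dot_cross_self dot_ge0. Qed.

Lemma S2_dot_le1 u v : S2 u -> S2 v -> dot u v <= 1.
Proof.
move=> u1 v1; have := dot_sqr_le u v; rewrite u1 v1 mul1r => h.
by have := sqr_ge0 (dot u v - 1); rewrite sqrrB1 -mulr_natl; lra.
Qed.

Lemma S2N u : S2 u -> S2 (- u).
Proof. by rewrite /S2 /= dotNl dotNr opprK. Qed.

Lemma S2_dot_geN1 u v : S2 u -> S2 v -> -1 <= dot u v.
Proof. by move=> u1 v1; have := S2_dot_le1 (S2N u1) v1; rewrite dotNl; lra. Qed.

Lemma S2_dot_eq1 u v : S2 u -> S2 v -> 1 <= dot u v -> u = v.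
Proof.
move=> u1 v1 h; apply/eqP; rewrite -subr_eq0; apply/eqP/dot_eq0.
have := S2_dot_le1 u1 v1.
by rewrite dotBl !dotBr u1 v1 (dotC v u); lra.
Qed.

Lemma S2_neq0 u : S2 u -> u <> 0.
Proof. by move=> u1 u0; move: u1; rewrite u0 /S2 /= dot0l => /esym/eqP; rewrite oner_eq0. Qed.

Lemma S2_normalize u : u <> 0 -> S2 ((Num.sqrt (dot u u))^-1 *: u).
Proof.
move=> u0; have h := dot_gt0 u0.
rewrite /S2 /= dotZl dotZr mulrA -invfM -expr2 sqr_sqrtr ?dot_ge0 // mulVf //.
by rewrite gt_eqF.
Qed.

Lemma perp_exists u v : exists2 d, d <> 0 & dot d u = 0 /\ dot d v = 0.
Proof.
pose A : 'M[R]_(3, 1 + 1) := row_mx u^T v^T.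
have kA : kermx A != 0.
  rewrite -mxrank_eq0 mxrank_ker subn_eq0 -ltnNge.
  by rewrite ltnS; apply: rank_leq_col.
have /rowV0Pn[d dk d0] := kA.
have /sub_kermxP dA := dk.
exists d; first by apply/eqP.
have dotm (x : 'rV[R]_3) : d *m x^T = (dot d x)%:M.
  apply/matrixP => i j; rewrite !ord1 !mxE eqxx mulr1n /dot.
  by apply: eq_bigr => k _; rewrite mxE.
move: dA; rewrite /A mul_mx_row !dotm => /eqP; rewrite row_mx_eq0.
move=> /andP[/eqP/matrixP/(_ 0 0) + /eqP/matrixP/(_ 0 0)].
by rewrite !mxE eqxx !mulr1n.
Qed.

Lemma S2_perp_exists u v : exists2 d, S2 d & dot d u = 0 /\ dot d v = 0.
Proof.
have [d d0 [du dv]] := perp_exists u v.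
exists ((Num.sqrt (dot d d))^-1 *: d); first exact: S2_normalize.
by rewrite !dotZl du dv mulr0.
Qed.

(* [sin^2] of half the distance, i.e. a quarter of the squared chord *)
Definition hav u v : R := (1 - dot u v) / 2.

Lemma havC u v : hav u v = hav v u. Proof. by rewrite /hav dotC. Qed.

Lemma hav_gt0 u v : S2 u -> S2 v -> u <> v -> 0 < hav u v.
Proof.
move=> u1 v1 uv; rewrite divr_gt0 // subr_gt0 lt_neqAle S2_dot_le1 // andbT.
by apply/eqP => h; apply: uv; apply: S2_dot_eq1; rewrite // h.
Qed.

Definition heron3 u v w := heron (hav v w) (hav u w) (hav u v).

Lemma det3_sqr u v w : S2 u -> S2 v -> S2 w ->
  det3 u v w ^+ 2 = 4 * heron3 u v w - 16 * (hav v w * hav u w * hav u v).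
Proof.
rewrite /S2 /= => u1 v1 w1.
have -> : det3 u v w ^+ 2 = dot u u * dot v v * dot w w
  + 2 * (dot v w * dot u w * dot u v) - dot u u * dot v w ^+ 2
  - dot v v * dot u w ^+ 2 - dot w w * dot u v ^+ 2.
  by rewrite /det3 !dotE !mxE /=; ring.
by rewrite u1 v1 w1 /heron3 /heron /hav; field.
Qed.

(** Expansion of [h] in the basis dual to [u], [v], [w], multiplied by the determinant. *)
Lemma det3_decomp u v w h :
  det3 u v w *: h = dot h u *: cross v w + dot h v *: cross w u + dot h w *: cross u v.
Proof. by apply: row3P; rewrite /det3 !dotE !mxE /=; ring. Qed.

(** This is [cross (v - u) (w - u)] expanded: a normal of the plane of the three points, of length
    twice the area of the chord triangle. *)
Definition cross3 u v w := cross v w + cross w u + cross u v.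

Lemma dot_cross3 u v w : S2 u -> S2 v -> S2 w ->
  dot (cross3 u v w) (cross3 u v w) = 4 * heron3 u v w.
Proof.
rewrite /S2 /= => u1 v1 w1.
have -> : dot (cross3 u v w) (cross3 u v w) =
    dot v v * dot w w + dot w w * dot u u + dot u u * dot v v
    - dot v w ^+ 2 - dot u w ^+ 2 - dot u v ^+ 2
    + 2 * (dot v w * dot u w - dot u v * dot w w + (dot u w * dot u v - dot v w * dot u u)
           + (dot u v * dot v w - dot u w * dot v v)).
  by rewrite /cross3 !dotE !mxE /=; ring.
by rewrite u1 v1 w1 /heron3 /heron /hav; field.
Qed.

(* [h] is the pole of the plane through [u], [v], [w]: [1 / dot h h] is the squared
   cosine of the circumradius. *)
Lemma circumradius_heron u v w h : S2 u -> S2 v -> S2 w ->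
  dot h u = 1 -> dot h v = 1 -> dot h w = 1 -> u <> v -> v <> w -> w <> u ->
  [/\ det3 u v w != 0, 0 < heron3 u v w &
     (1 - (dot h h)^-1) * heron3 u v w = 4 * hav v w * hav u w * hav u v].
Proof.
move=> u1 v1 w1 hu hv hw uv vw wu.
have E : det3 u v w *: h = cross3 u v w by rewrite det3_decomp hu hv hw !scale1r.
have D2 := det3_sqr u1 v1 w1; have N2 := dot_cross3 u1 v1 w1.
have abc : 0 < hav v w * hav u w * hav u v.
  apply: mulr_gt0 (hav_gt0 u1 v1 uv); apply: mulr_gt0 (hav_gt0 v1 w1 vw) _.
  by rewrite havC; apply: hav_gt0.
have D0 : det3 u v w != 0.
  apply/eqP => D0; move: N2 D2; rewrite -E D0 scale0r dot0l expr0n /=; lra.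
have hh : det3 u v w ^+ 2 * dot h h = 4 * heron3 u v w.
  by rewrite -N2 -E dotZl dotZr; ring.
have Dp : 0 < det3 u v w ^+ 2 by rewrite exprn_even_gt0.
split=> //; first by lra.
have h0 : dot h h != 0 by apply/eqP => h0; rewrite h0 mulr0 in hh; lra.
have : heron3 u v w = det3 u v w ^+ 2 * dot h h / 4 by rewrite hh; field.
move=> hE; rewrite {1}hE; apply: (mulfI (_ : 4 != 0 :> R)) => //.
transitivity (det3 u v w ^+ 2 * dot h h - det3 u v w ^+ 2); first by field.
by rewrite hh D2; ring.
Qed.

Lemma dotS2_sqr_le n u : S2 n -> dot n u ^+ 2 <= dot u u.
Proof. by move=> n1; rewrite -[leRHS]mul1r -n1 dot_sqr_le. Qed.

(* The vector [P u - Q v - T w] below is a normal of the line tangent to the three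
   caps; if its coefficients are nonnegative, it certifies that no line does better. *)
Lemma vertex_separatedP u v w h n (s : R) : S2 u -> S2 v -> S2 w ->
  dot h u = 1 -> dot h v = 1 -> dot h w = 1 -> u <> v -> v <> w -> w <> u ->
  S2 n -> 0 <= s -> s <= dot n u -> dot n v <= - s -> dot n w <= - s ->
  vertex_separated (s ^+ 2) (1 - (dot h h)^-1) (hav v w) (hav u w) (hav u v).
Proof.
move=> u1 v1 w1 hu hv hw uv vw wu n1 s0 nu nv nw.
have [D0 S0 KS] := circumradius_heron u1 v1 w1 hu hv hw uv vw wu.
set a := hav v w in KS *; set b := hav u w in KS *; set c := hav u v in KS *.
have a0 : 0 < a by rewrite hav_gt0.
split.
  have := dotS2_sqr_le (v + w) n1.
  rewrite dotDr !dotDl !dotDr v1 w1 (dotC w v).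
  have : (s + s) ^+ 2 <= (dot n v + dot n w) ^+ 2.
    by rewrite -(sqrrN (dot n v + _)) ler_pXn2r ?nnegrE //; lra.
  by rewrite /a /hav; lra.
move=> cab bac abc.
(* These come from the cofactors of the Gram matrix: the product of [m] with [u] is
   [det3 u v w ^+ 2], and with [v] and [w] it is the opposite. *)
pose P := 4 * a * (2 - a - b - c); pose Q := 4 * (1 - b) * (a + b - c).
pose T := 4 * (1 - c) * (a + c - b).
have b1 : b <= 1 by have := S2_dot_geN1 u1 w1; rewrite /b /hav; lra.
have c1 : c <= 1 by have := S2_dot_geN1 u1 v1; rewrite /c /hav; lra.
have P0 : 0 <= P by rewrite mulr_ge0 //; lra.
have Q0 : 0 <= Q by rewrite mulr_ge0 //; lra.
have T0 : 0 <= T by rewrite mulr_ge0 //; lra.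
pose m := P *: u - Q *: v - T *: w.
have DS := det3_sqr u1 v1 w1; rewrite -/a -/b -/c in DS.
have SE : heron3 u v w = heron a b c by [].
have mm : dot m m = det3 u v w ^+ 2 * (P + Q + T).
  rewrite DS SE /m !(dotBl, dotBr, dotZl, dotZr) u1 v1 w1 (dotC v u) (dotC w u) (dotC w v).
  have -> : dot u v = 1 - 2 * c by rewrite /c /hav; field.
  have -> : dot u w = 1 - 2 * b by rewrite /b /hav; field.
  have -> : dot v w = 1 - 2 * a by rewrite /a /hav; field.
  by rewrite /P /Q /T /heron; ring.
have nm : s * (P + Q + T) <= dot n m.
  rewrite /m !dotBr !dotZr.
  have := ler_wpM2l P0 nu; have := ler_wpM2l Q0 nv; have := ler_wpM2l T0 nw.
  by lra.
have key : s ^+ 2 * (P + Q + T) <= det3 u v w ^+ 2.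
  have : 0 <= P + Q + T by rewrite !addr_ge0.
  rewrite le_eqVlt => /orP[/eqP <-|PQT]; first by rewrite mulr0 sqr_ge0.
  rewrite -(ler_pM2r PQT) -mm; apply: le_trans (dotS2_sqr_le m n1).
  rewrite (_ : _ * _ * _ = (s * (P + Q + T)) ^+ 2); last by ring.
  by rewrite ler_pXn2r ?nnegrE // ?(le_trans _ nm) // mulr_ge0 // ltW.
have KSE : 4 * heron a b c - 16 * (a * b * c) = 4 * heron a b c * (dot h h)^-1.
  transitivity (4 * heron a b c - 4 * (4 * a * b * c)); first by ring.
  by rewrite -KS SE; ring.
move: key; rewrite DS SE (_ : P + Q + T = 4 * (heron a b c + 4 * a * (1 - b - c))); last first.
  by rewrite /P /Q /T /heron; ring.
rewrite /separated; set K := 1 - (dot h h)^-1 in KS *; move=> key.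
rewrite -(@ler_pM2r _ (4 * a * 4 * heron a b c)); last first.
  by do 3![apply: mulr_gt0 => //].
have K0 : 0 < K.
  rewrite -(pmulr_lgt0 _ S0) KS; apply: mulr_gt0 (hav_gt0 u1 v1 uv).
  apply: mulr_gt0; first by rewrite mulr_gt0.
  by rewrite /b havC hav_gt0.
rewrite SE in KS.
have := ler_wpM2l (ltW K0) key => k2.
have e1 : s ^+ 2 * (K * (1 - b - c) + b * c) * (4 * a * 4 * heron a b c) =
   (K * (s ^+ 2 * (4 * (heron a b c + 4 * a * (1 - b - c))))) * heron a b c.
  transitivity (s ^+ 2 * 4 * (K * (1 - b - c) * 4 * a * heron a b c
    + 4 * a * b * c * heron a b c)); first by ring.
  by rewrite -KS; ring.
have e2 : (1 - K) * (b * c) * (4 * a * 4 * heron a b c) =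
   (K * (4 * heron a b c - 16 * (a * b * c))) * heron a b c.
  transitivity ((1 - K) * 4 * heron a b c * (4 * a * b * c)); first by ring.
  transitivity (K * (4 * heron a b c - 4 * (4 * a * b * c)) * heron a b c); last by ring.
  by rewrite -KS; ring.
by rewrite e1 e2 ler_pM2r.
Qed.

End Vectors.

(** * Caps, hemispheres and packings expressed by dot products *)

Section Caps.
Context {R : realType}.
Implicit Types (u v w x y z c h n d p q : 'rV[R]_3) (k r : R).

Lemma S2_dot_itv u v : S2 u -> S2 v -> dot u v \in `[(-1), 1].
Proof. by move=> u1 v1; rewrite in_itv /= S2_dot_geN1 // S2_dot_le1. Qed.

Lemma cos_sdist u v : S2 u -> S2 v -> cos (sdist u v) = dot u v.
Proof. by move=> u1 v1; rewrite /sdist acosK // S2_dot_itv. Qed.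

Lemma sdist_itv u v : S2 u -> S2 v -> sdist u v \in `[0, pi].
Proof.
move=> u1 v1; have := S2_dot_itv u1 v1; rewrite !in_itv /= => h.
by rewrite /sdist acos_ge0 // acos_lepi.
Qed.

Lemma sdist_lt u v r : S2 u -> S2 v -> 0 <= r <= pi ->
  (sdist u v < r) = (cos r < dot u v).
Proof. by move=> u1 v1 hr; rewrite -(cos_sdist u1 v1) ltr_cos ?sdist_itv. Qed.

Lemma sdist_le u v r : S2 u -> S2 v -> 0 <= r <= pi ->
  (sdist u v <= r) = (cos r <= dot u v).
Proof. by move=> u1 v1 hr; rewrite !leNgt -(cos_sdist u1 v1) ltr_cos ?sdist_itv. Qed.

Lemma sdist_eq u v r : S2 u -> S2 v -> 0 <= r <= pi ->
  sdist u v = r <-> dot u v = cos r.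
Proof.
move=> u1 v1 hr; rewrite -(cos_sdist u1 v1); split => [->//|].
by apply: cos_inj; rewrite ?sdist_itv.
Qed.

Lemma capE x r p : S2 x -> 0 <= r <= pi -> cap x r p <-> S2 p /\ cos r <= dot x p.
Proof.
by move=> x1 hr; split=> -[p1 xp]; split; rewrite // ?sdist_le // -?sdist_le.
Qed.

Lemma S2_rotation u v (t : R) : S2 u -> S2 v -> dot u v = 0 ->
  S2 (cos t *: u + sin t *: v).
Proof.
rewrite /S2 /= => u1 v1 uv; rewrite !(dotDl, dotDr, dotZl, dotZr) u1 v1 (dotC v u) uv.
by rewrite !mulr0 addr0 add0r !mulr1 -!expr2 cos2Dsin2.
Qed.

Lemma sinterior_cap x r p : S2 x -> 0 <= r < pi / 2 ->
  sinterior (cap x r) p <-> S2 p /\ cos r < dot x p.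
Proof.
move=> x1 hr; have pi0 := pi_gt0 R.
have hr2 : 0 <= r <= pi by lra.
split=> -[p1].
  move=> [e e0 pe]; split=> //.
  have : cap x r p.
    apply: pe; split=> //; rewrite /sdist p1 acos1 //.
  move=> /(capE _ x1 hr2)[_]; rewrite le_eqVlt => /orP[/eqP xp|//].
  (* From a point of the boundary circle, a tangent direction [d] that does not lead towards [x]
     leaves the cap. *)
  have [d d1 [dp dx]] : exists2 d, S2 d & dot d p = 0 /\ dot d x <= 0.
    have [d d1 [dp _]] := S2_perp_exists p p.
    have [dx|dx] := lerP (dot d x) 0; first by exists d.
    by exists (- d); [exact: S2N|rewrite !dotNl dp; split; lra].
  pose t := Num.min (e / 2) (pi / 2).
  have ht : 0 < t <= pi / 2.
    by rewrite lt_min ge_min lexx orbT; apply/andP; split=> //; apply/andP; split; lra.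
  have te : t < e by rewrite gt_min; apply/orP; left; lra.
  have pd : dot p d = 0 by rewrite dotC.
  have q1 := S2_rotation t p1 d1 pd.
  have /(capE _ x1 hr2)[_] : cap x r (cos t *: p + sin t *: d).
    apply: pe; split=> //; rewrite /sdist dotDr !dotZr p1 pd mulr0 addr0 mulr1.
    by rewrite cosK // in_itv /=; lra.
  rewrite dotDr !dotZr -xp (dotC x d).
  have c0 : 0 < cos r by apply: cos_gt0_pihalf; lra.
  have ct : cos t < 1.
    by rewrite -(cos0 R) ltr_cos ?in_itv /=; lra.
  have st : 0 <= sin t by apply: sin_ge0_pi; lra.
  have h1 : sin t * dot d x <= 0 by rewrite mulr_ge0_le0.
  have h2 : cos t * cos r < cos r by rewrite gtr_pMl.
  by lra.
move=> xp; split=> //.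
pose k := Num.min 1 (dot x p - cos r).
have k0 : 0 < k by rewrite lt_min ltr01 subr_gt0.
have k1 : k <= 1 by rewrite ge_min lexx.
have kr : k <= dot x p - cos r by rewrite ge_min lexx orbT.
have kk : k ^+ 2 <= 1 by rewrite exprn_ile1 // ltW.
have kk0 : 0 < k ^+ 2 by rewrite exprn_gt0.
have ka : -1 <= 1 - k ^+ 2 / 2 < 1 by apply/andP; split; lra.
have ka' : -1 <= 1 - k ^+ 2 / 2 <= 1 by lra.
(* The angle whose chord has length [k]; a shorter chord changes the product with [x] by less than
   [k]. *)
exists (acos (1 - k ^+ 2 / 2)); first exact: acos_gt0.
move=> q [q1]; rewrite sdist_lt //; last by rewrite acos_ge0 // acos_lepi.
rewrite acosK ?in_itv //= => pq.
apply/(capE _ x1 hr2); split=> //.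
have := dotS2_sqr_le (p - q) x1.
have -> : dot (p - q) (p - q) = 2 - 2 * dot p q.
  by rewrite dotBl !dotBr p1 q1 (dotC q p); ring.
rewrite dotBr => h.
have h2 : (dot x p - dot x q) ^+ 2 < k ^+ 2 by lra.
have : dot x p - dot x q < k.
  apply: le_lt_trans (ler_norm _) _.
  by rewrite -(@ltr_pXn2r _ 2) ?nnegrE ?normr_ge0 // ?(ltW k0) // real_normK ?num_real.
by lra.
Qed.

Lemma S2_decomp n x p : S2 n ->
  dot x p = dot n x * dot n p + dot (x - dot n x *: n) (p - dot n p *: n).
Proof.
rewrite /S2 /= => n1.
by rewrite !(dotBl, dotBr, dotZl, dotZr) n1 (dotC x n); ring.
Qed.

(** The point of the line nearest to [z] is the normalized projection [q] of [z]. The converse is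
    Cauchy-Schwarz in the plane orthogonal to [n]. *)
Lemma line_disjoint_cap n z r : S2 n -> S2 z -> 0 <= r < pi / 2 ->
  line n `&` sinterior (cap z r) = set0 <-> sin r <= `|dot n z|.
Proof.
move=> n1 z1 hr; have pi0 := pi_gt0 R.
have s0 : 0 <= sin r by apply: sin_ge0_pi; lra.
have c0 : 0 < cos r by apply: cos_gt0_pihalf; lra.
split=> [dis|sn].
  rewrite leNgt; apply/negP => nz.
  have nz2 : dot n z ^+ 2 < sin r ^+ 2.
    by rewrite -[dot n z ^+ 2]real_normK ?num_real // ltr_pXn2r ?nnegrE.
  pose q := z - dot n z *: n.
  have qq : dot q q = 1 - dot n z ^+ 2.
    by rewrite /q !(dotBl, dotBr, dotZl, dotZr) n1 z1 (dotC z n); ring.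
  have qc : cos r ^+ 2 < dot q q by rewrite qq cos2sin2; lra.
  have q0 : q <> 0.
    by move=> q0; move: qc; rewrite q0 dot0l ltNge sqr_ge0.
  have nq : dot n q = 0 by rewrite /q dotBr dotZr n1; ring.
  have zq : dot z q = dot q q by rewrite {2}/q dotBl dotZl nq; ring.
  suff : (line n `&` sinterior (cap z r)) ((Num.sqrt (dot q q))^-1 *: q) by rewrite dis.
  split; first by split; [exact: S2_normalize|rewrite dotZr nq mulr0].
  apply/sinterior_cap => //; split; first exact: S2_normalize.
  have sq : 0 < Num.sqrt (dot q q) by rewrite sqrtr_gt0 dot_gt0.
  rewrite dotZr zq -{2}(sqr_sqrtr (dot_ge0 q)) expr2 mulKf ?gt_eqF //.
  by rewrite -(@ltr_pXn2r _ 2) ?nnegrE ?(ltW c0) ?(ltW sq) // sqr_sqrtr ?dot_ge0.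
apply/seteqP; split=> // p [[p1 np]] /(sinterior_cap _ z1 hr)[_ zp].
have E := S2_decomp z p n1; have CS := dot_sqr_le (z - dot n z *: n) (p - dot n p *: n).
rewrite np scale0r subr0 in E CS; rewrite mulr0 add0r in E; rewrite -E p1 mulr1 in CS.
move: CS.
have -> : dot (z - dot n z *: n) (z - dot n z *: n) = 1 - dot n z ^+ 2.
  by rewrite !(dotBl, dotBr, dotZl, dotZr) n1 z1 (dotC z n); ring.
have : cos r ^+ 2 < dot z p ^+ 2 by rewrite ltr_pXn2r ?nnegrE // ltW // (lt_trans c0).
have : sin r ^+ 2 <= dot n z ^+ 2.
  by rewrite -[dot n z ^+ 2]real_normK ?num_real // ler_pXn2r ?nnegrE.
by rewrite cos2sin2; lra.
Qed.

(** The test point is [cos r *: x + sin r *: m], on the boundary circle of the cap in the direction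
    [m] from [x] straight away from [n]. The converse is Cauchy-Schwarz in the plane orthogonal to
    [x]. *)
Lemma cap_hemisphere n x r : S2 n -> S2 x -> 0 <= r < pi / 2 ->
  cap x r `<=` hemisphere n <-> sin r <= dot n x.
Proof.
move=> n1 x1 hr; have pi0 := pi_gt0 R.
have hr2 : 0 <= r <= pi by lra.
have s0 : 0 <= sin r by apply: sin_ge0_pi; lra.
have c0 : 0 < cos r by apply: cos_gt0_pihalf; lra.
split=> [sub|sn p /(capE _ x1 hr2)[p1 xp]].
  have [_ nx] : hemisphere n x.
    by apply: sub; apply/capE => //; rewrite x1 cos_le1.
  rewrite leNgt; apply/negP => nxs.
  pose q := - (n - dot n x *: x).
  have qq : dot q q = 1 - dot n x ^+ 2.
    by rewrite /q dotNl dotNr !(dotBl, dotBr, dotZl, dotZr) n1 x1 (dotC x n); ring.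
  have xq : dot x q = 0 by rewrite /q dotNr dotBr dotZr x1 (dotC x n); ring.
  have nq : dot n q = - dot q q by rewrite qq /q dotNr dotBr dotZr n1; ring.
  have nxs2 : dot n x ^+ 2 < sin r ^+ 2 by rewrite ltr_pXn2r ?nnegrE.
  have qc : cos r ^+ 2 < dot q q by rewrite qq cos2sin2; lra.
  have q0 : q <> 0 by move=> q0; move: qc; rewrite q0 dot0l ltNge sqr_ge0.
  have sq : 0 < Num.sqrt (dot q q) by rewrite sqrtr_gt0 dot_gt0.
  have [m m1 [xm nm]] : exists2 m, S2 m & dot x m = 0 /\ dot n m = - Num.sqrt (dot q q).
    exists ((Num.sqrt (dot q q))^-1 *: q); first exact: S2_normalize.
    rewrite !dotZr xq nq mulr0 mulrN -{2}(sqr_sqrtr (dot_ge0 q)) expr2 mulKf //.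
    by rewrite gt_eqF.
  have p1 := S2_rotation r x1 m1 xm.
  have [_] : hemisphere n (cos r *: x + sin r *: m).
    apply: sub; apply/(capE _ x1 hr2); split; first exact: p1.
    by rewrite dotDr !dotZr x1 xm mulr0 addr0 mulr1.
  rewrite dotDr !dotZr nm mulrN subr_ge0 leNgt => /negP; apply.
  have cq : cos r < Num.sqrt (dot q q).
    by rewrite -(@ltr_pXn2r _ 2) ?nnegrE ?(ltW c0) ?(ltW sq) // sqr_sqrtr ?dot_ge0.
  have sp : 0 < sin r by apply: le_lt_trans nxs.
  apply: lt_le_trans (_ : cos r * sin r <= _); first by rewrite ltr_pM2l.
  by rewrite mulrC ler_pM2l // ltW.
split=> //.
have xp0 : 0 < dot x p by apply: lt_le_trans xp.
have E := S2_decomp n p x1.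
have CS := dot_sqr_le (n - dot x n *: x) (p - dot x p *: x).
set m := dot (n - _) _ in E CS.
have e1 : dot (n - dot x n *: x) (n - dot x n *: x) = 1 - dot n x ^+ 2.
  by rewrite !(dotBl, dotBr, dotZl, dotZr) n1 x1 (dotC x n); ring.
have e2 : dot (p - dot x p *: x) (p - dot x p *: x) = 1 - dot x p ^+ 2.
  by rewrite !(dotBl, dotBr, dotZl, dotZr) p1 x1 (dotC p x); ring.
rewrite e1 e2 in CS.
have h1 : sin r ^+ 2 <= dot n x ^+ 2 by rewrite ler_pXn2r ?nnegrE // (le_trans s0).
have h2 : cos r ^+ 2 <= dot x p ^+ 2 by rewrite ler_pXn2r ?nnegrE // ltW.
have cs := cos2Dsin2 r.
have h4 : 0 <= 1 - dot x p ^+ 2 by rewrite -e2 dot_ge0.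
have h3 : m ^+ 2 <= (cos r * sin r) ^+ 2.
  apply: le_trans CS _; rewrite exprMn; apply: ler_pM => //; try lra.
  by rewrite -e1 dot_ge0.
have : `|m| <= cos r * sin r.
  rewrite -(@ler_pXn2r _ 2) ?nnegrE ?normr_ge0 //; last by rewrite mulr_ge0 // ltW.
  by rewrite real_normK ?num_real.
rewrite ler_norml => /andP[mm _].
have : cos r * sin r <= dot x p * dot n x by rewrite ler_pM // ltW.
by rewrite E (dotC x n); move: mm; lra.
Qed.

(** Packing and separability as non-strict inequalities between dot products, a form that passes to
    subsets and to limits. *)
Definition sep_points (lambda rho : R) (X : set 'rV[R]_3) : Prop :=
  [/\ X `<=` S2,
    forall x y, X x -> X y -> x <> y -> dot x y <= cos (2 * rho) &
    forall x y, X x -> X y -> x <> y -> exists n, [/\ S2 n,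
      sin lambda <= dot n x, dot n y <= - sin lambda &
      forall z, X z -> sin lambda <= `|dot n z|]].

Lemma cos2E (x : R) : cos (2 * x) = 2 * cos x ^+ 2 - 1.
Proof. by rewrite mulrC mulr_natr cos_mulr2n mulr_natl. Qed.

Lemma caps_disjoint (rho : R) x y p : 0 < rho < pi / 2 -> S2 x -> S2 y -> S2 p ->
  cos rho < dot x p -> cos rho < dot y p -> cos (2 * rho) < dot x y.
Proof.
move=> hr x1 y1 p1 xp yp.
have c0 : 0 < cos rho by apply: cos_gt0_pihalf; lra.
have := dotS2_sqr_le (x + y) p1.
rewrite dotDr !(dotDl, dotDr) x1 y1 (dotC y x) (dotC p x) (dotC p y) cos2E.
have : (2 * cos rho) ^+ 2 < (dot x p + dot y p) ^+ 2.
  by rewrite ltr_pXn2r ?nnegrE //; lra.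
by rewrite exprMn; lra.
Qed.

Lemma packingP rho (X : set 'rV[R]_3) : 0 < rho < pi / 2 ->
  packing rho X <-> X `<=` S2 /\
    forall x y, X x -> X y -> x <> y -> dot x y <= cos (2 * rho).
Proof.
move=> hr; have pi0 := pi_gt0 R.
have hr1 : 0 <= rho < pi / 2 by lra.
have c0 : 0 < cos rho by apply: cos_gt0_pihalf; lra.
rewrite cos2E; split=> -[XS tr]; split=> // x y Xx Xy.
  have [x1 y1] := (XS _ Xx, XS _ Xy).
  move=> xy; rewrite leNgt; apply/negP => h; apply: xy; apply: tr => //.
  pose m := x + y.
  have mm : dot m m = 2 * (1 + dot x y).
    by rewrite /m !(dotDl, dotDr) x1 y1 (dotC y x); ring.
  have mc : (2 * cos rho) ^+ 2 < dot m m by rewrite mm exprMn; lra.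
  have m0 : m <> 0 by move=> m0; move: mc; rewrite m0 dot0l ltNge sqr_ge0.
  have sm : 0 < Num.sqrt (dot m m) by rewrite sqrtr_gt0 dot_gt0.
  have ms : 2 * cos rho < Num.sqrt (dot m m).
    rewrite -(@ltr_pXn2r _ 2) ?nnegrE ?(ltW sm) ?sqr_sqrtr ?dot_ge0 //.
    by rewrite mulr_ge0 // ltW.
  exists ((Num.sqrt (dot m m))^-1 *: m).
  have half : (Num.sqrt (dot m m))^-1 * (1 + dot x y) = Num.sqrt (dot m m) / 2.
    have -> : 1 + dot x y = dot m m / 2 by rewrite mm; field.
    by rewrite -{2}(sqr_sqrtr (dot_ge0 m)); field; rewrite gt_eqF.
  have m1 := S2_normalize m0.
  have xm : dot x m = 1 + dot x y by rewrite dotDr x1.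
  have ym : dot y m = 1 + dot x y by rewrite dotDr y1 dotC addrC.
  by split; apply/sinterior_cap => //; split; rewrite // dotZr ?xm ?ym half; lra.
have [x1 y1] := (XS _ Xx, XS _ Xy).
move=> [p [/(sinterior_cap _ x1 hr1)[p1 xp] /(sinterior_cap _ y1 hr1)[_ yp]]].
apply/eqP/negPn/negP => /eqP xy; have := tr x y Xx Xy xy.
by rewrite -cos2E leNgt (caps_disjoint hr x1 y1 p1).
Qed.

Lemma separable_packingP lambda rho (X : set 'rV[R]_3) :
  0 < rho < pi / 2 -> 0 <= lambda < pi / 2 ->
  separable_packing lambda rho X <-> sep_points lambda rho X.
Proof.
move=> hr hl; split.
  move=> [/(packingP _ hr)[XS pk] ts]; split=> // x y Xx Xy xy.
  have [n [n1 /cap_hemisphere nx /cap_hemisphere ny nz]] := ts x y Xx Xy xy.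
  exists n; split=> //; first by apply: nx => //; exact: XS.
    by have := ny (S2N n1) (XS _ Xy) hl; rewrite dotNl; lra.
  by move=> z Xz; apply/line_disjoint_cap => //; [exact: XS|exact: nz].
move=> [XS pk ts]; split; first by apply/packingP.
move=> x y Xx Xy xy; have [n [n1 nx ny nz]] := ts x y Xx Xy xy.
exists n; split=> //.
- by apply/cap_hemisphere => //; exact: XS.
- by apply/cap_hemisphere => //; [exact: S2N|exact: XS|rewrite dotNl; lra].
- by move=> z Xz; apply/line_disjoint_cap => //; [exact: XS|exact: nz].
Qed.

End Caps.

(** * Compactness *)

Lemma fmap_ultra (S T : Type) (f : S -> T) (F : set_system S) :
  UltraFilter F -> UltraFilter (f @ F).
Proof.
move=> FU; split; first exact: fmap_proper_filter.
move=> G GP FG; rewrite eqEsubset; split=> // A GA.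
have [//|FA] := in_ultra_setVsetC (f @^-1` A) FU.
have /FG GA' : (f @ F) (~` A) by [].
have : G (A `&` ~` A) by exact: filterI.
by rewrite setICr => /filter_not_empty.
Qed.

Section Limits.
Context {R : realType}.
Implicit Types (u v w x y z c h n d p q : 'rV[R]_3) (lambda rho r : R).

Lemma dot_cvg (T : Type) (F : set_system T) {FF : Filter F} (f g : T -> 'rV[R]_3) u v :
  f @ F --> u -> g @ F --> v -> dot (f t) (g t) @[t --> F] --> dot u v.
Proof.
move=> fu gv.
have cc (i : 'I_3) (a : T -> 'rV[R]_3) (b : 'rV[R]_3) : a @ F --> b -> a t 0 i @[t --> F] --> b 0 i.
  move=> ab; apply: (@cvg_comp _ _ _ a (fun m : 'rV[R]_3 => m 0 i)); first exact: ab.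
  exact: coord_continuous.
under eq_fun do rewrite dotE.
rewrite dotE; apply: cvgD; last by apply: cvgM; exact: cc.
by apply: cvgD; apply: cvgM; exact: cc.
Qed.

Lemma dot_continuous u : continuous (dot u).
Proof.
move=> v; apply: (@dot_cvg _ (nbhs v) _ (fun=> u) id u v); last exact: cvg_id.
exact: cvg_cst.
Qed.

Lemma dot_self_continuous : continuous (fun u : 'rV[R]_3 => dot u u).
Proof.
by move=> v; apply: (@dot_cvg _ (nbhs v) _ id id v v); exact: cvg_id.
Qed.

Lemma ball_dot_compact (M : R) : compact [set u : 'rV[R]_3 | dot u u <= M].
Proof.
apply: bounded_closed_compact; last first.
  rewrite (_ : [set _ | _] = (fun u : 'rV[R]_3 => dot u u) @^-1` [set t | t <= M]) //.
  by apply: preimage_closed; [move=> x _; exact: dot_self_continuous|exact: closed_le].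
exists (1 + M); split; first exact: num_real.
move=> x Mx u /= uM.
rewrite [leLHS]/Num.norm /= mx_normrE; apply/bigmax_leP; split.
  by apply: le_trans (_ : 1 + M <= _); [have := dot_ge0 u; lra|exact: ltW].
move=> [i j] _ /=; rewrite (ord1 i).
apply: (@le_trans _ _ (1 + M)); last exact: ltW.
have : u 0 j ^+ 2 <= dot u u.
  rewrite /dot (bigD1 j) //= expr2 lerDl sumr_ge0 // => k _.
  by rewrite -expr2 sqr_ge0.
rewrite -[X in X <= _]real_normK ?num_real //.
have := sqr_ge0 (`|u 0 j| - 1); rewrite sqrrB1 -mulr_natl => h1 h2.
have := normr_ge0 (u 0 j); lra.
Qed.

Lemma S2_closed : closed (@S2 R).
Proof.
rewrite (_ : S2 = (fun u : 'rV[R]_3 => dot u u) @^-1` [set 1]); last first.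
  by apply/seteqP; split.
apply: preimage_closed; first by move=> x _; exact: dot_self_continuous.
exact: closed_eq.
Qed.

Lemma S2_compact : compact (@S2 R).
Proof.
apply: subclosed_compact S2_closed (@ball_dot_compact 1) _ => u.
by rewrite /S2 /= => ->.
Qed.

Lemma S2_ultra_cvg (T : Type) (U : set_system T) (f : T -> 'rV[R]_3) :
  UltraFilter U -> (\forall t \near U, S2 (f t)) -> exists2 l, S2 l & f @ U --> l.
Proof.
move=> UU fS; have := S2_compact; rewrite compact_ultra.
by move=> /(_ _ (fmap_ultra f UU) fS)[l [l1 fl]]; exists l.
Qed.

Lemma cos_lt1 r : 0 < r <= pi -> cos r < 1.
Proof.
by move=> hr; have := pi_gt0 R; rewrite -(cos0 R) ltr_cos ?in_itv /=; lra.
Qed.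

(** An injective sequence of centers would converge along an ultrafilter refining [\oo], and two of
    its terms would both be within [rho] of the limit. *)
Lemma sep_points_finite lambda rho (X : set 'rV[R]_3) : 0 < rho < pi / 2 ->
  sep_points lambda rho X -> finite_set X.
Proof.
move=> hr [XS pk _]; apply: contrapT => /infiniteP/pcard_leP[f].
have [U [UU oU]] := @ultraFilterLemma nat \oo _.
have fX (k : nat) : X (f k) by exact: funS.
have [l l1 fl] : exists2 l, S2 l & f @ U --> l.
  by apply: S2_ultra_cvg; apply: nearW => k; exact: XS.
have fl1 : dot (f k) l @[k --> U] --> (1 : R).
  by rewrite -l1; apply: dot_cvg => //; exact: cvg_cst.
have c1 : cos rho < 1 by apply: cos_lt1; have := pi_gt0 R; lra.
have near1 : \forall k \near U, cos rho < dot (f k) l by exact: (cvgr_gt _ fl1 _ c1).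
have /filter_ex[k1 k1l] := near1.
have : \forall k \near U, cos rho < dot (f k) l /\ (k1 < k)%N.
  by apply: filterI => //; apply: oU; exact: nbhs_infty_gt.
move=> /filter_ex[k2 [k2l k12]].
have := caps_disjoint hr (XS _ (fX k1)) (XS _ (fX k2)) l1 k1l k2l.
rewrite ltNge pk // => /(@inj _ _ _ f); rewrite !inE => /(_ I I) kk.
by rewrite kk ltnn in k12.
Qed.

Lemma covering_radii_pi lambda rho : 0 < rho < pi / 2 -> 0 <= lambda < pi / 2 ->
  covering_radii lambda rho (pi : R).
Proof.
move=> hr hl; split; first exact: pi_gt0.
have [d d1 _] := S2_perp_exists (0 : 'rV[R]_3) 0.
exists [set d]; first (apply/separable_packingP => //; split).
- by move=> _ ->.
- by move=> x y -> -> /(_ erefl).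
- by move=> x y -> -> /(_ erefl).
move=> p p1; exists d => //; apply/capE => //; first by rewrite pi_ge0 lexx.
by rewrite cospi S2_dot_geN1.
Qed.

(* Limits along an ultrafilter of all selections of points of [X k]: no bound on the
   number of points is needed. *)
Definition ultra_limit (U : set_system nat) (X : nat -> set 'rV[R]_3) : set 'rV[R]_3 :=
  [set l | exists2 f : nat -> 'rV[R]_3, (forall k, X k (f k)) & f @ U --> l].

(** Normals of separating lines converge along with the points, by compactness of the sphere.
    Selections with different limits differ on a set of the ultrafilter, and there the separability
    of [X k] applies. *)
Lemma ultra_limit_sep (U : set_system nat) (X : nat -> set 'rV[R]_3) lambda rho :
  UltraFilter U -> (forall k, sep_points lambda rho (X k)) ->
  sep_points lambda rho (ultra_limit U X).
Proof.
move=> UU hX.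
have XS k : X k `<=` S2 by have [] := hX k.
have LS : ultra_limit U X `<=` S2.
  move=> l [f fX fl]; rewrite /S2 /=.
  have h : dot (f k) (f k) @[k --> U] --> dot l l by exact: dot_cvg.
  have ff k : dot (f k) (f k) = 1 := XS k _ (fX k).
  have h1 : dot (f k) (f k) @[k --> U] --> (1 : R).
    by under eq_fun do rewrite ff; exact: cvg_cst.
  exact: (cvg_unique (@norm_hausdorff _ _) h h1).
have neq (f g : nat -> 'rV[R]_3) x y : f @ U --> x -> g @ U --> y -> x <> y ->
    \forall k \near U, f k <> g k.
  move=> fx gy xy; have [fg|//] := in_ultra_setVsetC [set k | f k = g k] UU.
  exfalso; apply: xy; apply: (cvg_unique (@norm_hausdorff _ _) fx).
  apply: cvg_trans gy; apply: near_eq_cvg.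
  by apply: filterS fg => k /= ->.
split=> //.
- move=> x y [f fX fx] [g gX gy] xy.
  apply: (cvgr_to_le (dot_cvg fx gy)).
  apply: filterS (neq _ _ _ _ fx gy xy) => k fg.
  by have [_ h _] := hX k; exact: h.
move=> x y [f fX fx] [g gX gy] xy.
have /choice[n nP] : forall k, exists n, f k <> g k -> [/\ S2 n,
    sin lambda <= dot n (f k), dot n (g k) <= - sin lambda &
    forall z, X k z -> sin lambda <= `|dot n z|].
  (* [0] is a placeholder at the indices where the two points coincide, a set outside the
     ultrafilter. *)
  move=> k; have [fg|fg] := pselect (f k = g k); first by exists 0.
  by have [_ _ /(_ _ _ (fX k) (gX k) fg)[n nP]] := hX k; exists n.
have nfg := neq _ _ _ _ fx gy xy.
have [n0 n01 nn] : exists2 l, S2 l & n @ U --> l.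
  by apply: S2_ultra_cvg; apply: filterS nfg => k /nP[].
exists n0; split=> //.
- apply: (cvgr_to_ge (dot_cvg nn fx)).
  by apply: filterS nfg => k /nP[].
- apply: (cvgr_to_le (dot_cvg nn gy)).
  by apply: filterS nfg => k /nP[].
move=> z [e eX ez]; apply: (cvgr_to_ge (cvg_norm (dot_cvg nn ez))).
by apply: filterS nfg => k /nP[_ _ _]; apply.
Qed.

(** Coverings with radii tending to the infimum have an ultralimit covering with the infimum itself:
    the centers chosen to cover a fixed point converge to a center that covers it. *)
Lemma gamma_min lambda rho : 0 < rho < pi / 2 -> 0 <= lambda < pi / 2 ->
  covering_radii lambda rho (gamma lambda rho) /\
  lbound (covering_radii lambda rho) (gamma lambda rho).
Proof.
move=> hr hl.
set CR := covering_radii lambda rho.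
have CRpi : CR pi by exact: covering_radii_pi.
have CRlb : has_lbound CR by exists 0 => r [/ltW].
have hinf : has_inf CR by split; [exists pi|].
set r0 := inf CR.
have lb : lbound CR r0 by exact: ge_inf.
have r00 : 0 <= r0 by apply: lb_le_inf; [exists pi|move=> r [/ltW]].
suff C0 : CR r0.
  by apply: (@xgetPex _ 0 [set r | CR r /\ lbound CR r]); exists r0.
have /choice[rk rkP] : forall k : nat, exists r, CR r /\ r < r0 + k.+1%:R^-1.
  move=> k; have [|r Cr rk] := @inf_adherent _ CR k.+1%:R^-1 _ hinf; first by rewrite invr_gt0.
  by exists r.
have /choice[X XP] : forall k, exists X : set 'rV[R]_3, sep_points lambda rho X /\
    S2 `<=` \bigcup_(x in X) cap x (rk k).
  move=> k; have [[_ [X /separable_packingP Xs Xc]] _] := rkP k.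
  by exists X; split=> //; exact: Xs.
have [U [UU oU]] := @ultraFilterLemma nat \oo _.
have Lsep := @ultra_limit_sep U X lambda rho UU (fun k => (XP k).1).
have [LS Lpk _] := Lsep.
have Lcov p : S2 p -> exists2 l, ultra_limit U X l & sdist l p <= r0.
  move=> p1.
  have /choice[f fP] : forall k, exists x, X k x /\ sdist x p <= rk k.
    by move=> k; have [x Xx [_ xp]] := (XP k).2 p p1; exists x.
  have fS k : S2 (f k) by have [[h _ _] _] := XP k; apply: h; case: (fP k).
  have [l l1 fl] : exists2 l, S2 l & f @ U --> l.
    by apply: S2_ultra_cvg; apply: nearW.
  exists l; first by exists f => // k; case: (fP k).
  rewrite leNgt; apply/negP => rl.
  have := sdist_itv l1 p1; rewrite in_itv /= => lp.
  pose t := (r0 + sdist l p) / 2.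
  have ht : 0 <= t <= pi by rewrite /t; lra.
  have lt_ : t < sdist l p by rewrite /t; lra.
  have : cos t <= dot l p.
    have fp : dot (f k) p @[k --> U] --> dot l p by apply: dot_cvg => //; exact: cvg_cst.
    apply: (cvgr_to_ge fp).
    have : \forall k \near U, k.+1%:R^-1 < t - r0.
      have tr : 0 < t - r0 by rewrite /t; lra.
      by apply: oU; exact: (near_infty_natSinv_lt (PosNum tr)).
    apply: filterS => k /= tk.
    rewrite -sdist_le //; have [_ /le_trans] := fP k; apply.
    have [_ /ltW rkr] := rkP k; apply: le_trans rkr _.
    by rewrite -lerBrDl ltW.
  by rewrite -sdist_le // leNgt lt_.
split; last first.
  exists (ultra_limit U X); first exact/separable_packingP.
  by move=> p p1; have [l Ll lp] := Lcov p p1; exists l.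
(* An infimum [0] would turn every point of the sphere into a center, and centers at distance [rho]
   are too close. *)
rewrite lt_neqAle r00 andbT; apply/eqP => r0E.
have Lall p : S2 p -> ultra_limit U X p.
  move=> p1; have [l Ll] := Lcov p p1; have l1 := LS _ Ll.
  rewrite -r0E sdist_le ?lexx ?pi_ge0 // cos0 => /(S2_dot_eq1 l1 p1) <-.
  exact: Ll.
have [u u1 _] := S2_perp_exists (0 : 'rV[R]_3) 0.
have [v v1 [vu _]] := S2_perp_exists u u.
have uv : dot u v = 0 by rewrite dotC.
have w1 := S2_rotation rho u1 v1 uv.
have uw : dot u (cos rho *: u + sin rho *: v) = cos rho.
  by rewrite dotDr !dotZr u1 uv; ring.
have := Lpk _ _ (Lall _ u1) (Lall _ w1).
have cr := cos_lt1 (r := rho); have pi0 := pi_gt0 R.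
have c1 : cos rho < 1 by apply: cr; lra.
have -> : dot u (cos rho *: u + sin rho *: v) <= cos (2 * rho) = false.
  apply/negbTE; rewrite -ltNge uw ltr_cos ?in_itv /=; lra.
by move=> h; suff : false by []; apply: h => uE; move: c1; rewrite -uw -uE u1 ltxx.
Qed.
End Limits.

(** * The Delaunay decomposition *)

Section Cones.
Context {R : realType}.
Implicit Types (u v w x y z c h d p q : 'rV[R]_3) (k r eta : R).
Implicit Types (V W X : set 'rV[R]_3).

Definition cone V : set 'rV[R]_3 :=
  [set p | exists n (v : 'I_n -> 'rV[R]_3) (a : 'I_n -> R),
    (forall i, V (v i) /\ 0 <= a i) /\ p = \sum_i a i *: v i].

Lemma cone_ind V (P : 'rV[R]_3 -> Prop) :
  P 0 -> (forall k v q, 0 <= k -> V v -> cone V q -> P q -> P (k *: v + q)) ->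
  forall p, cone V p -> P p.
Proof.
move=> P0 Ps _ [n [v [a [va ->]]]].
elim: n v a va => [|n IH] v a va; first by rewrite big_ord0.
rewrite big_ord_recl; have [Vv a0] := va ord0; apply: Ps => //.
  by exists n, (fun i => v (lift ord0 i)), (fun i => a (lift ord0 i)).
exact: (IH (fun i => v (lift ord0 i)) (fun i => a (lift ord0 i))).
Qed.

Lemma cone0 V : cone V 0.
Proof. by exists 0%N, (fun=> 0), (fun=> 0); split=> [[]//|]; rewrite big_ord0. Qed.

Lemma cone_cons V k v q : 0 <= k -> V v -> cone V q -> cone V (k *: v + q).
Proof.
move=> k0 Vv [n [w [a [wa ->]]]].
exists n.+1, (fun i => oapp w v (unlift ord0 i)), (fun i => oapp a k (unlift ord0 i)).
split=> [i|]; first by case: unliftP => [j _|_] /=; [exact: wa|].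
rewrite big_ord_recl unlift_none /=; congr (_ + _).
by apply: eq_bigr => i _; rewrite liftK.
Qed.

Lemma cone_sub V W : V `<=` W -> cone V `<=` cone W.
Proof.
move=> VW p; apply: (@cone_ind V (cone W)); first exact: cone0.
by move=> k v q k0 /VW Wv _; exact: cone_cons.
Qed.

Lemma cone_mem V v : V v -> cone V v.
Proof.
by move=> Vv; rewrite -[v]scale1r -[_ *: _]addr0; apply: cone_cons (cone0 V).
Qed.

(** Induction on the generators. When [d] separates [p] from [s] but is positive at the new
    generator [v], everything is projected along [v] onto the plane orthogonal to [d]. A
    representation of the projected point lifts, as the projection adds to each element of [s] a
    nonnegative multiple of [v]; a functional separating the projections is pulled back. *)
Lemma farkas (s : seq 'rV[R]_3) p :
  cone [set` s] p \/ exists2 d, (forall x, x \in s -> dot d x <= 0) & 0 < dot d p.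
Proof.
have [n] := ubnP (size s); elim: n s p => // n IH [|v s] p /=.
  move=> _; have [->|p0] := pselect (p = 0); first by left; exact: cone0.
  by right; exists p => //; exact: dot_gt0.
rewrite ltnS => sn.
have [cp|[d ds dp]] := IH s p sn.
  by left; apply: cone_sub cp => x /= xs; rewrite in_cons xs orbT.
have [dv|dv] := lerP (dot d v) 0.
  by right; exists d => // x; rewrite in_cons => /orP[/eqP ->|/ds].
have dv0 : dot d v != 0 by rewrite gt_eqF.
pose f x := x - (dot d x / dot d v) *: v.
have fs : (size (map f s) < n)%N by rewrite size_map.
have [cp|[d' d's d'p]] := IH (map f s) (f p) fs.
  left; have [t t0 ct] : exists2 t, t <= 0 & cone [set` s] (f p + t *: v).
    move: cp; move: (f p) => q; 
    apply: (@cone_ind _ (fun q => exists2 t, t <= 0 & cone [set` s] (q + t *: v)))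
      => [|k _ q' k0 /mapP[x xs ->] _ [t t0 ct]].
      by exists 0 => //; rewrite scale0r addr0; exact: cone0.
    exists (t + k * (dot d x / dot d v)).
      have : k * (dot d x / dot d v) <= 0.
        by rewrite mulr_ge0_le0 // mulr_le0_ge0 ?ds // invr_ge0 ltW.
      by lra.
    have -> : k *: f x + q' + (t + k * (dot d x / dot d v)) *: v = k *: x + (q' + t *: v).
      rewrite /f scalerBr scalerA scalerDl.
      by apply: row3P; rewrite !mxE; ring.
    exact: cone_cons.
  have -> : p = (dot d p / dot d v - t) *: v + (f p + t *: v).
    by apply: row3P; rewrite !mxE; ring.
  apply: cone_cons; [|exact: mem_head|].
    by rewrite subr_ge0 (le_trans t0) // divr_ge0 // ltW.
  by apply: cone_sub ct => x /= xs; rewrite in_cons xs orbT.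
right; exists (d' - (dot d' v / dot d v) *: d); last first.
  by move: d'p; rewrite /f dotBl dotZl dotBr dotZr mulrAC [in X in _ -> X]mulrAC (mulrC (dot d p)).
move=> x; rewrite in_cons => /orP[/eqP ->|xs].
  by rewrite dotBl dotZl divfK // subrr.
have := d's (f x) (map_f f xs).
by rewrite /f dotBl dotZl dotBr dotZr mulrAC [in X in _ -> X]mulrAC (mulrC (dot d x)).
Qed.

Lemma eps_exists (s : seq 'rV[R]_3) (f : 'rV[R]_3 -> R) :
  (forall x, x \in s -> 0 < f x) -> exists2 e, 0 < e & forall x, x \in s -> e <= f x.
Proof.
elim: s => [|v s IH] fs; first by exists 1.
have [|e e0 es] := IH; first by move=> x xs; apply: fs; rewrite in_cons xs orbT.
exists (Num.min e (f v)); first by rewrite lt_min e0 fs ?mem_head.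
move=> x; rewrite in_cons ge_min => /orP[/eqP ->|/es ->//].
by rewrite lexx orbT.
Qed.

(** Membership of [h] in the polar body of [X]. If [1 < dot h h], the plane [dot h x = 1] bounds a
    cap around [h] with no point of [X] in its interior. *)
Definition supports X h : Prop := forall x, X x -> dot h x <= 1.

Definition facet X h : set 'rV[R]_3 := [set x | X x /\ dot h x = 1].

Definition spanning V : Prop := forall d, (forall v, V v -> dot d v = 0) -> d = 0.

(** Constraints that are not tight at [h] leave room in both directions, so only [facet X h]
    restricts small perturbations. *)
Lemma small_step X h d : finite_set X -> supports X h ->
  exists2 e, 0 < e & forall x, X x -> dot h x <> 1 -> dot h x + `|e * dot d x| <= 1.
Proof.
move=> /finite_seqP[s ->] hs.
pose f x := if dot h x == 1 then 1 else (1 - dot h x) / (1 + `|dot d x|).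
have [|e e0 es] := @eps_exists s f.
  move=> x xs; rewrite /f; case: eqP => [//|/eqP hx].
  rewrite divr_gt0 // ?subr_gt0 ?lt_neqAle ?hx ?hs //.
exists e => // x xs /eqP hx; have := es x xs; rewrite /f (negbTE hx).
have dx := normr_ge0 (dot d x).
rewrite ler_pdivlMr; last by lra.
by rewrite normrM gtr0_norm //; lra.
Qed.

(* Among the [h] of the polar body maximizing [dot h p], one of maximal norm is a vertex. *)
Lemma facet_cover X eta p : finite_set X -> X `<=` S2 -> 0 < eta ->
  (forall d, S2 d -> exists2 x, X x & eta <= dot d x) -> S2 p ->
  exists h, [/\ supports X h, spanning (facet X h) & cone (facet X h) p].
Proof.
move=> finX XS eta0 cov p1.
(* Applied to the direction of [h], the covering hypothesis bounds the norm of [h] by the inverse of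
   [eta]. *)
have Kc : compact [set h | supports X h].
  apply: (subclosed_compact _ (@ball_dot_compact R (eta ^- 2))) => [|h hX].
    rewrite (_ : [set h | _] = \bigcap_(x in X) [set h | dot h x <= 1]) //.
    apply: closed_bigI => x Xx.
    rewrite (_ : [set h | _] = (dot x) @^-1` [set t | t <= 1]); last first.
      by apply/seteqP; split=> h /=; rewrite dotC.
    by apply: preimage_closed; [move=> y _; exact: dot_continuous|exact: closed_le].
  have [->|h0] := pselect (h = 0).
    by rewrite /= dot0l invr_ge0 sqr_ge0.
  have [x Xx] := cov _ (S2_normalize h0).
  have sh : 0 < Num.sqrt (dot h h) by rewrite sqrtr_gt0 dot_gt0.
  rewrite dotZl mulrC ler_pdivlMr // => hx.
  have h1 : eta * Num.sqrt (dot h h) <= 1 := le_trans hx (hX x Xx).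
  rewrite /= -(sqr_sqrtr (dot_ge0 h)) -div1r ler_pdivlMr ?exprn_gt0 // -exprMn mulrC.
  by rewrite exprn_ile1 // mulr_ge0 // ltW.
have [h0 h0K h0max] : exists2 c, c \in [set h | supports X h] &
    forall t, t \in [set h | supports X h] -> dot p t <= dot p c.
  apply: EVT_max_rV => //; last exact: (continuous_subspaceT (@dot_continuous R p)).
  by exists 0 => x _; rewrite dot0l.
rewrite inE in h0K.
pose M := [set h | supports X h] `&` [set h | dot p h = dot p h0].
have Mc : compact M.
  apply: (subclosed_compact _ Kc) => [|h []//].
  apply: closedI; first by apply: compact_closed Kc; exact: norm_hausdorff.
  rewrite (_ : [set h | _] = (dot p) @^-1` [set dot p h0]) //.
  by apply: preimage_closed; [move=> y _; exact: dot_continuous|exact: closed_eq].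
have [h hM hmax] : exists2 c, c \in M & forall t, t \in M -> dot t t <= dot c c.
  apply: EVT_max_rV => //; last exact: (continuous_subspaceT (@dot_self_continuous R)).
  by exists h0.
rewrite inE in hM; have [hK hp] := hM.
(* Otherwise a Farkas vector gives a direction in which [dot h p] still grows within the polar
   body. *)
have cp : cone (facet X h) p.
  have /finite_seqP[s sE] : finite_set (facet X h) by apply: sub_finite_set finX => x [].
  have [|[d ds dp]] := farkas s p; first by rewrite sE.
  exfalso; have [e e0 es] := small_step d finX hK.
  have hd : supports X (h + e *: d).
    move=> x Xx; rewrite dotDl dotZl.
    have [hx|hx] := eqVneq (dot h x) 1.
      have /ds dx : x \in s by have : facet X h x by []; rewrite sE.
      by have : e * dot d x <= 0 := mulr_ge0_le0 (ltW e0) dx; lra.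
    by have := es x Xx (elimN eqP hx); have := ler_norm (e * dot d x); lra.
  have := h0max (h + e *: d); rewrite inE => /(_ hd).
  rewrite -hp dotDr dotZr (dotC p d); have := mulr_gt0 e0 dp; lra.
exists h; split=> // d dV; apply: contrapT => d0.
have dp : dot d p = 0.
  apply: (@cone_ind _ (fun q => dot d q = 0) _ _ _ cp); first by rewrite dot0r.
  by move=> k v q _ Vv _ dq; rewrite dotDr dotZr dV // dq; ring.
have [e e0 es] := small_step d finX hK.
have hd (sg : R) : `|sg| = 1 -> M (h + (sg * e) *: d).
  move=> sg1; split; last by rewrite /= dotDr dotZr (dotC p d) dp mulr0 addr0.
  move=> x Xx; rewrite dotDl dotZl.
  have [hx|hx] := eqVneq (dot h x) 1; first by rewrite hx dV ?mulr0 ?addr0.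
  have := es x Xx (elimN eqP hx); have := ler_norm (sg * e * dot d x).
  by rewrite -mulrA normrM sg1 mul1r mulrA; lra.
(* The moves by [e *: d] and by its opposite both stay in [M], and one of them increases the
   norm. *)
have h1 := hmax (h + (1 * e) *: d); have h2 := hmax (h + (-1 * e) *: d).
rewrite !inE in h1 h2.
have := h1 (hd 1 (normr1 _)); have := h2 (hd (-1) (normrN1 _)).
rewrite !(dotDl, dotDr, dotZl, dotZr) (dotC d h).
have : 0 < e ^+ 2 * dot d d by rewrite mulr_gt0 ?exprn_gt0 ?dot_gt0.
by lra.
Qed.

End Cones.

Section Delaunay.
Context {R : realType}.
Implicit Types (u v w x y z c h d p q : 'rV[R]_3) (k r eta : R).
Implicit Types (V W X : set 'rV[R]_3).

(* By [cells_delaunay], this is the Delaunay decomposition. *)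
Definition cells X : set (set 'rV[R]_3) :=
  [set V | exists h, [/\ supports X h, V = facet X h & spanning V]].

Definition pole h : 'rV[R]_3 := (Num.sqrt (dot h h))^-1 *: h.

Lemma pole_radius h : 1 < dot h h -> 0 < (Num.sqrt (dot h h))^-1 < 1.
Proof.
move=> h1; have s1 : 1 < Num.sqrt (dot h h) by rewrite -sqrtr1 ltr_sqrt // (lt_trans ltr01).
by rewrite invr_gt0 (lt_trans ltr01 s1) invf_lt1 // (lt_trans ltr01).
Qed.

Lemma acos_itv k : 0 < k < 1 -> 0 < acos k < pi / 2 /\ cos (acos k) = k.
Proof.
move=> hk; have k1 : -1 <= k <= 1 by lra.
have ck : cos (acos k) = k by rewrite acosK // in_itv.
have pi0 := pi_gt0 R.
split=> //; rewrite acos_gt0; last by lra.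
rewrite -ltr_cos ?in_itv /= ?acos_ge0 ?acos_lepi //; last by lra.
by rewrite ck cos_pihalf; lra.
Qed.

(** For a unit vector [v] with [dot h v = 1] the squared distance from [h] is [dot h h - 1]; if this
    is not positive, only [v = h] remains, and a single vector does not span. *)
Lemma spanning_normsq V h : V `<=` S2 -> (forall v, V v -> dot h v = 1) ->
  spanning V -> 1 < dot h h.
Proof.
move=> VS hV sp; rewrite ltNge; apply/negP => hh.
have [d d0 [dh _]] := perp_exists h h.
apply: d0; apply: sp => v Vv; have v1 : dot v v = 1 := VS v Vv.
have -> // : v = h.
have : dot (h - v) (h - v) <= 0.
  by rewrite dotBl !dotBr (dotC v h) (hV v Vv) v1; lra.
move=> hv; have /dot_eq0/eqP : dot (h - v) (h - v) = 0 by apply/eqP; rewrite eq_le hv dot_ge0.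
by rewrite subr_eq0 => /eqP.
Qed.

(** Used in both directions, this makes the functionals of two cells agree on their overlap; with
    [u] the point itself, it places a cell in its circumdisk. *)
Lemma cone_dot_le X h u p : supports X h -> (forall x, X x -> dot u x <= 1) ->
  forall V, V `<=` facet X h -> cone V p -> dot u p <= dot h p.
Proof.
move=> hX uX V VX; apply: (@cone_ind _ _ (fun q => dot u q <= dot h q)).
  by rewrite !dot0r.
move=> k v q k0 /VX[Xv hv] _ uq; rewrite !dotDr !dotZr hv.
by have := ler_wpM2l k0 (uX v Xv); lra.
Qed.

(** The two functionals agree at [p]. In an expansion of [p] over [facet X h] each term contributes
    at least as much to [dot h] as to [dot h'], so the generators with positive coefficients lie on
    both facets. *)
Lemma cone_facetI X h h' p : supports X h -> supports X h' ->
  cone (facet X h) p -> cone (facet X h') p -> cone (facet X h `&` facet X h') p.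
Proof.
move=> hX h'X cp c'p.
have hp : dot h p <= dot h' p by exact: (cone_dot_le h'X hX (@subset_refl _ _) c'p).
have : dot h' p <= dot h p /\
  (dot h p <= dot h' p -> cone (facet X h `&` facet X h') p); last by move=> [_]; apply.
move: p cp {c'p hp}.
apply: (@cone_ind _ _ (fun p => dot h' p <= dot h p /\
  (dot h p <= dot h' p -> cone (facet X h `&` facet X h') p))).
  by rewrite !dot0r; split=> // _; exact: cone0.
move=> k v q k0 [Xv hv] cq [hq IH]; rewrite !dotDr !dotZr hv.
have := ler_wpM2l k0 (h'X v Xv); move=> kv; split; first by lra.
move=> h2; have [k00|kn0] := eqVneq k 0.
  by rewrite k00 scale0r add0r; apply: IH; rewrite k00 in h2; lra.
have h'v : dot h' v = 1.
  by apply: (mulfI kn0); lra.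
by apply: cone_cons => //; apply: IH; lra.
Qed.

Lemma cells_sconvI X h h' : supports X h -> supports X h' ->
  sconv (facet X h) `&` sconv (facet X h') = sconv (facet X h `&` facet X h').
Proof.
move=> hX h'X; apply/seteqP; split=> p.
  by move=> [[p1 cp] [_ c'p]]; split=> //; exact: cone_facetI.
by move=> [p1 cp]; split; split=> //; apply: cone_sub cp => x [].
Qed.

Lemma facet_inj3 X u v w h h' : X `<=` S2 -> facet X h u -> facet X h v -> facet X h w ->
  facet X h' u -> facet X h' v -> facet X h' w -> u <> v -> v <> w -> w <> u -> h = h'.
Proof.
move=> XS [Xu hu] [Xv hv] [Xw hw] [_ hu'] [_ hv'] [_ hw'] uv vw wu.
have [D0 _ _] := circumradius_heron (XS _ Xu) (XS _ Xv) (XS _ Xw) hu hv hw uv vw wu.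
apply: (scalerI D0).
by rewrite !det3_decomp hu hv hw hu' hv' hw'.
Qed.

Lemma sinterior_inj V W h h' p : (forall q, sconv V q -> sconv W q -> dot h q = dot h' q) ->
  sinterior (sconv V) p -> sinterior (sconv W) p -> h = h'.
Proof.
move=> hh [p1 [e e0 eV]] [_ [e' e'0 e'W]].
have gq q : S2 q -> sdist p q < e -> sdist p q < e' -> dot (h - h') q = 0.
  move=> q1 qe qe'; have qV : sconv V q by apply: eV.
  have qW : sconv W q by apply: e'W.
  by rewrite dotBl hh // subrr.
apply/eqP; rewrite -subr_eq0; apply/eqP; apply: contrapT => g0.
have pi0 := pi_gt0 R.
have gp : dot (h - h') p = 0 by apply: gq; rewrite // /sdist p1 acos1.
pose d := pole (h - h'); have d1 : S2 d by exact: S2_normalize.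
have pd : dot p d = 0 by rewrite /d /pole dotZr dotC gp mulr0.
pose t := Num.min (pi / 2) (Num.min (e / 2) (e' / 2)).
have t0 : 0 < t by rewrite !lt_min !divr_gt0.
have tpi : t <= pi / 2 by rewrite /t ge_min lexx.
have te : t <= e / 2 by rewrite /t !ge_min lexx orbT.
have te' : t <= e' / 2 by rewrite /t !ge_min lexx !orbT.
have q1 := S2_rotation t p1 d1 pd.
have pq : sdist p (cos t *: p + sin t *: d) = t.
  apply/sdist_eq => //; first by lra.
  by rewrite dotDr (dotZr (cos t)) (dotZr (sin t)) p1 pd; ring.
have := gq _ q1; rewrite pq dotDr (dotZr (cos t)) (dotZr (sin t)) gp mulr0 add0r.
have st : sin t != 0 by rewrite gt_eqF // sin_gt0_pi //; lra.
have gd : dot (h - h') d != 0.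
  have gg := dot_gt0 g0.
  by rewrite /d /pole dotZr mulf_neq0 ?invr_eq0 ?sqrtr_eq0 -?ltNge // gt_eqF.
have tt1 : t < e by lra.
have tt2 : t < e' by lra.
by move=> /(_ tt1 tt2)/eqP; rewrite mulf_eq0 (negbTE st) (negbTE gd).
Qed.

(** The difference [h - h'] vanishes at the shared vertices and is positive at the others, so it is
    the normal of the edge. *)
Lemma facet_polygon_edge X h h' a b : X `<=` S2 -> supports X h -> supports X h' ->
  h <> h' -> a <> b -> facet X h `&` facet X h' = [set a; b] ->
  polygon_edge (facet X h) a b.
Proof.
move=> XS hX h'X hh ab I.
have [[Xa ha] [_ h'a]] : (facet X h `&` facet X h') a by rewrite I; left.
have [[Xb hb] [_ h'b]] : (facet X h `&` facet X h') b by rewrite I; right.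
split=> //; have g0 : h - h' <> 0 by move/eqP; rewrite subr_eq0 => /eqP.
exists (pole (h - h')).
have gE x : dot (pole (h - h')) x =
    (Num.sqrt (dot (h - h') (h - h')))^-1 * (dot h x - dot h' x).
  by rewrite /pole dotZl (dotBl h h' x).
rewrite !gE ha h'a hb h'b !subrr !mulr0; split=> //; first exact: S2_normalize.
move=> v [Xv hv] va vb; rewrite gE mulr_gt0 ?invr_gt0 ?sqrtr_gt0 ?dot_gt0 //.
rewrite hv subr_gt0 lt_neqAle h'X // andbT; apply/eqP => h'v.
have : [set a; b] v by rewrite -I; split; split.
by case.
Qed.

Lemma cell_polygon X V : finite_set X -> X `<=` S2 -> cells X V -> convex_polygon V.
Proof.
move=> finX XS [h [hX VE sp]].
have VX : V `<=` X by rewrite VE => x [].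
have VS : V `<=` S2 by move=> x /VX/XS.
have hV v : V v -> dot h v = 1 by rewrite VE => -[].
have hh := spanning_normsq VS hV sp.
have [k0 k1] := andP (pole_radius hh).
split=> //.
- exact: sub_finite_set finX.
- exists (pole h); last by move=> v Vv; rewrite /pole dotZl (hV v Vv) mulr1.
  by apply: S2_normalize => h0; rewrite h0 dot0l ltr10 in hh.
- move=> [n n1 nV]; apply: (S2_neq0 n1); apply: sp => v /nV[].
  by [].
move=> v Vv [v1 cv].
(* Every other vertex [w] has [dot v w < 1 = dot h w], and the strict inequality persists for
   nonzero combinations, while at [v] both sides are [1]. *)
have : v = 0 \/ dot v v < dot h v.
  move: cv; apply: (@cone_ind _ _ (fun p => p = 0 \/ dot v p < dot h p)); first by left.
  move=> k w q k0' [Vw wv] _ IH.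
  have [k00|kn0] := eqVneq k 0; first by rewrite k00 scale0r add0r.
  right; rewrite !dotDr !dotZr hV // mulr1.
  have w1 : dot v w < 1.
    rewrite lt_neqAle S2_dot_le1 ?andbT //; last exact: VS.
    by apply/eqP => vw; apply: wv; apply/esym; apply: S2_dot_eq1; rewrite ?vw //; exact: VS.
  have : k * dot v w < k by rewrite gtr_pMr // lt_neqAle eq_sym kn0.
  by case: IH => [->|]; rewrite ?dot0r; lra.
case; first exact: (S2_neq0 v1).
by rewrite v1 hV // ltxx.
Qed.

Lemma cell_circumdisk X V h : X `<=` S2 -> supports X h -> V = facet X h -> spanning V ->
  let r := acos (Num.sqrt (dot h h))^-1 in
  [/\ 0 < r < pi / 2, circumdisk V (pole h) r,
    forall x, X x -> dot (pole h) x <= cos r &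
    forall x, X x -> sdist (pole h) x = r -> V x].
Proof.
move=> XS hX VE sp r.
have VX : V `<=` X by rewrite VE => x [].
have VS : V `<=` S2 by move=> x /VX/XS.
have hV v : V v -> dot h v = 1 by rewrite VE => -[].
have hh := spanning_normsq VS hV sp.
have kk := pole_radius hh; have [k0 k1] := andP kk.
have [r0 cr] := acos_itv kk; rewrite -/r in r0 cr.
have pi0 := pi_gt0 R.
have hr : 0 <= r <= pi by lra.
have c1 : S2 (pole h).
  by apply: S2_normalize => h0; rewrite h0 dot0l ltr10 in hh.
split=> //.
- split=> //.
    by move=> v Vv; rewrite /sdist /pole dotZl (hV v Vv) mulr1.
  move=> p [p1 cp]; apply/capE => //; split=> //.
  rewrite cr /pole dotZl ler_pMr //.
  rewrite -[leLHS]p1; apply: (@cone_dot_le X h p p hX _ V) => //.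
    by move=> x /XS x1; exact: S2_dot_le1.
  by rewrite VE.
- by move=> x Xx; rewrite cr /pole dotZl ger_pMr // hX.
- move=> x Xx; move/(sdist_eq c1 (XS x Xx) hr); rewrite cr /pole dotZl.
  rewrite -[X in _ = X]mulr1 => /(mulfI (lt0r_neq0 k0)) hx.
  by rewrite VE; split.
Qed.

(** The covering hypothesis puts the origin in the interior of the hull of [X], so the cones over
    the facets fill space. Two facets share at most two vertices, since three determine the plane;
    this leaves the options of [edge_to_edge]. *)
Lemma cells_delaunay X eta : finite_set X -> X `<=` S2 -> 0 < eta ->
  (forall d, S2 d -> exists2 x, X x & eta <= dot d x) ->
  sconv X = S2 /\ delaunay X (cells X).
Proof.
move=> finX XS eta0 cov.
have bigS : \bigcup_(V in cells X) sconv V = S2.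
  apply/seteqP; split=> p; first by move=> [V _ []].
  move=> p1; have [h [hX sp cp]] := facet_cover finX XS eta0 cov p1.
  by exists (facet X h); [exists h|split].
have XE : sconv X = S2.
  apply/seteqP; split=> p; first by case.
  rewrite -{1}bigS => -[V [h [hX VE sp]] [p1 cp]]; split=> //.
  by apply: cone_sub cp; rewrite VE => x [].
split=> //; rewrite /delaunay XE; split.
- move=> V DV; split; first exact: cell_polygon DV.
  by have [h [_ -> _]] := DV; move=> x [].
- split=> // V W [h [hX VE sp]] [h' [h'X WE sp']] [p [pV pW]].
  rewrite VE WE; congr facet.
  apply: (sinterior_inj _ pV pW) => q; rewrite VE WE => -[q1 cq] [_ c'q].
  apply/eqP; rewrite eq_le.
  rewrite (cone_dot_le h'X hX (@subset_refl _ _) c'q).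
  by rewrite (cone_dot_le hX h'X (@subset_refl _ _) cq).
- move=> V W [h [hX VE sp]] [h' [h'X WE sp']] VW.
  have hh : h <> h' by move=> hh; apply: VW; rewrite VE WE hh.
  rewrite VE WE cells_sconvI //.
  set I := facet X h `&` facet X h'.
  have [I0|/set0P[a Ia]] := eqVneq I set0.
    apply: Or31; rewrite I0; apply/seteqP; split=> // p [p1 cp]; apply: (S2_neq0 p1).
    by move: p cp {p1}; apply: cone_ind => // k v q _ [].
  have [Ia1|/existsNP[b /not_implyP[Ib ab]]] := pselect (forall b, I b -> b = a).
    apply: Or32; exists a; first by case: Ia.
    have IE : I = [set a] by apply/seteqP; split=> [b /Ia1//|b ->].
    have a1 : S2 a by case: Ia => -[/XS].
    rewrite IE; apply/seteqP; split=> p; last by move=> ->; split=> //; exact: cone_mem.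
    move=> [p1 cp].
    have [k k0 pE] : exists2 k, 0 <= k & p = k *: a.
      move: p cp {p1}; apply: (@cone_ind _ _ (fun p => exists2 k, 0 <= k & p = k *: a)).
        by exists 0 => //; rewrite scale0r.
      move=> k v q k0 -> _ [k' k'0 ->]; exists (k + k'); first exact: addr_ge0.
      by rewrite scalerDl.
    move: p1; rewrite pE /S2 /= dotZl dotZr a1 mulr1 => /eqP.
    by rewrite -expr2 sqrp_eq1 // => /eqP ->; rewrite scale1r.
  have IE : I = [set a; b].
    apply/seteqP; split=> [z Iz|z [->|->]//].
    have [->|za] := pselect (z = a); first by left.
    have [->|zb] := pselect (z = b); first by right.
    exfalso; apply: hh; case: Ia => a1 a2; case: Ib => b1 b2; case: Iz => z1 z2.
    by apply: (facet_inj3 XS a1 b1 z1 a2 b2 z2) => // e; [apply: ab|apply: zb].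
  have ab' : a <> b by move=> e; apply: ab.
  apply: Or33; exists a, b; split; last by rewrite IE.
    exact: (facet_polygon_edge XS hX h'X).
  apply: (facet_polygon_edge XS h'X hX) => //; first by move=> e; apply: hh.
  by rewrite setIC.
move=> V DV; have [h [hX VE sp]] := DV.
have [hr disk empty onV] := cell_circumdisk XS hX VE sp.
exists (pole h), (acos (Num.sqrt (dot h h))^-1); split=> //.
have [c1 _ _ _] := disk.
apply/seteqP; split=> // x [Xx]; move=> /sinterior_cap -[] //; first by lra.
by move=> _; rewrite ltNge empty.
Qed.

End Delaunay.

(** * Comparison of the cells with an isosceles triangle *)

Section Triangles.
Context {R : realType}.
Implicit Types (u v w x y z c h d p q : 'rV[R]_3) (k r eta : R).
Implicit Types (V W X : set 'rV[R]_3).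

Lemma polygon_spanning V : convex_polygon V -> spanning V.
Proof.
move=> [_ VS _ nl _] d dV; apply: contrapT => d0; apply: nl.
exists (pole d); first exact: S2_normalize.
by move=> v Vv; split; [exact: VS|rewrite /pole dotZl (dV v Vv) mulr0].
Qed.

Lemma spanning_triple V : spanning V ->
  exists u v w, [/\ V u, V v, V w, u <> v & v <> w] /\ w <> u.
Proof.
move=> sp.
have key a b : exists2 z, V z & z <> a /\ z <> b.
  have [d d0 [da db]] := perp_exists a b.
  apply: contrapT => H; apply: d0; apply: sp => z Vz.
  have [->//|za] := pselect (z = a); have [->//|zb] := pselect (z = b).
  by exfalso; apply: H; exists z.
have [u Vu _] := key 0 0; have [v Vv [vu _]] := key u u.
have [w Vw [wu wv]] := key u v.
by exists u, v, w; split=> //; split=> // e; [apply: vu|apply: wv].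
Qed.

Lemma triangle_nondeg u v w : convex_polygon [set u; v; w] ->
  [/\ u <> v, v <> w, w <> u & det3 u v w != 0].
Proof.
move=> pol; have sp := polygon_spanning pol.
have [_ VS [n n1 nV] _ _] := pol.
have nd a b : ~ (forall z, [set u; v; w] z -> z = a \/ z = b).
  move=> ab; have [d d0 [da db]] := perp_exists a b.
  by apply: d0; apply: sp => z /ab[] ->.
have [uv vw wu] : [/\ u <> v, v <> w & w <> u].
  split=> e.
  - by apply: (nd v w) => z [[]|] ->; rewrite ?e; [left|left|right].
  - by apply: (nd u w) => z [[]|] ->; rewrite ?e; [left|right|right].
  - by apply: (nd u v) => z [[]|] ->; rewrite ?e; [left|right|left].
split=> //; apply/eqP => D0.
have [d d0 [du dv]] := perp_exists u v.
have dw : dot d w != 0.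
  apply/eqP => dw; apply: d0; apply: sp => z.
  by move=> [[]|] ->.
have [u1 v1] : S2 u /\ S2 v by split; apply: VS; left; [left|right].
have [nu nv] : 0 < dot n u /\ 0 < dot n v by split; apply: nV; left; [left|right].
have := det3_decomp u v w d.
rewrite D0 du dv !scale0r !add0r => /esym/eqP; rewrite scaler_eq0 (negbTE dw) /=.
move=> /eqP c0; have := dot_cross_self u v; rewrite c0 dot0l u1 v1 mulr1.
move=> /esym/eqP; rewrite subr_eq0 eq_sym sqrf_eq1 => /orP[/eqP e|/eqP e].
  by apply: uv; apply: S2_dot_eq1; rewrite // e.
have : v = - u.
  by apply/esym/S2_dot_eq1 => //; [exact: S2N|rewrite dotNl e opprK].
by move=> vu; move: nv; rewrite vu dotNr; lra.
Qed.

Lemma triangle_plane u v w : det3 u v w != 0 ->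
  exists h, [/\ dot h u = 1, dot h v = 1 & dot h w = 1].
Proof.
move=> D0; exists ((det3 u v w)^-1 *: cross3 u v w).
have e : [/\ dot (cross3 u v w) u = det3 u v w, dot (cross3 u v w) v = det3 u v w &
   dot (cross3 u v w) w = det3 u v w].
  by split; rewrite /cross3 /det3 !dotE !mxE /=; ring.
by case: e => e1 e2 e3; rewrite !dotZl e1 e2 e3 mulVf.
Qed.

(** Of the two disks bounded by the circumcircle, the smaller contains the triangle: with
    [cos r = 0] the vertices would be collinear, and with [cos r < 0] the normalized midpoint of an
    edge would lie outside the disk. *)
Lemma circumdisk_pole u v w c r : convex_polygon [set u; v; w] ->
  circumdisk [set u; v; w] c r ->
  [/\ 0 < r < pi / 2, 0 < cos r < 1 &
    (1 - cos r ^+ 2) * heron3 u v w = 4 * hav v w * hav u w * hav u v].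
Proof.
move=> pol [c1 hr cV sub].
have [uv vw wu D0] := triangle_nondeg pol.
have [_ VS [n n1 nV] nl _] := pol.
have cE z : [set u; v; w] z -> dot c z = cos r.
  by move=> Vz; apply/sdist_eq => //; [exact: VS|exact: cV].
have [Vu Vv Vw] : [/\ [set u; v; w] u, [set u; v; w] v & [set u; v; w] w].
  by split; [left; left|left; right|right].
have [u1 v1 w1] : [/\ S2 u, S2 v & S2 w] by split; apply: VS.
have c0 : 0 < cos r.
  rewrite ltNge le_eqVlt; apply/negP => /orP[/eqP c0|c0].
    by apply: nl; exists c => // z Vz; split; [exact: VS|rewrite cE].
  have m0 : u + v <> 0.
    by move=> m0; have := nV u Vu; have := nV v Vv; have := dotDr u v n; rewrite m0 dot0r; lra.
  have [_] : cap c r (pole (u + v)).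
    apply: sub; split; first exact: S2_normalize.
    rewrite /pole scalerDr -[_ *: v]addr0.
    have k0 : 0 <= (Num.sqrt (dot (u + v) (u + v)))^-1 by rewrite invr_ge0 sqrtr_ge0.
    exact: (cone_cons k0 Vu (cone_cons k0 Vv (cone0 _))).
  rewrite sdist_le //; last exact: S2_normalize.
  have mm : dot (u + v) (u + v) = 2 + 2 * dot u v.
    by rewrite dotDl !dotDr u1 v1 (dotC v u); ring.
  have s0 : 0 < Num.sqrt (dot (u + v) (u + v)) by rewrite sqrtr_gt0 dot_gt0.
  rewrite /pole dotZr (dotDr u v c) !cE // mulrC ler_pdivlMr //.
  have -> : cos r + cos r = cos r * 2 by ring.
  rewrite ler_nM2l // => s2.
  have : 2 ^+ 2 <= dot (u + v) (u + v).
    by rewrite -(sqr_sqrtr (dot_ge0 (u + v))) ler_pXn2r ?nnegrE // ltW.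
  rewrite mm => h; apply: uv; apply: S2_dot_eq1 => //; lra.
have hE z : [set u; v; w] z -> dot ((cos r)^-1 *: c) z = 1.
  by move=> Vz; rewrite dotZl cE // mulVf // gt_eqF.
have [_ S0] := circumradius_heron u1 v1 w1 (hE u Vu) (hE v Vv) (hE w Vw) uv vw wu.
have -> : (dot ((cos r)^-1 *: c) ((cos r)^-1 *: c))^-1 = cos r ^+ 2.
  by rewrite dotZl dotZr c1 mulr1 -invfM invrK expr2.
move=> KS.
have abc : 0 < 4 * hav v w * hav u w * hav u v.
  apply: mulr_gt0 (hav_gt0 u1 v1 uv); apply: mulr_gt0.
    by apply: mulr_gt0 (hav_gt0 v1 w1 vw).
  by rewrite havC hav_gt0.
have K0 : 0 < 1 - cos r ^+ 2 by rewrite -(pmulr_lgt0 _ S0) KS.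
have cr1 : cos r < 1.
  by rewrite -(@ltr_pXn2r _ 2) ?nnegrE ?(ltW c0) // expr1n; lra.
have pi0 := pi_gt0 R.
split=> //; last by rewrite c0.
apply/andP; split.
  rewrite lt_neqAle; case/andP: hr => -> _; rewrite andbT; apply/eqP => r0.
  by rewrite -r0 cos0 ltxx in cr1.
rewrite -ltr_cos ?in_itv /= ?cos_pihalf //; lra.
Qed.

Definition isosceles (Y X : R) : set (set 'rV[R]_3) :=
  [set V | convex_polygon V /\ exists u v w,
    [/\ V = [set u; v; w], hav u v = Y, hav v w = X & hav w u = X]].

Lemma isosceles_disk (Y X : R) V c r : isosceles Y X V -> circumdisk V c r ->
  [/\ 0 < r < pi / 2, 0 < cos r & (1 - cos r ^+ 2) * (4 * X - Y) = 4 * X ^+ 2].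
Proof.
move=> [pol [u [v [w [VE uvY vwX wuX]]]]]; rewrite VE in pol * => disk.
have [r0 /andP[c0 _]] := circumdisk_pole pol disk.
have [uv _ _ _] := triangle_nondeg pol; have [_ VS _ _ _] := pol.
have Y0 : 0 < Y.
  by rewrite -uvY hav_gt0 //; apply: VS; left; [left|right].
rewrite /heron3 (havC u w) uvY vwX wuX => KS; split=> //.
apply: (mulIf (lt0r_neq0 Y0)).
have -> : 4 * X ^+ 2 * Y = 4 * X * X * Y by ring.
by rewrite -KS /heron; ring.
Qed.

Lemma isosceles_disk_exists (Y X : R) V : isosceles Y X V -> exists c r, circumdisk V c r.
Proof.
move=> [pol [u [v [w [VE _ _ _]]]]].
have sp := polygon_spanning pol.
have [_ VS _ _ _] := pol.
move: (pol); rewrite {1}VE => pol'.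
have [_ _ _ D0] := triangle_nondeg pol'.
have [h [hu hv hw]] := triangle_plane D0.
have hV z : V z -> dot h z = 1 by rewrite VE => -[[]|] ->.
have sup : supports V h by move=> z /hV ->.
have VF : V = facet V h by apply/seteqP; split=> [z Vz|z []//]; split=> //; exact: hV.
have [_ disk _ _] := cell_circumdisk VS sup VF sp.
by exists (pole h), (acos (Num.sqrt (dot h h))^-1).
Qed.

(** The formula determines [cos r ^+ 2] from [X] and [Y], so the radius picked by [xget] serves
    every member; the existence of a member excludes its default. *)
Lemma isosceles_circumradius (Y X : R) : isosceles Y X !=set0 ->
  let r := circumradius (isosceles Y X) in
  [/\ 0 < r < pi / 2, 0 < cos r,
     (1 - cos r ^+ 2) * (4 * X - Y) = 4 * X ^+ 2 &
     forall V, isosceles Y X V -> exists c, circumdisk V c r].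
Proof.
move=> [V0 TV0] r.
have [V [c [TV disk]]] : exists V c, isosceles Y X V /\ circumdisk V c r.
  apply: (@xgetPex _ 0 [set r | exists V c, isosceles Y X V /\ circumdisk V c r]).
  have [c [r' disk]] := isosceles_disk_exists TV0.
  by exists r', V0, c.
have [r0 c0 E] := isosceles_disk TV disk.
split=> // W TW; have [c' [r' disk']] := isosceles_disk_exists TW.
have [r'0 c'0 E'] := isosceles_disk TW disk'.
have XY : 4 * X - Y != 0.
  apply/eqP => XY; have [_ [u [v [w [VE uvY vwX wuX]]]]] := TV.
  have [pol _] := TV; rewrite VE in pol.
  have [uv vw _ _] := triangle_nondeg pol; have [_ VS _ _ _] := pol.
  have X0 : 0 < X by rewrite -vwX hav_gt0 //; apply: VS; [left; right|right].
  move: E; rewrite XY mulr0 => /eqP; rewrite eq_sym mulf_eq0 expf_eq0 (gt_eqF X0).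
  by rewrite pnatr_eq0.
suff -> : r = r' by exists c'.
have pi0 := pi_gt0 R.
apply: cos_inj; rewrite ?in_itv /=; try lra.
apply/eqP; rewrite -(@eqrXn2 _ 2) // ?(ltW c0) ?(ltW c'0) //.
have := mulIf XY (etrans E (esym E')); lra.
Qed.

(* [beta g(b) + delta g(d) = 0] for [g(x) = (x - a).(x - c)] whenever
   [beta b + delta d] is an affine combination of [a] and [c]: two opposite angles of
   a concyclic quadrilateral are not both acute. *)
Lemma four_concyclic a b c d h : S2 a -> S2 b -> S2 c -> S2 d ->
  dot h a = 1 -> dot h b = 1 -> dot h c = 1 -> dot h d = 1 -> det3 a b c != 0 ->
  d <> a -> d <> b -> d <> c ->
  0 < dot (b - a) (b - c) -> 0 < dot (d - a) (d - c) ->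
  0 < dot (a - b) (a - c) -> 0 < dot (d - b) (d - c) ->
  0 < dot (c - a) (c - b) -> 0 < dot (d - a) (d - b) -> False.
Proof.
move=> a1 b1 c1 d1 ha hb hc hd D0 da db dc b_ac d_ac a_bc d_bc c_ab d_ab.
pose t := (det3 a b c)^-1.
have dE : d = (t * det3 d b c) *: a + (t * det3 a d c) *: b + (t * det3 a b d) *: c.
  apply: (scalerI D0); rewrite !scalerDr !scalerA !mulrA divff // !mul1r.
  by apply: row3P; rewrite /det3 !dotE !mxE /=; ring.
move: dE; set x := t * _; set y := t * _; set z := t * _ => dE.
have xyz : x + y + z = 1.
  by rewrite -hd dE !dotDr !dotZr ha hb hc !mulr1.
have dd (e : 'rV[R]_3) : dot d e = x * dot a e + y * dot b e + z * dot c e.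
  by rewrite {1}dE !dotDl !dotZl.
have sgn k (A B : R) : 0 < A -> 0 < B -> A = k * B -> 0 < k.
  by move=> A0 B0 E; rewrite -(pmulr_lgt0 _ B0) -E.
have ea : dot d a = x + y * dot a b + z * dot a c.
  by rewrite dd a1 (dotC b a) (dotC c a); ring.
have eb : dot d b = x * dot a b + y + z * dot b c.
  by rewrite dd b1 (dotC c b); ring.
have ec : dot d c = x * dot a c + y * dot b c + z by rewrite dd c1; ring.
have xE : x = 1 - y - z by lra.
(* On the sphere [dot (p - a) (p - c)] is affine in [p] and vanishes at [a] and [c], so its value at
   [d] is [y] times its value at [b]; likewise for [x] and [z]. *)
have y0 : 0 < y.
  apply: (sgn _ _ _ d_ac b_ac).
  by rewrite !(dotBl, dotBr) d1 b1 (dotC a d) ea ec xE; ring.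
have x0 : 0 < x.
  apply: (sgn _ _ _ d_bc a_bc).
  by rewrite !(dotBl, dotBr) d1 a1 (dotC b d) (dotC b a) eb ec xE; ring.
have z0 : 0 < z.
  apply: (sgn _ _ _ d_ab c_ab).
  by rewrite !(dotBl, dotBr) d1 c1 (dotC a d) (dotC c b) ea eb xE; ring.
have lt1 (e : 'rV[R]_3) : S2 e -> d <> e -> dot e d < 1.
  move=> e1 de; rewrite lt_neqAle S2_dot_le1 // andbT; apply/eqP => h1; apply: de.
  by apply/esym/S2_dot_eq1; rewrite ?h1.
(* Positive affine coordinates make [d] a proper convex combination of points of the sphere, of norm
   below [1]. *)
have := dd d; rewrite d1.
have := lt1 a a1 da; have := lt1 b b1 db; have := lt1 c c1 dc.
move=> c2 b2 a2.
have : x * dot a d < x by rewrite gtr_pMr.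
have : y * dot b d < y by rewrite gtr_pMr.
have : z * dot c d < z by rewrite gtr_pMr.
lra.
Qed.

(** If [dot p w < cos r = dot c w] for all [w], then [p - c] is negative on the nonzero part of the
    cone, in particular at [p], and [1 < dot c p]. *)
Lemma disk_cover W c r p : W `<=` S2 -> S2 c -> 0 <= r <= pi ->
  (forall w, W w -> sdist c w = r) -> sconv W p -> exists2 w, W w & cos r <= dot w p.
Proof.
move=> WS c1 hr cW [p1 cp]; apply: contrapT => H.
have lt_ w : W w -> dot p w < dot c w.
  move=> Ww; rewrite (sdist_eq c1 (WS w Ww) hr).1 ?cW // ltNge dotC; apply/negP => h.
  by apply: H; exists w.
have : p = 0 \/ dot p p < dot c p.
  move: cp; apply: (@cone_ind _ _ (fun q => q = 0 \/ dot p q < dot c q)); first by left.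
  move=> k w q k0 Ww _ IH.
  have [k00|kn0] := eqVneq k 0; first by rewrite k00 scale0r add0r.
  right; rewrite !dotDr !dotZr.
  have : k * dot p w < k * dot c w by rewrite ltr_pM2l ?lt_ // lt_neqAle eq_sym kn0.
  by case: IH => [->|]; rewrite ?dot0r; lra.
case; first exact: S2_neq0.
by rewrite p1 ltNge S2_dot_le1.
Qed.

Lemma orth_dot (Q : 'M[R]_3) p q : Q *m Q^T = 1%:M -> dot (p *m Q) (q *m Q) = dot p q.
Proof.
have dm (a b : 'rV[R]_3) : dot a b = (a *m b^T) 0 0.
  by rewrite mxE /dot; apply: eq_bigr => i _; rewrite mxE.
by move=> QQ; rewrite !dm trmx_mul mulmxA -(mulmxA p) QQ mulmx1.
Qed.

Lemma cone_ray W h w p : W `<=` S2 -> (forall z, W z -> dot h z = 1) -> W w -> cone W p ->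
  dot w p <= dot h p /\ (dot h p <= dot w p -> exists2 t, 0 <= t & p = t *: w).
Proof.
move=> WS hW Ww.
apply: (@cone_ind _ _ (fun p => dot w p <= dot h p /\
  (dot h p <= dot w p -> exists2 t, 0 <= t & p = t *: w))).
  by rewrite !dot0r; split=> // _; exists 0; rewrite ?scale0r.
move=> k z q k0 Wz _ [wq IH]; rewrite !dotDr !dotZr (hW z Wz).
have := ler_wpM2l k0 (S2_dot_le1 (WS w Ww) (WS z Wz)) => kz.
split; first by lra.
move=> h2; have [|t t0 ->] := IH; first by lra.
have [k00|kn0] := eqVneq k 0; first by exists t; rewrite // k00 scale0r add0r.
have wz : w = z.
  apply: S2_dot_eq1; [exact: WS|exact: WS|].
  by rewrite -(@ler_pM2l _ k) ?lt_neqAle ?k0 1?eq_sym ?kn0 //; lra.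
by exists (k + t); [exact: addr_ge0|rewrite -wz scalerDl].
Qed.

(** [congruent] relates the solid polygons, so vertices have to be recovered: on the cone of [W],
    [dot w] reaches [dot h] only along the ray of [w] ([cone_ray]). *)
Lemma congruent_vertex V W (Q : 'M[R]_3) h w : Q *m Q^T = 1%:M -> V `<=` S2 -> W `<=` S2 ->
  (forall z, W z -> dot h z = 1) -> (fun p => p *m Q) @` sconv V = sconv W -> W w ->
  exists2 v, V v & v *m Q = w.
Proof.
move=> QQ VS WS hW QV Ww; have w1 := WS w Ww.
have [q [q1 cq] qw] : ((fun p => p *m Q) @` sconv V) w by rewrite QV; split=> //; exact: cone_mem.
have VQ v : V v -> sconv W (v *m Q).
  by move=> Vv; rewrite -QV; exists v => //; split; [exact: VS|exact: cone_mem].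
have : dot w (q *m Q) <= dot h (q *m Q) /\ (dot h (q *m Q) <= dot w (q *m Q) ->
    q = 0 \/ exists2 v, V v & v *m Q = w).
  move: q cq {q1 qw}; apply: (@cone_ind _ _ (fun q => dot w (q *m Q) <= dot h (q *m Q) /\
    (dot h (q *m Q) <= dot w (q *m Q) -> q = 0 \/ exists2 v, V v & v *m Q = w))).
    by rewrite mul0mx !dot0r; split=> // _; left.
  move=> k v q k0 Vv _ [wq IH]; rewrite mulmxDl -scalemxAl !dotDr !dotZr.
  have [vQ1 cvQ] := VQ v Vv; have [le1 eq1] := cone_ray WS hW Ww cvQ.
  have := ler_wpM2l k0 le1 => kz; split; first by lra.
  move=> h2; have [k00|kn0] := eqVneq k 0.
    by rewrite k00 scale0r add0r; apply: IH; rewrite k00 in h2; lra.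
  right; exists v => //; have [|t t0 tE] := eq1.
    by rewrite -(@ler_pM2l _ k) ?lt_neqAle ?k0 1?eq_sym ?kn0 //; lra.
  move: vQ1; rewrite tE /S2 /= dotZl dotZr w1 mulr1 => /eqP.
  by rewrite -expr2 sqrp_eq1 // => /eqP ->; rewrite scale1r.
move=> [_ H]; have [|q0|//] := H; first by rewrite qw w1 hW.
by move: (S2_neq0 q1); rewrite q0.
Qed.

End Triangles.

(** * From optimal triangles to the least covering radius *)

Section SharpBound.
Context {R : realType}.
Implicit Types (u v w x y z c h d p q : 'rV[R]_3) (k r eta lambda rho : R).
Implicit Types (V W X : set 'rV[R]_3).

Lemma sep_points_sub lambda rho X W : W `<=` X -> sep_points lambda rho X ->
  sep_points lambda rho W.
Proof.
move=> WX [XS pk ts]; split=> [x /WX/XS//|x y /WX Xx /WX Xy|x y /WX Xx /WX Xy xy].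
  exact: pk.
by have [n [n1 nx ny nz]] := ts x y Xx Xy xy; exists n; split=> // z /WX; exact: nz.
Qed.

Lemma covering_cells lambda rho r X : 0 < rho < pi / 2 -> 0 < r < pi / 2 ->
  sep_points lambda rho X -> S2 `<=` \bigcup_(x in X) cap x r ->
  [/\ finite_set X, X `<=` S2, sconv X = S2 /\ delaunay X (cells X) &
    forall h, supports X h -> spanning (facet X h) -> 1 - (dot h h)^-1 <= 1 - cos r ^+ 2].
Proof.
move=> hr r0 Xs cov; have finX := sep_points_finite hr Xs; have [XS _ _] := Xs.
have pi0 := pi_gt0 R.
have hr' : 0 <= r <= pi by lra.
have c0 : 0 < cos r by apply: cos_gt0_pihalf; lra.
have cov' d : S2 d -> exists2 x, X x & cos r <= dot d x.
  move=> d1; have [x Xx [_ xd]] := cov d d1; exists x => //.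
  by rewrite dotC -sdist_le //; exact: XS.
split=> //; first exact: (cells_delaunay finX XS c0 cov').
move=> h hX sp.
have hh : 1 < dot h h.
  apply: (@spanning_normsq _ (facet X h)) => // [x [/XS]//|x []//].
have c1 : S2 (pole h) by apply: S2_normalize => h0; rewrite h0 dot0l ltr10 in hh.
have [x Xx] := cov' _ c1.
have /andP[k0 k1] := pole_radius hh.
rewrite /pole dotZl => hx.
have : cos r <= (Num.sqrt (dot h h))^-1.
  by apply: le_trans hx _; rewrite ger_pMr // hX.
rewrite -(@ler_pXn2r _ 2) ?nnegrE ?(ltW c0) ?(ltW k0) // exprVn sqr_sqrtr ?dot_ge0 //.
lra.
Qed.

Lemma set3_rot u v w : [set u; v; w] = [set v; w; u].
Proof.
apply/seteqP; split=> z [[->|->]|->];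
  by [right|left; left|left; right|left; right|right|left; left].
Qed.

(** The interface between single triangles and packings: [1 - (dot h h)^-1] is the squared sine of
    the circumradius, and the alternatives tell which edge is the base. *)
Definition local_optimum lambda rho (Y X K0 : R) : Prop :=
  forall u v w h, u <> v -> v <> w -> w <> u ->
    dot h u = 1 -> dot h v = 1 -> dot h w = 1 -> sep_points lambda rho [set u; v; w] ->
    K0 <= 1 - (dot h h)^-1 /\ (1 - (dot h h)^-1 = K0 ->
      [\/ [/\ hav u v = Y, hav v w = X & hav w u = X],
          [/\ hav u v = X, hav v w = Y & hav w u = X] |
          [/\ hav u v = X, hav v w = X & hav w u = Y]]).

Lemma acute_of_hav (Y X : R) u v w : S2 u -> S2 v -> S2 w -> 0 < Y < 2 * X ->
  [\/ [/\ hav u v = Y, hav v w = X & hav w u = X],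
      [/\ hav u v = X, hav v w = Y & hav w u = X] |
      [/\ hav u v = X, hav v w = X & hav w u = Y]] ->
  [/\ 0 < dot (u - v) (u - w), 0 < dot (v - u) (v - w) & 0 < dot (w - u) (w - v)].
Proof.
move=> u1 v1 w1 hY H.
have E (a b c : 'rV[R]_3) : S2 a -> dot (a - b) (a - c) = 2 * (hav a b + hav a c - hav b c).
  by move=> a1; rewrite !(dotBl, dotBr) a1 /hav (dotC b a); field.
rewrite !E // (havC v u) (havC w v) (havC u w) ?(havC w u).
by rewrite (havC w u) in H; case: H => -[-> -> ->]; split; lra.
Qed.

Lemma sharp_bound_of_local lambda rho (Y X K0 : R) :
  0 < rho < pi / 2 -> 0 <= lambda < pi / 2 -> isosceles Y X !=set0 -> 0 < Y < 2 * X ->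
  K0 * (4 * X - Y) = 4 * X ^+ 2 -> local_optimum lambda rho Y X K0 ->
  sharp_bound lambda rho (isosceles Y X).
Proof.
move=> hr hl T0 hY HK0 loc.
have [r0 c0 HKr disk] := isosceles_circumradius T0.
set r := circumradius _ in r0 c0 HKr disk.
have pi0 := pi_gt0 R.
have d0 : 4 * X - Y != 0 by rewrite gt_eqF //; lra.
have K0E : K0 = 1 - cos r ^+ 2 by apply: (mulIf d0); rewrite HK0 HKr.
have [[g0 [F /(separable_packingP _ hr hl) Fs Fcov]] lb] := gamma_min hr hl.
set g := gamma lambda rho in g0 Fcov lb.
have FT : (exists2 F, separable_packing lambda rho F &
    Delaunay_tiles_congruent_to (isosceles Y X) F) -> g <= r.
  move=> [G Gs [D [DP _ _ _] [[Dc _] Dcong]]]; apply: lb; split; first by case/andP: r0.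
  exists G => // p p1; move: (p1); rewrite -{1}Dc => -[V [DV tV] Vp].
  have [W TW [Q QQ QV]] := Dcong V DV tV.
  have [c [c1 hr' cW sub]] := disk W TW.
  have [[_ VS _ _ _] VG] := DP V DV; have [[_ WS _ _ _] _] := TW.
  have Wp : sconv W (p *m Q) by rewrite -QV; exists p.
  have [w Ww wp] := disk_cover WS c1 hr' cW Wp.
  have cw z : W z -> dot ((cos r)^-1 *: c) z = 1.
    by move=> Wz; rewrite dotZl (sdist_eq c1 (WS z Wz) hr').1 ?cW // mulVf // gt_eqF.
  have [v Vv vw] := congruent_vertex QQ VS WS cw QV Ww.
  exists v; first exact: VG.
  by apply/capE => //; [exact: VS|rewrite -vw orth_dot in wp].
(* [covering_cells] requires a radius below [pi / 2], which is available for [g = r] and for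
   [g < r], the two situations in which it is applied. *)
have [gr|gr] := ltrP g r; last first.
  split=> //; split; last by move=> /FT rg; apply/eqP; rewrite eq_le rg.
  rewrite -/g -/r => gE; rewrite gE in Fcov.
  have [finF FS [FE FD] FK] := covering_cells hr r0 Fs Fcov.
  exists F; first exact/separable_packingP.
  have cellT V : cells F V -> triangular V /\ isosceles Y X V.
    move=> DV; have [h [hF VE sp]] := DV.
    have pol := cell_polygon finF FS DV.
    have VF z : V z -> F z /\ dot h z = 1 by rewrite VE => -[].
    have opt u v w : V u -> V v -> V w -> u <> v -> v <> w -> w <> u ->
      [\/ [/\ hav u v = Y, hav v w = X & hav w u = X],
          [/\ hav u v = X, hav v w = Y & hav w u = X] |
          [/\ hav u v = X, hav v w = X & hav w u = Y]].
      move=> Vu Vv Vw uv vw wu.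
      have [[Fu hu] [Fv hv] [Fw hw]] := And3 (VF u Vu) (VF v Vv) (VF w Vw).
      have [|K0K] := loc u v w h uv vw wu hu hv hw.
        by apply: sep_points_sub Fs => z [[]|] ->.
      apply; apply/eqP; rewrite eq_le K0K andbT K0E.
      by apply: FK; rewrite // -VE.
    have [u [v [w [[Vu Vv Vw uv vw] wu]]]] := spanning_triple sp.
    have V3 : V = [set u; v; w].
      apply/seteqP; split=> [z Vz|z [[->|->]|->]//].
      apply: contrapT => nz.
      have zu : z <> u by move=> e; apply: nz; left; left.
      have zv : z <> v by move=> e; apply: nz; left; right.
      have zw : z <> w by move=> e; apply: nz; right.
      have S z' : V z' -> S2 z' by move=> /VF[/FS].
      have [[Fu hu] [Fv hv] [Fw hw]] := And3 (VF u Vu) (VF v Vv) (VF w Vw).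
      have [Fz hz] := VF z Vz.
      have [D0 _ _] := circumradius_heron (S u Vu) (S v Vv) (S w Vw) hu hv hw uv vw wu.
      have [a1 a2 a3] := acute_of_hav (S u Vu) (S v Vv) (S w Vw) hY (opt u v w Vu Vv Vw uv vw wu).
      have uz : u <> z by move=> e; apply: zu.
      have wz : w <> z by move=> e; apply: zw.
      have vz : v <> z by move=> e; apply: zv.
      have uw : u <> w by move=> e; apply: wu.
      have [_ _ b1] := acute_of_hav (S u Vu) (S w Vw) (S z Vz) hY (opt u w z Vu Vw Vz uw wz zu).
      have [_ _ b2] := acute_of_hav (S v Vv) (S w Vw) (S z Vz) hY (opt v w z Vv Vw Vz vw wz zv).
      have [_ _ b3] := acute_of_hav (S u Vu) (S v Vv) (S z Vz) hY (opt u v z Vu Vv Vz uv vz zu).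
      exact: (four_concyclic (S u Vu) (S v Vv) (S w Vw) (S z Vz) hu hv hw hz D0 zu zv zw
        a2 b1 a1 b2 a3 b3).
    split; first by exists u, v, w.
    split=> //; case: (opt u v w Vu Vv Vw uv vw wu) => -[e1 e2 e3].
    - by exists u, v, w.
    - by exists v, w, u; split; rewrite // V3 set3_rot.
    - by exists w, u, v; split; rewrite // V3 -set3_rot.
  have DI : cells F `&` @triangular R = cells F.
    by apply/seteqP; split=> [V []//|V DV]; split=> //; case: (cellT V DV).
  exists (cells F); first exact: FD.
  have [_ tl _ _] := FD.
  split; first by rewrite DI -FE.
  move=> V DV _; exists V; first by case: (cellT V DV).
  exists 1%:M; first by rewrite trmx1 mulmx1.
  by apply/seteqP; split=> [_ [p Vp <-]|p Vp]; [rewrite mulmx1|exists p; rewrite ?mulmx1].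
exfalso; have g2 : 0 < g < pi / 2 by rewrite g0; lra.
have [finF FS [FE FD] FK] := covering_cells hr g2 Fs Fcov.
have [u u1 _] := S2_perp_exists (0 : 'rV[R]_3) 0.
have [bigF _] : tiling (cells F) (sconv F) by case: FD.
have [V DV _] : (\bigcup_(V in cells F) sconv V) u by rewrite bigF FE.
have [h [hF VE sp]] := DV.
have [a [b [c [[Va Vb Vc ab bc] ca]]]] := spanning_triple sp.
rewrite VE in Va Vb Vc.
have [[Fa ha] [Fb hb] [Fc hc]] := And3 Va Vb Vc.
have [|K0K _] := loc a b c h ab bc ca ha hb hc.
  by apply: sep_points_sub Fs => z [[]|] ->.
rewrite VE in sp; have := FK h hF sp.
have cg : cos r < cos g by rewrite ltr_cos ?in_itv /=; lra.
have : cos r ^+ 2 < cos g ^+ 2 by rewrite ltr_pXn2r ?nnegrE // ltW // (lt_trans c0).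
by rewrite K0E in K0K; lra.
Qed.

End SharpBound.

Lemma pinv_spec (T : choiceType) (U : Type) (dflt : U -> T) (A : set T) (f : T -> U) (y : U) :
  (A ('pinv_dflt A f y) /\ f ('pinv_dflt A f y) = y) \/ 'pinv_dflt A f y = dflt y.
Proof.
rewrite /pinv_ splitV /=.
have [fAy|fAy] := pselect ((f @` A) y).
  by left; have /= := 'oinvP_([fun f in A]) fAy; case.
right.
rewrite (_ : 'oinv_[fun f in A] y =
  if pselect ((f @` A) y) is left By then some (projT1 (cid2 By)) else None) //.
by case: pselect.
Qed.

(** * Optimality of single triangles with separable vertices *)

Section Local.
Context {R : realType}.
Implicit Types (u v w x y z c h d p q : 'rV[R]_3) (k r eta lambda rho l X Y K : R).

Lemma sep_points_hav lambda rho (X : set 'rV[R]_3) x y : sep_points lambda rho X -> X x -> X y ->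
  x <> y -> sin rho ^+ 2 <= hav x y.
Proof.
move=> [_ pk _] Xx Xy xy; have := pk x y Xx Xy xy.
by rewrite cos2E cos2sin2 /hav; lra.
Qed.

Lemma local_regular lambda rho u v w h : 0 < rho < pi / 2 ->
  u <> v -> v <> w -> w <> u -> dot h u = 1 -> dot h v = 1 -> dot h w = 1 ->
  sep_points lambda rho [set u; v; w] ->
  4 / 3 * sin rho ^+ 2 <= 1 - (dot h h)^-1 /\ (1 - (dot h h)^-1 = 4 / 3 * sin rho ^+ 2 ->
    [/\ hav u v = sin rho ^+ 2, hav v w = sin rho ^+ 2 & hav w u = sin rho ^+ 2]).
Proof.
move=> hr uv vw wu hu hv hw sep; have [VS _ _] := sep; have pi0 := pi_gt0 R.
have [Vu Vv Vw] : [/\ [set u; v; w] u, [set u; v; w] v & [set u; v; w] w].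
  by split; [left; left|left; right|right].
have [_ S0 KS] := circumradius_heron (VS _ Vu) (VS _ Vv) (VS _ Vw) hu hv hw uv vw wu.
have p0 : 0 < sin rho ^+ 2 by rewrite exprn_gt0 // sin_gt0_pi //; lra.
have uw : u <> w by move=> e; apply: wu.
have [|||H1 H2] := regular_circumradius_le p0 _ _ _ S0 KS; try exact: sep_points_hav sep _ _ _.
by split=> // /H2[e1 e2 e3]; rewrite (havC w u).
Qed.

Definition vertex_line lambda (u v w : 'rV[R]_3) : Prop := exists n,
  [/\ S2 n, sin lambda <= dot n u, dot n v <= - sin lambda & dot n w <= - sin lambda].

(** The base joins the two vertices that are cut off, as it is the edge common to the conditions at
    [u] and at [v]. *)
Lemma local_pair lambda rho u v w h X Y K :
  0 < rho < pi / 2 -> 0 <= lambda <= rho ->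
  optimal (sin lambda ^+ 2) X Y K ->
  slack_quot (sin lambda ^+ 2) K (Y / (4 * X)) (Y / (4 * X)) = 0 \/ X <= sin rho ^+ 2 ->
  u <> v -> v <> w -> w <> u -> dot h u = 1 -> dot h v = 1 -> dot h w = 1 ->
  sep_points lambda rho [set u; v; w] ->
  vertex_line lambda u v w -> vertex_line lambda v w u -> 1 - (dot h h)^-1 <= K ->
  [/\ 1 - (dot h h)^-1 = K, hav u v = Y, hav v w = X & hav w u = X].
Proof.
move=> hr hl opt hc uv vw wu hu hv hw sep [n [n1 nu nv nw]] [m [m1 mv mw mu]] KK.
have [VS _ _] := sep; have pi0 := pi_gt0 R.
have [Vu Vv Vw] : [/\ [set u; v; w] u, [set u; v; w] v & [set u; v; w] w].
  by split; [left; left|left; right|right].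
have [u1 v1 w1] := And3 (VS _ Vu) (VS _ Vv) (VS _ Vw).
have [_ S0 KS] := circumradius_heron u1 v1 w1 hu hv hw uv vw wu.
have uw : u <> w by move=> e; apply: wu.
have vu : v <> u by move=> e; apply: uv.
have wv : w <> v by move=> e; apply: vw.
have s0 : 0 <= sin lambda by apply: sin_ge0_pi; lra.
have lp : sin lambda ^+ 2 <= sin rho ^+ 2.
  have sr : 0 <= sin rho by apply: sin_ge0_pi; lra.
  rewrite ler_pXn2r ?nnegrE // !leNgt ltr_sin ?in_itv /= -?leNgt; lra.
have Gu := vertex_separatedP u1 v1 w1 hu hv hw uv vw wu n1 s0 nu nv nw.
have Gv := vertex_separatedP v1 u1 w1 hv hu hw vu uw wv m1 s0 mv mu mw.
rewrite (havC v u) in Gv.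
have [e1 e2 e3 e4] := sep_circumradius opt hc lp (sep_points_hav sep Vv Vw vw)
  (sep_points_hav sep Vu Vw uw) (sep_points_hav sep Vu Vv uv) S0 KS Gu Gv KK.
by rewrite (havC w u).
Qed.

Lemma sep_points_vertex_line lambda rho u v w : u <> v -> sep_points lambda rho [set u; v; w] ->
  vertex_line lambda u v w \/ vertex_line lambda v w u.
Proof.
move=> uv [_ _ /(_ u v)]; case=> //; [by left; left|by left; right|].
move=> n [n1 nu nv nz].
have := nz w (or_intror erefl); rewrite ler_normr => /orP[nw|nw].
  by right; exists (- n); split; [exact: S2N| | |]; rewrite dotNl; lra.
by left; exists n; split=> //; lra.
Qed.

Lemma local_separable lambda rho X Y K :
  0 < rho < pi / 2 -> 0 <= lambda <= rho ->
  optimal (sin lambda ^+ 2) X Y K ->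
  slack_quot (sin lambda ^+ 2) K (Y / (4 * X)) (Y / (4 * X)) = 0 \/ X <= sin rho ^+ 2 ->
  local_optimum lambda rho Y X K.
Proof.
move=> hr hl opt hc u v w h uv vw wu hu hv hw sep.
have sep2 : sep_points lambda rho [set v; w; u] by rewrite -set3_rot.
have sep3 : sep_points lambda rho [set w; u; v] by rewrite set3_rot.
suff H : 1 - (dot h h)^-1 <= K -> 1 - (dot h h)^-1 = K /\
      [\/ [/\ hav u v = Y, hav v w = X & hav w u = X],
          [/\ hav u v = X, hav v w = Y & hav w u = X] |
          [/\ hav u v = X, hav v w = X & hav w u = Y]].
  split; last by move=> e; have [|] := H; rewrite ?e.
  by have [/H[<-//]|/ltW] := lerP (1 - (dot h h)^-1) K.
move=> KK.
have puv := local_pair hr hl opt hc uv vw wu hu hv hw sep.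
have pvw := local_pair hr hl opt hc vw wu uv hv hw hu sep2.
have pwu := local_pair hr hl opt hc wu uv vw hw hu hv sep3.
have [Au|Av] := sep_points_vertex_line uv sep.
- have [Av|Aw] := sep_points_vertex_line vw sep2.
    have [|e1 e2 e3 e4] := puv Au _ KK; first exact: Av.
    by split=> //; apply: Or31.
  have [e1 e2 e3 e4] := pwu Aw Au KK.
  by split=> //; apply: Or33.
- have [Aw|Au] := sep_points_vertex_line wu sep3.
    have [e1 e2 e3 e4] := pvw Av Aw KK.
    by split=> //; apply: Or32.
  have [e1 e2 e3 e4] := puv Au Av KK.
  by split=> //; apply: Or31.
Qed.

End Local.

(** * The four cases *)

Section Trig.
Context {R : realType}.
Implicit Types (lambda rho x y : R).

Lemma trianglesE x y : 0 <= x <= pi / 2 -> 0 <= y <= pi / 2 ->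
  triangles (2 * y) (2 * x) (2 * x) = isosceles (sin y ^+ 2) (sin x ^+ 2).
Proof.
move=> hx hy.
have E (u v : 'rV[R]_3) t : S2 u -> S2 v -> 0 <= t <= pi / 2 ->
    sdist u v = 2 * t <-> hav u v = sin t ^+ 2.
  move=> u1 v1 ht; have ht' : 0 <= 2 * t <= pi by lra.
  rewrite (sdist_eq u1 v1 ht') cos2E cos2sin2 /hav.
  by split=> e; lra.
apply/seteqP; split=> V [pol [u [v [w [VE e1 e2 e3]]]]]; split=> //; exists u, v, w;
  have [_ VS _ _ _] := pol; rewrite VE in VS;
  have [u1 v1 w1] : [/\ S2 u, S2 v & S2 w] by split; apply: VS; [left; left|left; right|right].
- by split=> //; apply/E.
- by split=> //; apply/E.
Qed.

Lemma sin2E x : sin (2 * x) = 2 * sin x * cos x.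
Proof. by rewrite mulrC mulr_natr sin_mulr2n -mulr_natr; ring. Qed.

Lemma sin_sqr_lt x y : 0 <= x <= pi / 2 -> 0 <= y <= pi / 2 ->
  (sin x ^+ 2 < sin y ^+ 2) = (x < y).
Proof.
move=> hx hy; have pi0 := pi_gt0 R.
rewrite ltr_pXn2r ?nnegrE ?sin_ge0_pi //; try lra.
by rewrite ltr_sin // in_itv /=; lra.
Qed.

Lemma sin_piquarter_sqr : sin (pi / 4 : R) ^+ 2 = 2^-1.
Proof.
have := cos2E (pi / 4 : R); have -> : 2 * (pi / 4) = pi / 2 :> R by field.
by rewrite cos_pihalf cos2sin2; lra.
Qed.

Lemma asin_ge0_pihalf (k : R) : 0 <= k <= 1 -> 0 <= asin k <= pi / 2.
Proof.
move=> hk; have pi0 := pi_gt0 R.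
rewrite asin_lepi2 ?andbT; last by lra.
rewrite leNgt; apply/negP => a0.
have : sin (asin k) < sin 0.
  by rewrite ltr_sin ?in_itv /= ?asin_geNpi2 ?asin_lepi2 //; lra.
by rewrite asinK ?in_itv /= ?sin0; lra.
Qed.

Lemma asin_lt (k y : R) : 0 <= k <= 1 -> 0 <= y <= pi / 2 ->
  (asin k < y) = (k ^+ 2 < sin y ^+ 2).
Proof.
move=> hk hy; rewrite -(sin_sqr_lt (asin_ge0_pihalf hk) hy) asinK // in_itv /=.
by lra.
Qed.

Lemma lt_asin (k y : R) : 0 <= k <= 1 -> 0 <= y <= pi / 2 ->
  (y < asin k) = (sin y ^+ 2 < k ^+ 2).
Proof.
move=> hk hy; rewrite -(sin_sqr_lt hy (asin_ge0_pihalf hk)) asinK // in_itv /=.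
by lra.
Qed.

Lemma Ts_domain_spec lambda y : Ts_domain lambda y ->
  [/\ 0 < lambda < pi / 4, 0 < sin lambda ^+ 2 < 2^-1, 0 <= y < pi / 2,
   sin lambda ^+ 2 <= (1 - sin lambda ^+ 2) * sin y ^+ 2 & 0 < asin (tan lambda)].
Proof.
move=> [hl hy]; have pi0 := pi_gt0 R.
have hl2 : 0 <= lambda <= pi / 2 by lra.
have h4 : 0 <= (pi : R) / 4 <= pi / 2 by lra.
have l0 : 0 < sin lambda ^+ 2 by rewrite exprn_gt0 // sin_gt0_pi //; lra.
have l2 : sin lambda ^+ 2 < 2^-1 by rewrite -sin_piquarter_sqr sin_sqr_lt //; lra.
have c2 := cos2sin2 lambda.
have c0 : 0 < cos lambda by apply: cos_gt0_pihalf; lra.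
have s0 : 0 < sin lambda by apply: sin_gt0_pi; lra.
have t0 : 0 < tan lambda by rewrite divr_gt0.
have t1 : tan lambda <= 1.
  by rewrite /tan ler_pdivrMr // mul1r -(@ler_pXn2r _ 2) ?nnegrE ?ltW //; lra.
have ht : 0 <= tan lambda <= 1 by rewrite ltW.
have at0 := asin_ge0_pihalf ht.
have hy2 : 0 <= y <= pi / 2 by lra.
have at1 : 0 < asin (tan lambda).
  rewrite lt_neqAle; case/andP: at0 => -> _; rewrite andbT; apply/eqP => a0.
  have : sin (asin (tan lambda)) = tan lambda by rewrite asinK // in_itv /=; lra.
  by rewrite -a0 sin0; lra.
split=> //; [by rewrite l0 l2|by lra|].
have : tan lambda ^+ 2 <= sin y ^+ 2.
  by rewrite leNgt -(lt_asin ht hy2) -leNgt; case/andP: hy.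
rewrite /tan exprMn exprVn ler_pdivrMr ?exprn_gt0 //.
by rewrite c2 mulrC.
Qed.

(** Squaring [sin (2 * x1s lambda y)] turns the definition into the equality case of [feasible]:
    this leg is tight for the base [y]. The last hypothesis is [tan lambda ^+ 2 <= sin y ^+ 2]
    without denominators; it keeps the argument of [asin] at most [1], by the factorization in
    [a1]. *)
Lemma x1s_spec lambda y : 0 < sin lambda ^+ 2 < 2^-1 -> 0 < cos lambda -> 0 <= y < pi / 2 ->
  sin lambda ^+ 2 <= (1 - sin lambda ^+ 2) * sin y ^+ 2 ->
  let X := sin (x1s lambda y) ^+ 2 in
  [/\ 0 <= x1s lambda y <= pi / 4, 0 < X <= 2^-1 &
    (1 - sin lambda ^+ 2) * (sin y ^+ 2) ^+ 2 = 4 * X * (1 - X) * (sin y ^+ 2 - sin lambda ^+ 2)].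
Proof.
move=> hl c0 hy ly X; have pi0 := pi_gt0 R.
set l := sin lambda ^+ 2 in hl ly *; set Y := sin y ^+ 2 in ly *.
have Y1 : Y < 1.
  have <- : sin (pi / 2 : R) ^+ 2 = 1 by rewrite sin_pihalf expr1n.
  by rewrite /Y sin_sqr_lt //; lra.
have Y0 : 0 < Y by rewrite -(@pmulr_rgt0 _ (1 - l)); lra.
have lY : l < Y.
  have : 0 < l * Y by rewrite mulr_gt0; lra.
  by move: ly; lra.
have D0 : 0 < Y - l by lra.
pose a := cos lambda * Y / Num.sqrt (Y - l).
have sD : 0 < Num.sqrt (Y - l) by rewrite sqrtr_gt0.
have a0 : 0 < a by rewrite divr_gt0 // mulr_gt0.
have a2 : a ^+ 2 * (Y - l) = (1 - l) * Y ^+ 2.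
  rewrite /a expr_div_n sqr_sqrtr ?(ltW D0) // divfK ?gt_eqF //.
  by rewrite exprMn cos2sin2.
have a1 : a <= 1.
  rewrite -(@ler_pXn2r _ 2) ?nnegrE ?(ltW a0) // expr1n -(ler_pM2r D0) a2 mul1r.
  rewrite -subr_ge0; have -> : Y - l - (1 - l) * Y ^+ 2 = (1 - Y) * ((1 - l) * Y - l) by ring.
  by rewrite mulr_ge0; lra.
have ha : 0 <= a <= 1 by rewrite ltW.
have asa := asin_ge0_pihalf ha.
have xE : 2 * x1s lambda y = asin a by rewrite /x1s mulrA divff ?mul1r // pnatr_eq0.
have hx : 0 <= x1s lambda y <= pi / 4 by lra.
have sx : 4 * X * (1 - X) = a ^+ 2.
  have -> : a = sin (2 * x1s lambda y) by rewrite xE asinK // in_itv /=; lra.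
  by rewrite sin2E !exprMn cos2sin2 /X; ring.
split=> //; last by rewrite sx a2.
have X2 : X <= 2^-1.
  rewrite -sin_piquarter_sqr leNgt /X sin_sqr_lt -?leNgt; lra.
rewrite X2 andbT lt_neqAle sqr_ge0 andbT; apply/eqP => X0.
have : 0 < a ^+ 2 by rewrite exprn_gt0.
by rewrite -sx -X0 mulr0 mul0r ltxx.
Qed.

(** The second inequality holds because [144 * D] exceeds the square of the polynomial part by
    [(8 * l * (3 - 5 * l)) ^+ 3], the negated cube of the coefficient [40 * l ^+ 2 - 24 * l] in
    Cardano's formula. *)
Lemma cardano_gt0 (l : R) : 0 < l < 2^-1 ->
  let D := l ^+ 3 * ((1 - l) * (375 * (l - 2^-1) ^+ 2 + 9 / 4)) in
  0 < D /\ 0 < 100 * l ^+ 3 - 36 * l ^+ 2 + 12 * Num.sqrt D.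
Proof.
move=> /andP[l0 l2] D.
have e1 : 0 < 1 - l by lra.
have e2 : 0 < 375 * (l - 2^-1) ^+ 2 + 9 / 4 by have := sqr_ge0 (l - 2^-1); lra.
have D0 : 0 < D by apply: mulr_gt0 (exprn_gt0 3 l0) (mulr_gt0 e1 e2).
split=> //.
have e3 : 0 < 3 - 5 * l by lra.
have e4 : 0 < 8 * l by lra.
have h : (36 * l ^+ 2 - 100 * l ^+ 3) ^+ 2 < (12 * Num.sqrt D) ^+ 2.
  rewrite exprMn sqr_sqrtr ?(ltW D0) // -subr_gt0 /D.
  have -> : 12 ^+ 2 * (l ^+ 3 * ((1 - l) * (375 * (l - 2^-1) ^+ 2 + 9 / 4))) -
    (36 * l ^+ 2 - 100 * l ^+ 3) ^+ 2 = (8 * l * (3 - 5 * l)) ^+ 3 by field.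
  by rewrite exprn_gt0 // mulr_gt0.
have s0 : 0 < 12 * Num.sqrt D by rewrite mulr_gt0 // sqrtr_gt0.
suff : 36 * l ^+ 2 - 100 * l ^+ 3 < 12 * Num.sqrt D by lra.
apply: le_lt_trans (ler_norm _) _.
by rewrite -(@ltr_pXn2r _ 2) ?nnegrE ?normr_ge0 ?(ltW s0) // real_normK ?num_real.
Qed.

Lemma ymins_spec lambda : 0 < sin lambda ^+ 2 < 2^-1 ->
  ycubic (sin lambda ^+ 2) (sin (ymins lambda) ^+ 2) = 0 /\ 0 <= ymins lambda < pi / 2.
Proof.
rewrite /ymins; move: (sin lambda) => L.
set A := (X in X `^ _); set A3 := A `^ _ => hl.
have [l lE] : exists l, l = L ^+ 2 by eexists.
rewrite -lE in hl *.
have [D0 A0'] := cardano_gt0 hl; set D := _ * _ in D0 A0'.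
have sD : Num.sqrt D ^+ 2 = D by rewrite sqr_sqrtr // ltW.
have AE : A = 100 * l ^+ 3 - 36 * l ^+ 2 + 12 * Num.sqrt D.
  rewrite /A lE -!exprM; congr (_ + _ * Num.sqrt _).
  by rewrite /D lE; field.
have A0 : 0 < A by rewrite AE.
have A30 : A3 != 0 by rewrite gt_eqF // powR_gt0.
have A3E : A3 ^+ 3 = A.
  by rewrite -powR_mulrn ?powR_ge0 // -powRrM mulVf ?pnatr_eq0 // powRr1 // ltW.
pose Y := (A3 + (40 * l ^+ 2 - 24 * l) / A3 + 10 * l) / 6.
have CY : ycubic l Y = 0.
  apply: ycubic_cardano => //; rewrite A3E.
  transitivity ((A - (100 * l ^+ 3 - 36 * l ^+ 2)) ^+ 2 - 144 * D); last first.
    rewrite (_ : A - _ = 12 * Num.sqrt D); last by rewrite AE; ring.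
    by rewrite exprMn sD; ring.
  by rewrite /D; field.
have Y2 : Y < 2 * l by case: (ycubic_bounds Y hl) => + _; apply; rewrite CY.
have Y1 : 3 / 2 * l < Y by case: (ycubic_bounds Y hl) => _; apply.
(* The radicand in [ymins] is [36 * Y] for Cardano's root [Y]. *)
set S := (X in Num.sqrt X).
have SE : S = 36 * Y by rewrite /S /Y lE; field.
have S0 : 0 <= S by rewrite SE; lra.
pose k := 6^-1 * Num.sqrt S.
have kE : k ^+ 2 = Y by rewrite /k exprMn sqr_sqrtr // SE; field.
have k0 : 0 <= k by rewrite mulr_ge0 ?sqrtr_ge0 // invr_ge0.
have k1 : k < 1 by rewrite -(@ltr_pXn2r _ 2) ?nnegrE // kE expr1n; lra.
have hk : 0 <= k <= 1 by lra.
rewrite -/k; split; first by rewrite asinK ?kE // in_itv /=; lra.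
by rewrite asin_ltpi2 ?andbT; [case/andP: (asin_ge0_pihalf hk)|lra].
Qed.

(** [l / (1 - l)] is [tan lambda ^+ 2], the left end of the domain of [x1s]; the cubic is negative
    there. *)
Lemma ycubic_root_gt l (Y : R) : 0 < l < 2^-1 -> ycubic l Y = 0 -> l < (1 - l) * Y.
Proof.
move=> hl CY; rewrite mulrC -ltr_pdivrMr; last by lra.
rewrite -(ycubic_lt _ _ hl) CY.
have -> : ycubic l (l / (1 - l)) = - (l ^+ 2 * (1 - 2 * l) ^+ 3 / (1 - l) ^+ 3).
  by rewrite /ycubic; field; lra.
by rewrite oppr_lt0 !mulr_gt0 ?invr_gt0 ?exprn_gt0 //; lra.
Qed.

End Trig.

(** * The bound in each case *)

Section Cases.
Context {R : realType}.
Implicit Types (lambda rho x y : R).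

Lemma cos_gt0_piquarter lambda : 0 < lambda < pi / 4 -> 0 < cos lambda.
Proof. by move=> hl; have := pi_gt0 R; move=> pi0; apply: cos_gt0_pihalf; lra. Qed.

Lemma T1sE lambda y : Ts_domain lambda y ->
  T1s lambda y = isosceles (sin y ^+ 2) (sin (x1s lambda y) ^+ 2).
Proof.
move=> dom; have [hl l2 hy ly _] := Ts_domain_spec dom; have pi0 := pi_gt0 R.
have [hx _ _] := x1s_spec l2 (cos_gt0_piquarter hl) hy ly.
rewrite -trianglesE; [|lra|lra].
by apply/seteqP; split=> V; [case|split].
Qed.

Lemma sharp_bound_T1s lambda rho : 0 <= lambda <= rho -> 0 < rho < pi / 2 ->
  T1s lambda (ymins lambda) !=set0 -> sharp_bound lambda rho (T1s lambda (ymins lambda)).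
Proof.
move=> hlr hr T0; have pi0 := pi_gt0 R.
have dom : Ts_domain lambda (ymins lambda) by case: T0 => V [].
rewrite T1sE // in T0 *.
have [hl l2 hy ly _] := Ts_domain_spec dom.
have [hx hX tight] := x1s_spec l2 (cos_gt0_piquarter hl) hy ly.
have [CY _] := ymins_spec l2.
set l := sin lambda ^+ 2 in l2 ly tight CY.
set Y := sin (ymins lambda) ^+ 2 in T0 ly tight CY *.
set X := sin (x1s _ _) ^+ 2 in T0 hX tight *.
have XY : 3 * l <= 1 -> X < Y.
  by apply: ycubic_root_leg_lt => //; case/andP: hX.
have CY0 : ycubic l Y <= 0 by rewrite CY.
have [opt /(_ CY) sq0] := optimal_intro l2 hX ly tight CY0 XY.
have [_ _ hY HK _ _ _ _] := opt.
apply: (sharp_bound_of_local hr _ T0 hY HK); first by lra.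
by apply: local_separable => //; left.
Qed.

(* The map [Y |-> Y^2 / (Y - l)] decreases on [l < Y <= 2 l], so [ymins] precedes the
   preimage of any [rho] above its image. *)
Lemma ycubic_le0 (l M XM Y X : R) : 0 < l < 2^-1 -> ycubic l M = 0 ->
  (1 - l) * M ^+ 2 = 4 * XM * (1 - XM) * (M - l) ->
  (1 - l) * Y ^+ 2 = 4 * X * (1 - X) * (Y - l) ->
  l < M -> l < Y <= 2 * l -> XM < X <= 2^-1 -> ycubic l Y <= 0.
Proof.
move=> hl CM tightM tight lM /andP[lY Y2l] /andP[XM_X X2].
rewrite leNgt -CM (ycubic_lt _ _ hl); apply/negP => MY.
have [l0 l2] := andP hl.
have a1 : 0 <= l - M / 2 by clear -MY Y2l; lra.
have a2 : 0 <= l - Y / 2 by clear -Y2l; lra.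
have M0 : 0 <= M by rewrite ltW // (lt_trans l0).
have Y0 : 0 <= Y by rewrite ltW // (lt_trans l0).
have h1 : 0 <= (Y - M) * (Y * (l - M / 2) + M * (l - Y / 2)).
  by rewrite mulr_ge0 ?subr_ge0 ?(ltW MY) // addr_ge0 // mulr_ge0.
have h2 : (1 - l) * ((Y - M) * (Y * (l - M / 2) + M * (l - Y / 2))) =
    4 * ((Y - l) * (M - l)) * ((XM - X) * (1 - X - XM)).
  transitivity ((1 - l) * M ^+ 2 * (Y - l) - (1 - l) * Y ^+ 2 * (M - l)); first by field.
  by rewrite tightM tight; ring.
have h3 : 0 <= 4 * ((Y - l) * (M - l)) * ((XM - X) * (1 - X - XM)).
  by rewrite -h2 mulr_ge0 //; clear -l2; lra.
have h4 : 0 < 4 * ((Y - l) * (M - l)) by rewrite !mulr_gt0 ?subr_gt0.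
have h5 : 0 < 1 - X - XM by clear -X2 XM_X; lra.
by move: h3; rewrite (pmulr_rge0 _ h4) (pmulr_lge0 _ h5) subr_ge0 leNgt XM_X.
Qed.

Lemma lt_of_tan_sqr_le (l Y : R) : 0 < l < 1 -> l <= (1 - l) * Y -> l < Y.
Proof.
move=> hl h; have l1 : 0 < 1 - l by clear -hl; lra.
have Y0 : 0 < Y by rewrite -(pmulr_rgt0 _ l1); clear -hl h; lra.
have lY : 0 < l * Y by rewrite mulr_gt0 //; case/andP: hl.
by rewrite mulrBl in h; lra.
Qed.

(* When the base is shorter than the legs, the regular triangle already does better. *)
Lemma local_short_base lambda rho (Y K : R) : 0 < rho < pi / 2 ->
  Y <= sin rho ^+ 2 -> 0 < sin rho ^+ 2 ->
  K * (4 * sin rho ^+ 2 - Y) = 4 * (sin rho ^+ 2) ^+ 2 ->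
  local_optimum lambda rho Y (sin rho ^+ 2) K.
Proof.
move=> hr; have loc := @local_regular R lambda rho.
move: (sin rho ^+ 2) loc => X loc YX X0 HK u v w h uv vw wu hu hv hw sep.
have [H1 H2] := loc u v w h hr uv vw wu hu hv hw sep.
have d0 : 0 < 4 * X - Y by clear -X0 YX; lra.
have EK : (4 / 3 * X - K) * (4 * X - Y) = 4 / 3 * X * (X - Y).
  by rewrite mulrBl HK; field.
have X43 : 0 < 4 / 3 * X by rewrite mulr_gt0.
have K43 : K <= 4 / 3 * X.
  by rewrite -subr_ge0 -(pmulr_lge0 _ d0) EK mulr_ge0 ?(ltW X43) // subr_ge0.
split; first exact: le_trans H1.
move=> KE; have KX : K = 4 / 3 * X by apply/eqP; rewrite eq_le K43 -KE.
have YE : X - Y = 0 by apply: (mulfI (lt0r_neq0 X43)); rewrite -EK KX subrr mul0r mulr0.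
have [|e1 e2 e3] := H2; first by rewrite KE.
by apply: Or31; split=> //; rewrite e1; apply/eqP; rewrite -subr_eq0 YE.
Qed.

(** The legs have the least length allowed, [2 * rho], which is the constrained alternative of
    [local_separable]; [ycubic_le0] supplies the slope. If the base does not exceed the legs, the
    comparison is with the regular triangle. *)
Lemma sharp_bound_T1s_inv lambda rho : 0 <= lambda <= rho -> 0 < rho < pi / 2 ->
  T1s lambda (x1s_inv lambda rho) !=set0 -> x1s lambda (ymins lambda) < rho ->
  sharp_bound lambda rho (T1s lambda (x1s_inv lambda rho)).
Proof.
move=> hlr hr T0 xr; have pi0 := pi_gt0 R.
have hl' : 0 <= lambda < pi / 2 by clear -hlr hr; lra.
have dom : Ts_domain lambda (x1s_inv lambda rho) by case: T0 => V [].
have [hl l2 hy ly at0] := Ts_domain_spec dom.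
have [yS1 xinv] : S1 lambda (x1s_inv lambda rho) /\ x1s lambda (x1s_inv lambda rho) = rho.
  (* The default [0] lies left of [asin (tan lambda)], where [T1s] is empty. *)
  have [//|y0] := pinv_spec (fun=> 0) (S1 lambda) (x1s lambda) rho.
  by case: dom => _; rewrite /x1s_inv y0 leNgt at0.
rewrite T1sE // in T0 *; rewrite xinv in T0 *.
have c0 := cos_gt0_piquarter hl.
have := x1s_spec l2 c0 hy ly; rewrite xinv; move=> [_ hX tight].
have [CM hym] := ymins_spec l2.
have lyM := ltW (ycubic_root_gt l2 CM).
have [hxM hXM tightM] := x1s_spec l2 c0 hym lyM.
have Y2l : sin (x1s_inv lambda rho) ^+ 2 <= 2 * sin lambda ^+ 2.
  have s0 : 0 <= sin lambda by apply: sin_ge0_pi; clear -hl pi0; lra.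
  have sE : (Num.sqrt 2 * sin lambda) ^+ 2 = 2 * sin lambda ^+ 2.
    by rewrite exprMn sqr_sqrtr.
  have k0 : 0 <= Num.sqrt 2 * sin lambda by rewrite mulr_ge0 // sqrtr_ge0.
  have k1 : Num.sqrt 2 * sin lambda <= 1.
    by rewrite -(@ler_pXn2r _ 2) ?nnegrE // sE expr1n; clear -l2; lra.
  have hk : 0 <= Num.sqrt 2 * sin lambda <= 1 by rewrite k0.
  have hy' : 0 <= x1s_inv lambda rho <= pi / 2 by clear -hy; lra.
  by rewrite -sE leNgt -(asin_lt hk hy') -leNgt; case/andP: yS1.
have XM : sin (x1s lambda (ymins lambda)) ^+ 2 < sin rho ^+ 2.
  by rewrite sin_sqr_lt //; clear -hxM hr pi0; lra.
have l1 : 0 < sin lambda ^+ 2 < 1 by clear -l2; lra.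
have [X0 X2] := andP hX.
have lY := lt_of_tan_sqr_le l1 ly.
have CY : ycubic (sin lambda ^+ 2) (sin (x1s_inv lambda rho) ^+ 2) <= 0.
  apply: (ycubic_le0 l2 CM tightM tight (lt_of_tan_sqr_le l1 lyM)).
    by rewrite lY.
  by rewrite XM.
have [XY|YX] := ltrP (sin rho ^+ 2) (sin (x1s_inv lambda rho) ^+ 2).
  have [opt _] := optimal_intro l2 hX ly tight CY (fun=> XY).
  have [_ _ hY HK _ _ _ _] := opt.
  apply: (sharp_bound_of_local hr hl' T0 hY HK).
  by apply: local_separable => //; right.
have Y0 : 0 < sin (x1s_inv lambda rho) ^+ 2 by apply: lt_trans lY; case/andP: l1.
have hY : 0 < sin (x1s_inv lambda rho) ^+ 2 < 2 * sin rho ^+ 2 by clear -Y0 YX X0; lra.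
have HK : (4 * (sin rho ^+ 2) ^+ 2 / (4 * sin rho ^+ 2 - sin (x1s_inv lambda rho) ^+ 2)) *
    (4 * sin rho ^+ 2 - sin (x1s_inv lambda rho) ^+ 2) = 4 * (sin rho ^+ 2) ^+ 2.
  by rewrite divfK // gt_eqF // subr_gt0; clear -YX X0; lra.
exact: (sharp_bound_of_local hr hl' T0 hY HK (local_short_base hr YX X0 HK)).
Qed.

Lemma sharp_bound_Tregs lambda rho : 0 <= lambda < pi / 2 -> 0 < rho < pi / 2 ->
  Tregs rho !=set0 -> sharp_bound lambda rho (Tregs rho).
Proof.
move=> hl hr; have pi0 := pi_gt0 R.
rewrite /Tregs trianglesE; [|lra|lra]; set X := sin rho ^+ 2 => T0.
have X0 : 0 < X by rewrite exprn_gt0 // sin_gt0_pi //; lra.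
have HK : 4 / 3 * X * (4 * X - X) = 4 * X ^+ 2 by field.
apply: (sharp_bound_of_local hr hl T0 _ HK); first by lra.
move=> u v w h uv vw wu hu hv hw sep.
have [H1 H2] := local_regular hr uv vw wu hu hv hw sep.
by split=> // /H2; apply: Or31.
Qed.

(** The squared sines of [yss] and [ybs] are the roots of this quadratic in [sin rho ^+ 2]. With
    [l = sin lambda ^+ 2] its discriminant is [(1 - l) * (9 - 25 * l)], negative for
    [sin lambda > 3 / 5]. *)
Lemma yss_ybs_quadratic_gt0 lambda rho : 0 < lambda < pi / 4 -> 0 <= rho <= pi / 2 ->
  (lambda <= asin (3 / 5) -> rho < yss lambda \/ ybs lambda < rho) ->
  0 < 4 * (sin rho ^+ 2) ^+ 2 - (3 + 5 * sin lambda ^+ 2) * sin rho ^+ 2 + 4 * sin lambda ^+ 2.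
Proof.
move=> hl hr H; have pi0 := pi_gt0 R.
have hl' : 0 <= lambda <= pi / 2 by lra.
have l2 : sin lambda ^+ 2 < 2^-1 by rewrite -sin_piquarter_sqr sin_sqr_lt; lra.
have l0 : 0 <= sin lambda ^+ 2 by exact: sqr_ge0.
have h35 : 0 <= (3 / 5 : R) <= 1 by lra.
move: H; rewrite /yss /ybs leNgt (asin_lt h35 hl').
have -> : sin lambda ^+ 4 = (sin lambda ^+ 2) ^+ 2 by rewrite -exprM.
move: (sin lambda ^+ 2) l2 l0 => l l2 l0.
set d := 9 - 34 * l + 25 * l ^+ 2.
have dE : d = (1 - l) * (9 - 25 * l) by rewrite /d; ring.
have QE (p : R) : 16 * (4 * p ^+ 2 - (3 + 5 * l) * p + 4 * l) = (8 * p - (3 + 5 * l)) ^+ 2 - d.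
  by rewrite /d; ring.
move=> H; rewrite -(@pmulr_rgt0 _ 16) // QE subr_gt0.
have [l35|l35] := ltrP ((3 / 5) ^+ 2) l.
  apply: lt_le_trans (sqr_ge0 _); rewrite dE.
  by rewrite pmulr_rlt0; lra.
have d0 : 0 <= d by rewrite dE mulr_ge0; lra.
have sd0 := sqrtr_ge0 d.
have dd : Num.sqrt d ^+ 2 = d by rewrite sqr_sqrtr.
(* This bound and the next place both roots in [[0, 1]], where [sqrt] and [asin] can be undone. *)
have sd1 : Num.sqrt d <= 3 + 5 * l.
  rewrite -(@ler_pXn2r _ 2) ?nnegrE //; last by lra.
  by rewrite dd -subr_ge0 (_ : _ - _ = 64 * l); [lra|rewrite /d; ring].
have sd2 : Num.sqrt d <= 5 - 5 * l.
  rewrite -(@ler_pXn2r _ 2) ?nnegrE //; last by lra.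
  by rewrite dd -subr_ge0 (_ : _ - _ = 16 * (1 - l)); [lra|rewrite /d; ring].
have root (E : R) : 0 <= E <= 1 -> 0 <= Num.sqrt E <= 1 /\ Num.sqrt E ^+ 2 = E.
  move=> /andP[E0 E1]; rewrite sqr_sqrtr // sqrtr_ge0 -(sqrtr1 R) ler_sqrt //.
case: H; first by rewrite -leNgt.
- have [|h1 h2] := root ((3 + 5 * l - Num.sqrt d) / 8); first by lra.
  rewrite (lt_asin h1 hr) h2 => h.
  have : Num.sqrt d ^+ 2 < (3 + 5 * l - 8 * sin rho ^+ 2) ^+ 2.
    by rewrite ltr_pXn2r ?nnegrE //; lra.
  by rewrite dd -[X in _ < X]sqrrN opprB.
- have [|h1 h2] := root ((3 + 5 * l + Num.sqrt d) / 8); first by lra.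
  rewrite (asin_lt h1 hr) h2 => h.
  have : Num.sqrt d ^+ 2 < (8 * sin rho ^+ 2 - (3 + 5 * l)) ^+ 2.
    by rewrite ltr_pXn2r ?nnegrE //; lra.
  by rewrite dd.
Qed.

Lemma sharp_bound_T2s lambda rho : 0 <= lambda < pi / 2 -> 0 < rho < pi / 2 ->
  T2s lambda rho !=set0 -> pi / 4 < rho ->
  (lambda <= asin (3 / 5) -> rho < yss lambda \/ ybs lambda < rho) ->
  sharp_bound lambda rho (T2s lambda rho).
Proof.
move=> hl hr T0 r4 H; have pi0 := pi_gt0 R.
have dom : Ts_domain lambda rho by case: T0 => V [].
have [hl4 l2 hy ly _] := Ts_domain_spec dom.
have [hx hX1 tight] := x1s_spec l2 (cos_gt0_piquarter hl4) hy ly.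
have TE : T2s lambda rho = isosceles (sin rho ^+ 2) (sin (x2s lambda rho) ^+ 2).
  rewrite -trianglesE; [|rewrite /x2s; lra|lra].
  by apply/seteqP; split=> V; [case|split].
have hr2 : 0 <= rho <= pi / 2 by lra.
have := yss_ybs_quadratic_gt0 hl4 hr2 H.
have XE : sin (x2s lambda rho) ^+ 2 = 1 - sin (x1s lambda rho) ^+ 2.
  by rewrite /x2s -cosBpihalf addrAC subrr add0r cosN cos2sin2.
rewrite TE XE in T0 *.
have p2 : 2^-1 < sin rho ^+ 2 by rewrite -sin_piquarter_sqr sin_sqr_lt //; lra.
have p1 : sin rho ^+ 2 < 1.
  by rewrite -[ltRHS](expr1n R 2) -sin_pihalf sin_sqr_lt //; lra.
set X1 := sin (x1s _ _) ^+ 2 in T0 hX1 tight *.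
have loc := @local_regular R lambda rho.
move: (sin lambda ^+ 2) l2 ly tight => l l2 ly tight.
set p := sin rho ^+ 2 in T0 tight p2 p1 ly loc * => Q0.
(* Multiplied by [p], the quadratic becomes [4 * (p - l) * (p - (1 - X1)) * (p - X1)] by tightness.
   As [X1 <= 1/2 < p], its positivity says that the legs are shorter than the base. *)
have Xp : 1 - X1 < p.
  have h1 : 0 < p * (4 * p ^+ 2 - (3 + 5 * l) * p + 4 * l).
    by apply: mulr_gt0 => //; clear -p2; lra.
  have E : p * (4 * p ^+ 2 - (3 + 5 * l) * p + 4 * l) =
     4 * (p - l) * ((p - (1 - X1)) * (p - X1)).
    transitivity ((1 - l) * p ^+ 2 - 4 * p * (1 - p) * (p - l)); first by ring.
    by rewrite tight; ring.
  have e1 : 0 < 4 * (p - l) by clear -p2 l2; lra.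
  have e3 : 0 < p - X1 by clear -p2 hX1; lra.
  by move: h1; rewrite E (pmulr_rgt0 _ e1) (pmulr_lgt0 _ e3) subr_gt0.
set X : R := 1 - X1 in T0 Xp *.
have X2 : 2^-1 <= X by rewrite /X; clear -hX1; lra.
have hY : 0 < p < 2 * X by clear -X2 p1 p2; lra.
have d0 : 0 < 4 * X - p by clear -X2 p1; lra.
pose K : R := 4 * X ^+ 2 / (4 * X - p).
have HK : K * (4 * X - p) = 4 * X ^+ 2 by rewrite /K divfK // gt_eqF.
apply: (sharp_bound_of_local hr hl T0 hY HK).
move=> u v w h uv vw wu hu hv hw sep.
have [H1 _] := loc u v w h hr uv vw wu hu hv hw sep.
have EK : (4 / 3 * p - K) * (4 * X - p) = 4 / 3 * ((3 * X - p) * (p - X)).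
  by rewrite mulrBl HK; field.
have K43 : K < 4 / 3 * p.
  rewrite -subr_gt0 -(pmulr_lgt0 _ d0) EK.
  have e1 : 0 < 3 * X - p by clear -X2 p1; lra.
  have e2 : 0 < p - X by rewrite subr_gt0.
  by rewrite mulr_gt0 // mulr_gt0.
have KH := lt_le_trans K43 H1.
by split=> [|KE]; [exact: ltW|rewrite KE ltxx in KH].
Qed.

End Cases.

Theorem theorem5 (R : realType) (lambda rho : R)
    (hlambda : 0 <= lambda <= rho) (hrho : 0 < rho < pi / 2)
    (hsum : lambda <= pi / 2 - rho) :
  [/\
    T1s lambda (ymins lambda) !=set0 ->
      lambda <= rho <= x1s lambda (ymins lambda) ->
      sharp_bound lambda rho (T1s lambda (ymins lambda)),
    T1s lambda (x1s_inv lambda rho) !=set0 ->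
      (if lambda <= asin (3 / 5)
       then x1s lambda (ymins lambda) < rho <= Num.min (yss lambda) (pi / 4)
       else x1s lambda (ymins lambda) < rho <= pi / 4) ->
      sharp_bound lambda rho (T1s lambda (x1s_inv lambda rho)),
    Tregs rho !=set0 ->
      lambda <= asin (3 / 5) -> yss lambda < rho <= ybs lambda ->
      sharp_bound lambda rho (Tregs rho) &
    T2s lambda rho !=set0 ->
      pi / 4 < rho ->
      (lambda <= asin (3 / 5) -> rho < yss lambda \/ ybs lambda < rho) ->
      sharp_bound lambda rho (T2s lambda rho)].
Proof.
have hl : 0 <= lambda < pi / 2 by lra.
split=> [T0 _|T0 H|T0 _ _|T0 H1 H2].
- exact: sharp_bound_T1s.
- apply: sharp_bound_T1s_inv => //.
  by move: H; case: ifP => _ /andP[].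
- exact: sharp_bound_Tregs.
- exact: sharp_bound_T2s.
Qed.
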